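(* Let $M^n=[0,\bar r)\times_\lambda N^{n-1}$ ($0<\bar r\le\infty$) be an $n$-dimensional warped product manifold with metric $\bar g=dr^2+\lambda(r)^2g_N$, and let $k$ be an integer with $0\le k<\frac{n-1}{2}$. Let $(\Sigma^{n-1},g)$ be a complete star-shaped hypersurface in $M$ which is contained in a slab $[r_1,r_2]\times N$, such that the generalized Einstein tensor $E_{(k)}$ of $\Sigma$ is semi-definite on $\Sigma$. Assume that the Omori-Yau maximum principle holds on $\Sigma$ for the trace type operator $\mathrm{tr}(-2E_{(k)}\nabla_g^2)$ and that the Gauss-Bonnet curvature $\mathcal{H}_{2k}$ is bounded by two positive constants, i.e. $0<C_1\le\mathcal{H}_{2k}\le C_2$ on $\Sigma$. If on $\Sigma$ $$\frac{\mathcal{H}_{2k+1}}{\mathcal{H}_{2k}}\le(n-1-2k)\frac{\lambda'(r)}{\lambda(r)}\quad\text{and}\quad|\nabla r|\le\inf_\Sigma\left((n-1-2k)\frac{\lambda'(r)}{\lambda(r)}-\frac{\mathcal{H}_{2k+1}}{\mathcal{H}_{2k}}\right),$$ then $\Sigma$ is a slice $\{r_0\}\times N$ for some $r_0\in[0,\bar r)$.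
   Context: $(N^{n-1},g_N)$ is an $(n-1)$-dimensional Riemannian manifold and $\lambda:[0,\bar r)\to\mathbb{R}_+$ is a smooth positive function; a slab is $[r_1,r_2]\times N$ with $[r_1,r_2]\subset[0,\bar r)$. A hypersurface $\Sigma^{n-1}$ of $M$ is smooth and carries the induced metric $g$ with Levi-Civita connection $\nabla$; on $\Sigma$, $r$ denotes the height function, i.e. the restriction to $\Sigma$ of the projection $M\to[0,\bar r)$, and $\nabla r$ is its gradient on $(\Sigma,g)$. $\nu$ is the outer unit normal of $\Sigma$, and $h_{ij}$ is its second fundamental form with respect to $-\nu$, i.e. $h_{ij}=\langle\bar\nabla_{e_i}\nu,e_j\rangle$, where $\bar\nabla$ is the Levi-Civita connection of $\bar g$ (so the slice $\{r\}\times N$ with $\nu=\partial_r$ has $h_{ij}=\frac{\lambda'}{\lambda}g_{ij}$). $\Sigma$ is star-shaped if it can be written as a graph over $N$, alternatively, $\langle\frac{\partial}{\partial r},\nu\rangle\ge 0$ on $\Sigma$. For an integer $0\le k\le\frac{n-1}{2}$, the Gauss-Bonnet curvature $L_k$ and the generalized Einstein tensor $E_{(k)}$ of $(\Sigma^{n-1},g)$ are $$L_k=\frac1{2^k}\delta^{i_1i_2\cdots i_{2k-1}i_{2k}}_{j_1j_2\cdots j_{2k-1}j_{2k}}{R_{i_1i_2}}^{j_1j_2}\cdots{R_{i_{2k-1}i_{2k}}}^{j_{2k-1}j_{2k}},$$ $$E_{(k)}^{ij}=-\frac1{2^{k+1}}g^{lj}\delta^{i\,i_1i_2\cdots i_{2k-1}i_{2k}}_{l\,j_1j_2\cdots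 j_{2k-1}j_{2k}}{R_{i_1i_2}}^{j_1j_2}\cdots{R_{i_{2k-1}i_{2k}}}^{j_{2k-1}j_{2k}},$$ where repeated indices are summed, $R_{ijkl}$ is the Riemann curvature tensor of $g$ with sign such that ${R_{ij}}^{ij}=R$ is the scalar curvature, and $\delta^{j_1\cdots j_r}_{i_1\cdots i_r}=\det(\delta^{j_b}_{i_a})_{a,b=1}^r$ is the generalized Kronecker delta. By convention $L_0=1$, $E_{(0)}=-\frac12 g$. One sets $$\mathcal{H}_{2k}:=L_k,\qquad \mathcal{H}_{2k+1}:=-2\sum_{i,j=1}^{n-1}E_{(k)}^{ij}h_{ij}.$$ ''Semi-definite on $\Sigma$'' means positive semi-definite everywhere on $\Sigma$ or negative semi-definite everywhere on $\Sigma$. Omori-Yau maximum principle: let $\nabla^2=\nabla_g^2$ be the Hessian on $\Sigma$ and $L=\mathrm{tr}(T\circ\nabla^2)$ with $T$ a symmetric tensor, so that for $T=-2E_{(k)}$ one has $Lu=-2E_{(k)}^{ij}\nabla_i\nabla_ju$. The Omori-Yau maximum principle holds on $\Sigma$ for $L$ if for any $u\in C^2(\Sigma)$ with $\sup_\Sigma u<+\infty$ there is a sequence $\{p_i\}_{i\in\mathbb{N}}\subset\Sigma$ such that for each $i$: (1) $u(p_i)>\sup_\Sigma u-\frac1i$, (2) $|\nabla u|(p_i)<\frac1i$, (3) $Lu(p_i)<\frac1i$. Equivalently (replacing $u$ by $-u$), for any $u\in C^2(\Sigma)$ with $\inf_\Sigma u>-\infty$ there is a sequence $\{p_i\}\subset\Sigma$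 with $u(p_i)<\inf_\Sigma u+\frac1i$, $|\nabla u|(p_i)<\frac1i$, $Lu(p_i)>-\frac1i$. *)

(* Defs.v *)
From HB Require Import structures.
From mathcomp Require Import all_boot all_order all_algebra.
From mathcomp Require Import all_classical all_reals all_analysis.

Set Implicit Arguments.
Unset Strict Implicit.
Unset Printing Implicit Defensive.

Import Order.TTheory GRing.Theory Num.Theory.
Import numFieldNormedType.Exports.

Local Open Scope ring_scope.
Local Open Scope classical_set_scope.

(* Vectors are rows; 'J f y i j is the i-th partial derivative of the j-th
   component of f, so that jacobians act on tangent vectors by v *m 'J f y. *)

Section Calculus.
Variables (R : realType) (m : nat).
Implicit Types (U : set 'rV[R]_m) (f : 'rV[R]_m -> R).

Definition pd (i : 'I_m) f (y : 'rV[R]_m) : R := 'D_(delta_mx 0 i) f y.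

Definition iter_pd (s : seq 'I_m) f : 'rV[R]_m -> R := foldr pd f s.

Definition Ck (k : nat) U f : Prop :=
  forall (s : seq 'I_m) (y : 'rV[R]_m), U y ->
    ((size s <= k)%N -> {for y, continuous (iter_pd s f)}) /\
    ((size s < k)%N ->
       forall i : 'I_m, derivable (iter_pd s f) y (delta_mx 0 i)).

Definition smooth U f : Prop := forall k, Ck k U f.

Definition smooth_map (p : nat) U (f : 'rV[R]_m -> 'rV[R]_p) : Prop :=
  forall j : 'I_p, smooth U (fun y => f y 0 j).

End Calculus.

(* The metric is given by its matrix field G in one coordinate system. *)
Section LocalGeometry.
Variables (R : realType) (m : nat).
Implicit Types (G : 'rV[R]_m -> 'M[R]_m) (y : 'rV[R]_m).

Definition norm_in (g : 'M[R]_m) (v : 'rV[R]_m) : R :=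
  Num.sqrt ((v *m g *m v^T) 0 0).

(* Gamma^k_{ij} *)
Definition christoffel G y (k i j : 'I_m) : R :=
  2^-1 * \sum_l invmx (G y) k l *
    (pd i (fun z => G z j l) y + pd j (fun z => G z i l) y
     - pd l (fun z => G z i j) y).

(* the d_k component of
   R(d_i, d_j) d_l = nabla_i nabla_j d_l - nabla_j nabla_i d_l *)
Definition curvature G y (i j l k : 'I_m) : R :=
  pd i (fun z => christoffel G z k j l) y
  - pd j (fun z => christoffel G z k i l) y
  + \sum_s (christoffel G y k i s * christoffel G y s j l
            - christoffel G y k j s * christoffel G y s i l).

(* R_{ij}^{kl}; the contraction R_{ij}^{ij} is the scalar curvature, which is
   positive on round spheres *)
Definition riem G y (i j k l : 'I_m) : R :=
  \sum_q invmx (G y) l q * curvature G y i j q k.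

Definition hessian G (u : 'rV[R]_m -> R) y : 'M[R]_m :=
  \matrix_(i, j) (pd i (pd j u) y - \sum_k christoffel G y k i j * pd k u y).

Definition gradient G (u : 'rV[R]_m -> R) y : 'rV[R]_m :=
  \row_i \sum_j invmx (G y) i j * pd j u y.

Definition gdelta (r : nat) (I J : 'I_r -> 'I_m) : R :=
  \det (\matrix_(a, b) (I a == J b)%:R).

Lemma evP (k : nat) (a : 'I_k) : (a.*2 < k.*2)%N.
Proof. by rewrite ltn_double. Qed.

Lemma odP (k : nat) (a : 'I_k) : (a.*2.+1 < k.*2)%N.
Proof. by rewrite ltn_Sdouble. Qed.

Definition ev (k : nat) (a : 'I_k) : 'I_(k.*2) := Ordinal (evP a).
Definition od (k : nat) (a : 'I_k) : 'I_(k.*2) := Ordinal (odP a).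

Definition riem_prod (k : nat) G y (I J : 'I_(k.*2) -> 'I_m) : R :=
  \prod_(a < k) riem G y (I (ev a)) (I (od a)) (J (ev a)) (J (od a)).

Definition gauss_bonnet (k : nat) G y : R :=
  (2 ^+ k)^-1 *
  \sum_(I : {ffun 'I_(k.*2) -> 'I_m}) \sum_(J : {ffun 'I_(k.*2) -> 'I_m})
     gdelta I J * riem_prod G y I J.

(* the index string i, I_0, I_1, ... *)
Definition icons (r : nat) (i : 'I_m) (I : 'I_r -> 'I_m) (a : 'I_r.+1) : 'I_m :=
  if unlift ord0 a is Some b then I b else i.

(* upper indices *)
Definition einstein (k : nat) G y : 'M[R]_m :=
  \matrix_(i, j) (- (2 ^+ k.+1)^-1 *
  \sum_l invmx (G y) l j *
  \sum_(I : {ffun 'I_(k.*2) -> 'I_m}) \sum_(J : {ffun 'I_(k.*2) -> 'I_m})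
     gdelta (icons i I) (icons l J) * riem_prod G y I J).

End LocalGeometry.

(* Connected smooth manifolds without boundary.  A chart a is a homeomorphism
   phi a from the open set dom a onto the open set phi a @` dom a, with inverse
   psi a; chart_at selects a chart around each point, in which pointwise
   quantities are evaluated. *)
Record manifold (R : realType) (m : nat) := Manifold {
  point :> topologicalType;
  chart : Type;
  dom : chart -> set point;
  phi : chart -> point -> 'rV[R]_m;
  psi : chart -> 'rV[R]_m -> point;
  chart_at : point -> chart;
  chart_atP : forall x, dom (chart_at x) x;
  dom_open : forall a, open (dom a);
  img_open : forall a, open (phi a @` dom a);
  phi_continuous : forall a x, dom a x -> {for x, continuous (phi a)};
  psi_continuous : forall a y, (phi a @` dom a) y -> {for y, continuous (psi a)};
  phiK : forall a x, dom a x -> psi a (phi a x) = x;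
  transition_smooth : forall a b,
    smooth_map [set y | (phi a @` dom a) y /\ dom b (psi a y)] (phi b \o psi a);
  manifold_hausdorff : hausdorff_space point;
  manifold_second_countable : @second_countable point;
  manifold_nonempty : [set: point] !=set0;
  manifold_connected : connected [set: point]
}.

Arguments chart {R m} _.
Arguments dom {R m _}.
Arguments phi {R m _}.
Arguments psi {R m _}.
Arguments chart_at {R m _}.

Definition img (R : realType) m (X : manifold R m) (a : chart X)
  : set 'rV[R]_m := phi a @` dom a.

(* covariant 2-tensors, as families of matrix fields in the charts *)
Definition tensor2 (R : realType) m (X : manifold R m) : Type :=
  chart X -> 'rV[R]_m -> 'M[R]_m.

Record riemannian_metric (R : realType) m (X : manifold R m) := RiemannianMetric {
  gcomp : tensor2 X;
  metric_smooth : forall a (i j : 'I_m), smooth (img a) (fun y => gcomp a y i j);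
  metric_sym : forall a y, img a y -> (gcomp a y)^T = gcomp a y;
  metric_pos : forall a y, img a y -> forall v : 'rV[R]_m, v != 0 ->
    0 < (v *m gcomp a y *m v^T) 0 0;
  metric_transition : forall a b y, img a y -> dom b (psi a y) ->
    gcomp a y = 'J (phi b \o psi a) y *m gcomp b (phi b (psi a y))
                *m ('J (phi b \o psi a) y)^T
}.

Section Manifold.
Variables (R : realType) (m : nat) (X : manifold R m) (g : tensor2 X).

Definition coord_at (p : X) : 'rV[R]_m := phi (chart_at p) p.

Definition metric_at (p : X) : 'M[R]_m := g (chart_at p) (coord_at p).

Definition Ck_fun (k : nat) (u : X -> R) : Prop :=
  forall a, Ck k (img a) (u \o psi a).

Definition norm_grad (u : X -> R) (p : X) : R :=
  norm_in (metric_at p)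
    (gradient (g (chart_at p)) (u \o psi (chart_at p)) (coord_at p)).

(* tr (T o nabla^2 u) = T^{ij} nabla_i nabla_j u; T p has upper indices and is
   expressed in chart_at p *)
Definition trace_op (T : X -> 'M[R]_m) (u : X -> R) (p : X) : R :=
  \sum_i \sum_j T p i j *
    hessian (g (chart_at p)) (u \o psi (chart_at p)) (coord_at p) i j.

Definition omori_yau (L : (X -> R) -> X -> R) : Prop :=
  forall u : X -> R, Ck_fun 2 u -> has_ubound (range u) ->
  exists p : nat -> X, forall i : nat, (0 < i)%N ->
    [/\ sup (range u) - i%:R^-1 < u (p i),
        norm_grad u (p i) < i%:R^-1
      & L u (p i) < i%:R^-1].

Definition C1_curve (c : R -> X) : Prop :=
  continuous c /\
  forall a t, dom a (c t) ->
    derivable (phi a \o c) t 1 /\ {for t, continuous (derive1 (phi a \o c))}.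

Definition speed (c : R -> X) (t : R) : R :=
  norm_in (metric_at (c t)) (derive1 (phi (chart_at (c t)) \o c) t).

Definition curve_length (c : R -> X) : R :=
  \int[@lebesgue_measure R]_(t in `[0, 1]) speed c t.

Definition dist (p q : X) : R :=
  inf [set curve_length c | c in [set c | [/\ C1_curve c, c 0 = p & c 1 = q]]].

Definition complete_metric : Prop :=
  forall x : nat -> X,
    (forall e : R, 0 < e -> exists K : nat,
       forall i j, (K <= i)%N -> (K <= j)%N -> dist (x i) (x j) < e) ->
    exists p : X, x @ \oo --> p.

Definition semi_definite (T : X -> 'M[R]_m) : Prop :=
  (forall p (v : 'rV[R]_m), 0 <= (v *m T p *m v^T) 0 0) \/
  (forall p (v : 'rV[R]_m), (v *m T p *m v^T) 0 0 <= 0).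

Definition GB_curvature (k : nat) (p : X) : R :=
  gauss_bonnet k (g (chart_at p)) (coord_at p).

Definition einstein_tensor (k : nat) (p : X) : 'M[R]_m :=
  einstein k (g (chart_at p)) (coord_at p).

End Manifold.

(* lam stands for one of its smooth extensions to an open interval containing
   [0, rbar), whose derivatives at 0 are the one-sided ones. *)
Definition warping_function (R : realType) (rbar : \bar R) (lam : R -> R) : Prop :=
  (exists2 e : R, 0 < e &
     forall (k : nat) (x : R), - e < x -> (x%:E < rbar)%E ->
       derivable (derive1n k lam) x 1) /\
  (forall x : R, 0 <= x -> (x%:E < rbar)%E -> 0 < lam x).

(* A chart b of N gives the coordinates (r, phi b x) on R x N; the hypersurface
   is the image of the manifold S under F = (r, pi) : S -> [0, rbar) x N. *)
Section Hypersurface.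
Variables (R : realType) (m : nat) (N : manifold R m) (gN : riemannian_metric N).
Variables (rbar : \bar R) (lam : R -> R).
Variables (S : manifold R m) (F : S -> R * N).

Definition wcoord (b : chart N) (q : R * N) : 'rV[R]_(1 + m) :=
  row_mx (q.1)%:M (phi b q.2).

(* dr^2 + lam(r)^2 gN *)
Definition wmetric (b : chart N) (z : 'rV[R]_(1 + m)) : 'M[R]_(1 + m) :=
  block_mx 1%:M 0 0 (lam (lsubmx z 0 0) ^+ 2 *: gcomp gN b (rsubmx z)).

Definition wtransition (b b' : chart N) (z : 'rV[R]_(1 + m)) : 'rV[R]_(1 + m) :=
  row_mx (lsubmx z) (phi b' (psi b (rsubmx z))).

Definition Floc (a : chart S) (b : chart N) (y : 'rV[R]_m) : 'rV[R]_(1 + m) :=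
  wcoord b (F (psi a y)).

Definition Fdom (a : chart S) (b : chart N) : set 'rV[R]_m :=
  [set y | img a y /\ dom b (F (psi a y)).2].

(* S may be immersed; embedded hypersurfaces are those with F a homeomorphism
   onto its image. *)
Definition hypersurface : Prop :=
  [/\ forall p, 0 <= (F p).1 /\ ((F p).1%:E < rbar)%E,
      continuous F,
      forall a b, smooth_map (Fdom a b) (Floc a b)
    & forall a b y, Fdom a b y -> row_free ('J (Floc a b) y)].

Definition height (p : S) : R := (F p).1.

(* The right-hand side does not depend on the chart of N used. *)
Definition induced_metric : tensor2 S := fun a y =>
  let b := chart_at (F (psi a y)).2 in
  'J (Floc a b) y *m wmetric b (Floc a b y) *m ('J (Floc a b) y)^T.

(* nu b p consists of the components of nu(p), a tangent vector of R x N at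
   F p, in the coordinates given by b. *)
Variable nu : chart N -> S -> 'rV[R]_(1 + m).

Definition unit_normal : Prop :=
  [/\ forall a b, smooth_map (Fdom a b) (nu b \o psi a),
      forall b b' p, dom b (F p).2 -> dom b' (F p).2 ->
        nu b' p = nu b p *m 'J (wtransition b b') (wcoord b (F p)),
      forall a b y, Fdom a b y ->
        'J (Floc a b) y *m wmetric b (Floc a b y) *m (nu b (psi a y))^T = 0
    & forall b p, dom b (F p).2 ->
        norm_in (wmetric b (wcoord b (F p))) (nu b p) = 1].

(* <d/dr, nu> *)
Definition angle (p : S) : R :=
  let b := chart_at (F p).2 in
  ((row_mx 1%:M 0 : 'rV[R]_(1 + m)) *m wmetric b (wcoord b (F p))
     *m (nu b p)^T) 0 0.

(* For a graph over N the outer unit normal is the one satisfying this. *)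
Definition star_shaped : Prop := forall p, 0 <= angle p.

(* row i: the covariant derivative along F of nu in the direction e_i *)
Definition covariant_normal (p : S) : 'M[R]_(m, 1 + m) :=
  let a := chart_at p in let b := chart_at (F p).2 in
  let y := coord_at p in
  \matrix_(i, A) ('J (nu b \o psi a) y i A +
    \sum_B \sum_C christoffel (wmetric b) (Floc a b y) A B C *
                  'J (Floc a b) y i B * nu b p 0 C).

(* h_ij = < nabla_{e_i} nu, e_j > *)
Definition second_ff (p : S) : 'M[R]_m :=
  let a := chart_at p in let b := chart_at (F p).2 in
  let y := coord_at p in
  covariant_normal p *m wmetric b (Floc a b y) *m ('J (Floc a b) y)^T.

Definition H_even (k : nat) (p : S) : R := GB_curvature induced_metric k p.

Definition H_odd (k : nat) (p : S) : R :=
  - 2 * \sum_i \sum_j einstein_tensor induced_metric k p i j * second_ff p i j.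

End Hypersurface.

(* Main.v *)
Require Import Defs.
From HB Require Import structures.
From mathcomp Require Import all_boot all_order all_algebra.
From mathcomp Require Import all_classical all_reals all_analysis.
From mathcomp Require Import ring lra.

Set Implicit Arguments.
Unset Strict Implicit.
Unset Printing Implicit Defensive.

Import Order.TTheory GRing.Theory Num.Theory.
Import numFieldNormedType.Exports.

Local Open Scope ring_scope.
Local Open Scope classical_set_scope.

(** Write lambda for the warping function, r for the height, nu for the unit
    normal, h for the second fundamental form, theta = <d/dr, nu>, m = n - 1 for
    the dimension and T = -2 E_(k); let Phi be a primitive of lambda and
    L = tr (T o nabla^2).

    The Gauss formula in a warped product gives
      nabla^2 Phi(r) = lambda'(r) g - lambda(r) theta h
    (lemma [height_hessian], combined with [pd2_comp]), and the contraction of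
    the generalized Kronecker delta gives tr (T g) = (m - 2k) H_2k
    ([einstein_trace]).  Hence, with A = (m - 2k) lambda'/lambda and
    D = A - H_(2k+1) / H_2k,
      L Phi(r) = lambda H_2k ((1 - theta) A + theta D)
    ([trace_op_Phi_height]).  Moreover |grad Phi(r)| = lambda |grad r| and
    |grad r|^2 + theta^2 = 1 with theta >= 0, so where |grad Phi(r)| is small
    theta is close to 1 and the term (1 - theta) A is negligible.  Along the
    sequence that the Omori-Yau principle provides for Phi(r), the upper bound
    on L Phi(r) therefore forces inf D <= 0 ([inf_deficit_le0]).  Since |grad r|
    is bounded by inf D, the gradient vanishes and r is a constant r0.

    It remains to see that a complete hypersurface contained in the slice
    r = r0 fills it, that is, that its projection to N is onto.  The projection
    multiplies lengths by 1 / lambda(r0) and has invertible differential.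
    Instead of lifting paths, one minimizes.  In a small chart ball of N that
    meets the image, let z be any point and f the distance in the chart from
    the projection to z.  From a point with f > 0 one can move on the
    hypersurface so that f decreases at a rate bounded below with respect to
    the length travelled ([lift_step]).  On a complete manifold Caristi's
    argument ([caristi]) then yields a point where f vanishes, so z is in the
    image ([slice_covers]).  Thus the image is open and closed in the connected
    manifold N.

    The distance is an infimum over C^1 curves, which cannot be concatenated
    freely.  Distances are therefore estimated through curves of speed at most 1
    that are at rest near both ends ([reach]): these can be concatenated, and
    their travelling times add up. *)

(** * Functions with continuous partial derivatives *)

Section Calc.
Variable R : realType.

Lemma is_derive_line (V W : normedModType R) (f : V -> W) (y v : V) (t : R) :
  derivable f (y + t *: v) v ->
  is_derive t (1 : R) (fun s : R => f (y + s *: v)) ('D_v f (y + t *: v)).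
Proof.
have E : (fun h : R => h^-1 *: (((fun s : R => f (y + s *: v)) \o shift t) h%:A
                          - f (y + t *: v))) =
         (fun h : R => h^-1 *: ((f \o shift (y + t *: v)) (h *: v)
                          - f (y + t *: v))).
  apply/funext => h /=; congr (_ *: (f _ - _)).
  by rewrite [h%:A]mulr1 scalerDl addrCA.
by move=> d; split; [rewrite /derivable E | rewrite /derive E].
Qed.

Lemma derivable_scale_dir (V W : normedModType R) (f : V -> W) (z v : V) (h : R) :
  derivable f z v -> is_derive z (h *: v) f (h *: 'D_v f z).
Proof.
move=> d.
have d1 : is_derive (0:R) (1:R) (fun s : R => f (z + s *: v)) ('D_v f z).
  have := @is_derive_line _ _ f z v 0; rewrite scale0r addr0; exact.
have [->|h0] := eqVneq h 0; first by rewrite !scale0r; exact: is_derive0.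
move: d1 => [d1 e1].
have E : (fun k : R => k^-1 *: ((f \o shift z) (k *: (h *: v)) - f z)) =
   (fun k => h *: (k^-1 *: (((f \o shift z) (k *: v)) - f z))) \o ( *%R^~ h).
  apply/funext => k /=.
  by rewrite !scalerA invfM mulrCA mulfV// mulr1.
have C : (fun k : R => k^-1 *: ((f \o shift z) (k *: (h *: v)) - f z)) @ 0^'
    --> h *: 'D_v f z.
  rewrite E; apply: (@cvg_comp _ _ _ _ _ _ 0^'); last first.
    by apply: cvgZl_tmp; exact: d.
  move=> A /= [e e0 eA]; exists (e / `|h|) => /=; first by rewrite divr_gt0// normr_gt0.
  move=> k /=; rewrite sub0r normrN => kh k0; apply: eA => /=.
    by rewrite sub0r normrN normrM -ltr_pdivlMr// normr_gt0.
  by rewrite mulf_neq0.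
split; first by apply/cvg_ex; exists (h *: 'D_v f z).
exact/cvg_lim.
Qed.

(** The mean value theorem on the segment from [y] to [y + v]. *)
Lemma MVT_line (V : normedModType R) (f : V -> R) (y v : V) :
  (forall t, 0 <= t <= 1 -> derivable f (y + t *: v) v) ->
  exists2 t, 0 <= t <= 1 & f (y + v) - f y = 'D_v f (y + t *: v).
Proof.
move=> d.
have [x||c] := @MVT_segment R (fun s => f (y + s *: v)) (fun t => 'D_v f (y + t *: v)) 0 1 ler01.
- rewrite in_itv /= => /andP[x0 x1]; apply: is_derive_line; apply: d.
  by rewrite !ltW.
- apply: derivable_within_continuous => x; rewrite in_itv /= => x01.
  by have [] := is_derive_line (d x x01).
rewrite in_itv /= => c01; rewrite scale1r scale0r addr0 subr0 mulr1 => E.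
by exists c.
Qed.

Lemma norm_row_ge m (h : 'rV[R]_m) i : `|h 0 i| <= `|h|.
Proof. by rewrite [leRHS]/Num.Def.normr/= mx_normrE; exact: (le_bigmax _ _ (0, i)). Qed.

Lemma norm_row_le m (h : 'rV[R]_m) e : 0 <= e -> (forall i, `|h 0 i| <= e) -> `|h| <= e.
Proof.
move=> e0 H; rewrite /Num.Def.normr/= mx_normrE (bigmax_le _ e0)//= => -[i j] _ /=.
by rewrite ord1.
Qed.

(** Frechet differentiability from an explicit candidate for the differential. *)
Lemma differentiable_of_bound (V W : normedModType R) (f : V -> W)
    (L : {linear V -> W}) (y : V) :
  continuous L ->
  (forall e : R, 0 < e -> \forall h \near (0 : V),
     `|f (h + y) - (f y + L h)| <= e * `|h|) ->
  differentiable f y.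
Proof.
move=> Lc H.
suff K : f \o shift y = cst (f y) + L +o_ 0 id.
  have E := diff_unique Lc K.
  by apply/diff_locallyP; rewrite E.
by apply/eqaddoP => _/posnumP[e]; exact: H.
Qed.

Lemma cvg_sum_fin (T : Type) (G : set_system T) (FG : Filter G) n
    (f : 'I_n -> T -> R) (l : 'I_n -> R) :
  (forall i, f i x @[x --> G] --> l i) ->
  \sum_i f i x @[x --> G] --> \sum_i l i.
Proof.
by move=> H; apply: (@cvg_big R 'I_n +%R) => //; exact: add_continuous.
Qed.

End Calc.

Section C1diff.
Variables (R : realType) (m : nat).
Implicit Types (f : 'rV[R]_m -> R) (y h : 'rV[R]_m).

(* the vector whose first k coordinates are those of h, the others being 0 *)
Let P (h : 'rV[R]_m) (k : nat) : 'rV[R]_m := \row_j (if (j < k)%N then h 0 j else 0).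

Let P_step h (k : 'I_m) t : `|P h k + (t *: (h 0 k *: delta_mx 0 k))| <= `|h| * Num.max 1 `|t|.
Proof.
apply: norm_row_le => [|j]; first by rewrite mulr_ge0// le_max ler01.
have hj := norm_row_ge h.
have M1 : 1 <= Num.max 1 `|t| by rewrite le_max lexx.
have Mt : `|t| <= Num.max 1 `|t| by rewrite le_max lexx orbT.
rewrite !mxE eqxx /=; case: (eqVneq j k) => [->|jk].
  by rewrite ltnn add0r mulr1 normrM mulrC ler_pM.
rewrite !mulr0 addr0; case: ifP => _; last by rewrite normr0 mulr_ge0// le_max ler01.
by rewrite -[leLHS]mulr1 ler_pM.
Qed.

Let P_telescope f y h :
  f (y + h) - f y = \sum_(k < m) (f (y + (P h k + h 0 k *: delta_mx 0 k)) - f (y + P h k)).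
Proof.
have Pm : P h m = h by apply/rowP => j; rewrite mxE ltn_ord.
have P0 : P h 0 = 0 by apply/rowP => j; rewrite !mxE.
rewrite -{1}Pm -[X in _ - f X]addr0 -[X in _ - f (_ + X)]P0.
rewrite -(@telescope_sumr _ 0 m (fun k => f (y + P h k)))// big_mkord.
apply: eq_bigr => k _; congr (f (y + _) - _).
apply/rowP => j; rewrite !mxE eqxx /= ltnS leq_eqVlt.
have [->|jk] := eqVneq j k; first by rewrite ltnn eqxx /= add0r mulr1.
have -> : (j == k :> nat) = false by apply/negbTE.
by rewrite mulr0 addr0.
Qed.

(** The increment is telescoped along the coordinate directions, and the mean
    value theorem is applied to each step. *)
Lemma C1_differentiable f y :
  (forall i : 'I_m, \forall z \near y, derivable f z (delta_mx 0 i)) ->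
  (forall i : 'I_m, {for y, continuous (pd i f)}) ->
  differentiable f y.
Proof.
move=> df cf.
pose L (h : 'rV[R]_m) : R := \sum_i h 0 i * pd i f y.
have Llin : linear L.
  move=> a u v; rewrite /L scaler_sumr -big_split /=; apply: eq_bigr => i _.
  by rewrite !mxE mulrDl -mulrA.
pose Lb := GRing.isLinear.Build _ _ _ _ _ Llin.
pose LL : {linear 'rV[R]_m -> R} := HB.pack L Lb.
have Lc : continuous LL.
  move=> h; apply: (@cvg_sum_fin R _ (nbhs h) _ m
    (fun i (x : 'rV[R]_m) => x 0 i * pd i f y)) => i.
  apply: cvgM; last exact: cvg_cst.
  exact: coord_continuous.
apply: (differentiable_of_bound (L := LL)) => // e e0.
have e1 : 0 < e / (m%:R + 1) by rewrite divr_gt0// ltr_wpDl.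
have : \forall z \near y, forall i : 'I_m, derivable f z (delta_mx 0 i) /\
   `|pd i f y - pd i f z| < e / (m%:R + 1).
  apply: (@filter_forall _ _ (fun i z => derivable f z (delta_mx 0 i) /\
   `|pd i f y - pd i f z| < e / (m%:R + 1)) (nbhs y)) => i.
  apply: filterI; first exact: df.
  by move/cvgrPdist_lt: (cf i) => /(_ _ e1); exact.
move=> /nbhs_ballP[d /= d0 Hd].
apply/nbhs_ballP; exists d => //= h.
rewrite -ball_normE /= sub0r normrN => hd.
rewrite [h + y]addrC opprD addrA.
rewrite P_telescope /LL /= /L -sumrB.
have K (k : 'I_m) : `|f (y + (P h k + h 0 k *: delta_mx 0 k)) - f (y + P h k) - h 0 k * pd k f y|
     <= `|h| * (e / (m%:R + 1)).
  have B (t : R) : 0 <= t <= 1 -> ball y d (y + P h k + t *: (h 0 k *: delta_mx 0 k)).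
    move=> /andP[t0 t1]; rewrite -ball_normE /= opprD addrA opprD addrA subrr sub0r -opprD normrN.
    apply: le_lt_trans (P_step _ _ _) _.
    by rewrite max_l ?mulr1// ger0_norm.
  have dd (t : R) : 0 <= t <= 1 -> derivable f (y + P h k + t *: (h 0 k *: delta_mx 0 k)) (h 0 k *: delta_mx 0 k).
    by move=> /B/Hd/(_ k)[/derivable_scale_dir D _]; have [] := D (h 0 k).
  have [t t01 E] := MVT_line dd.
  have [D1 D2] := Hd _ (B t t01) k.
  have [_ D3] := derivable_scale_dir (h 0 k) D1.
  rewrite addrA E D3 -mulrBr normrM ler_pM// ?norm_row_ge//.
  by rewrite distrC ltW.
apply: le_trans (ler_norm_sum _ _ _) _.
apply: (@le_trans _ _ (\sum_(k < m) (`|h| * (e / (m%:R + 1))))).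
  by apply: ler_sum => k _; exact: K.
have M : e / (m%:R + 1) * m%:R <= e.
  by rewrite mulrAC ler_pdivrMr ?ltr_wpDl// ler_pM2l// lerDl.
by rewrite sumr_const card_ord -mulrnAr -(mulr_natr (e / _)) mulrC ler_wpM2r.
Qed.

End C1diff.

(** * Symmetry of second partial derivatives *)

Section Clairaut.
Variables (R : realType) (m : nat).
Implicit Types (f : 'rV[R]_m -> R) (y : 'rV[R]_m).

Lemma is_derive_translate (V W : normedModType R) (f : V -> W) (z v w : V) :
  derivable f (z + w) v ->
  is_derive z v (fun x => f (x + w)) ('D_v f (z + w)).
Proof.
have E : (fun h : R => h^-1 *: (((fun x => f (x + w)) \o shift z) (h *: v) - f (z + w))) =
         (fun h : R => h^-1 *: ((f \o shift (z + w)) (h *: v) - f (z + w))).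
  by apply/funext => h /=; rewrite addrA.
by move=> d; split; [rewrite /derivable E | rewrite /derive E].
Qed.

(* Both mixed partials are limits of this expression, symmetric in i and j,
   divided by t ^ 2. *)
Let second_difference (i j : 'I_m) f y (t : R) :=
  f (y + t *: 'e_i + t *: 'e_j) - f (y + t *: 'e_i) - f (y + t *: 'e_j) + f y.

Lemma norm_delta (i : 'I_m) : `|'e_i : 'rV[R]_m| <= 1.
Proof.
by apply: norm_row_le => // j; rewrite mxE eqxx; case: (j == i); rewrite ?normr1 ?normr0.
Qed.

Let second_difference_approx i j f y :
  (\forall z \near y, derivable f z 'e_i /\ derivable (pd i f) z 'e_j) ->
  {for y, continuous (pd j (pd i f))} ->
  forall e, 0 < e -> exists2 d : R, 0 < d & forall t, 0 < t < d ->
    `|second_difference i j f y t - t ^+ 2 * pd j (pd i f) y| <= e * t ^+ 2.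
Proof.
move=> df cf e e0.
have : \forall z \near y, (derivable f z 'e_i /\ derivable (pd i f) z 'e_j) /\
    `|pd j (pd i f) y - pd j (pd i f) z| < e.
  apply: filterI => //.
  by move: cf => /cvgrPdist_lt/(_ e e0).
move=> /nbhs_ballP[d /= d0 Hd].
exists (d / 2); first by rewrite divr_gt0.
move=> t /andP[t0 td].
have B (a b : R) : 0 <= a <= 1 -> 0 <= b <= 1 ->
    ball y d (y + a *: (t *: 'e_i) + b *: (t *: 'e_j)).
  move=> /andP[a0 a1] /andP[b0 b1].
  rewrite -ball_normE /= -addrA opprD addrA subrr sub0r normrN.
  apply: le_lt_trans (ler_normD _ _) _.
  have K (c : R) k : 0 <= c -> c <= 1 -> `|c *: (t *: 'e_k) : 'rV[R]_m| <= t.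
    move=> c0 c1; rewrite scalerA normrZ ger0_norm ?mulr_ge0 ?(ltW t0)//.
    apply: (@le_trans _ _ (c * t)).
      by rewrite ler_piMr ?mulr_ge0 ?(ltW t0)// norm_delta.
    by rewrite ler_piMl// ltW.
  by have := K a i a0 a1; have := K b j b0 b1; lra.
have B1 (a : R) : 0 <= a <= 1 -> ball y d (y + a *: (t *: 'e_i)).
  by move=> a01; have := B a 0 a01; rewrite lexx ler01 scale0r addr0; exact.
have B2 (a : R) : 0 <= a <= 1 -> ball y d (y + a *: (t *: 'e_i) + t *: 'e_j).
  by move=> a01; have := B a 1 a01; rewrite lexx ler01 scale1r; exact.
pose phi z := f (z + t *: 'e_j) - f z.
have dphi (s : R) : 0 <= s <= 1 -> is_derive (y + s *: (t *: 'e_i)) (t *: 'e_i) phi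
   (t *: pd i f (y + s *: (t *: 'e_i) + t *: 'e_j) - t *: pd i f (y + s *: (t *: 'e_i))).
  move=> s01; have [[D1 _] _] := Hd _ (B1 _ s01); have [[D2 _] _] := Hd _ (B2 _ s01).
  have [d1 e1] := derivable_scale_dir t D2.
  have A : is_derive (y + s *: (t *: 'e_i)) (t *: 'e_i) (fun z => f (z + t *: 'e_j))
      (t *: pd i f (y + s *: (t *: 'e_i) + t *: 'e_j)).
    by rewrite -[X in is_derive _ _ _ X]e1; exact: is_derive_translate.
  exact: is_deriveB A (derivable_scale_dir t D1).
have [s s01] := MVT_line (fun s s01 => @ex_derive _ _ _ _ _ _ _ (dphi s s01)).
rewrite (@derive_val _ _ _ _ _ _ _ (dphi s s01)) -scalerBr.
have dd (r : R) : 0 <= r <= 1 -> is_derive (y + s *: (t *: 'e_i) + r *: (t *: 'e_j)) (t *: 'e_j)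
    (pd i f) (t *: pd j (pd i f) (y + s *: (t *: 'e_i) + r *: (t *: 'e_j))).
  by move=> r01; have [[_ D] _] := Hd _ (B _ _ s01 r01); exact: derivable_scale_dir.
have [r r01] := MVT_line (fun r r01 => @ex_derive _ _ _ _ _ _ _ (dd r r01)).
rewrite (@derive_val _ _ _ _ _ _ _ (dd r r01)) => -> E.
have -> : second_difference i j f y t =
  t ^+ 2 * pd j (pd i f) (y + s *: (t *: 'e_i) + r *: (t *: 'e_j)).
  rewrite expr2 -mulrA -[RHS]E /phi /second_difference; ring.
have [_ K] := Hd _ (B _ _ s01 r01).
move: K; move: (pd j (pd i f) y) (pd j (pd i f) _) => D1 D2 K.
have t20 : 0 <= t ^+ 2 by rewrite exprn_ge0// ltW.
rewrite -mulrBr normrM (ger0_norm t20) mulrC ler_wpM2r//.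
by rewrite distrC ltW.
Qed.

(** Symmetry of the second partial derivatives that are continuous at the point
    under consideration. *)
Lemma clairaut i j f y :
  (\forall z \near y, [/\ derivable f z 'e_i, derivable f z 'e_j,
     derivable (pd i f) z 'e_j & derivable (pd j f) z 'e_i]) ->
  {for y, continuous (pd j (pd i f))} -> {for y, continuous (pd i (pd j f))} ->
  pd i (pd j f) y = pd j (pd i f) y.
Proof.
move=> df c1 c2.
apply/eqP; rewrite -subr_eq0 -normr_eq0; apply/negPn/negP => n0.
set D := pd i (pd j f) y - pd j (pd i f) y in n0 *.
have D0 : 0 < `|D| by rewrite lt_neqAle eq_sym n0 normr_ge0.
have e0 : 0 < `|D| / 4 by rewrite divr_gt0.
have [|d1 d10 H1] := @second_difference_approx i j f y _ c1 _ e0.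
  by apply: filterS df => z [].
have [|d2 d20 H2] := @second_difference_approx j i f y _ c2 _ e0.
  by apply: filterS df => z [].
pose t := Num.min d1 d2 / 2.
have m0 : 0 < Num.min d1 d2 by rewrite lt_min d10 d20.
have t0 : 0 < t by rewrite divr_gt0.
have tm : t < Num.min d1 d2 by rewrite /t; lra.
move: (tm); rewrite lt_min => /andP[t1 t2].
have {}H1 := H1 t; have {}H2 := H2 t; rewrite t0 t1 /= in H1; rewrite t0 t2 /= in H2.
have {}H1 := H1 isT; have {}H2 := H2 isT.
have E : second_difference j i f y t = second_difference i j f y t.
  by rewrite /second_difference [y + t *: 'e_j + t *: 'e_i]addrAC; ring.
have := le_trans (ler_distD (second_difference i j f y t) (t ^+ 2 * pd i (pd j f) y) _)
   (lerD (_ : _ <= `|D| / 4 * t ^+ 2) H1).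
rewrite distrC -E => /(_ H2); rewrite -mulrBr normrM -/D.
rewrite ger0_norm ?exprn_ge0 ?(ltW t0)// -mulrDl [leLHS]mulrC ler_pM2r ?exprn_gt0//.
by move: (`|D|) D0 {H1 H2 E df c1 c2 tm} => x x0; lra.
Qed.

End Clairaut.

(** * Chain rules and smooth maps *)

Section Chain.
Variable R : realType.

Lemma deriveE_pd m (f : 'rV[R]_m -> R) (y v : 'rV[R]_m) :
  differentiable f y -> 'D_v f y = \sum_i v 0 i * pd i f y.
Proof.
move=> df; rewrite deriveE// {1}[v]row_sum_delta linear_sum; apply: eq_bigr => i _.
by rewrite linearZ -deriveE.
Qed.

Lemma differentiable_row (V : normedModType R) p (X : V -> 'rV[R]_p) y :
  (forall j, differentiable (fun x => X x 0 j) y) -> differentiable X y.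
Proof.
move=> dX.
have -> : X = \sum_(j < p) (fun x => X x 0 j *: ('e_j : 'rV[R]_p)).
  apply/funext => x; rewrite fct_sumE; exact: row_sum_delta.
by apply: differentiable_sum => j; apply: differentiableZl.
Qed.

Lemma differentiable_entry (V : normedModType R) p (X : V -> 'rV[R]_p) y j :
  differentiable X y -> differentiable (fun x => X x 0 j) y.
Proof.
move=> dX; apply: (@differentiable_comp _ _ _ _ X (fun M : 'rV[R]_p => M 0 j)) => //.
exact: differentiable_coord.
Qed.

Lemma derive_entry (V : normedModType R) p (X : V -> 'rV[R]_p) y v j :
  differentiable X y -> ('D_v X y) 0 j = 'D_v (fun x => X x 0 j) y.
Proof. by move=> dX; rewrite derive_mx ?mxE//; exact: diff_derivable. Qed.

Lemma jacobianE m p (X : 'rV[R]_m -> 'rV[R]_p) y i j :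
  differentiable X y -> 'J X y i j = pd i (fun x => X x 0 j) y.
Proof.
move=> dX; rewrite /pd -derive_entry// deriveEjacobian//.
by rewrite -rowE [RHS]mxE.
Qed.

Lemma derive_comp_pd (V : normedModType R) p (X : V -> 'rV[R]_p) (f : 'rV[R]_p -> R) y v :
  differentiable X y -> differentiable f (X y) ->
  'D_v (f \o X) y = \sum_j pd j f (X y) * 'D_v (fun x => X x 0 j) y.
Proof.
move=> dX df; rewrite deriveE; last exact: differentiable_comp.
rewrite diff_comp//= -deriveE// deriveE_pd//; apply: eq_bigr => j _.
by rewrite -deriveE// derive_entry// mulrC.
Qed.

Lemma derive_comp_jacobian (V : normedModType R) p q (X : V -> 'rV[R]_p)
   (g : 'rV[R]_p -> 'rV[R]_q) y v :
  differentiable X y -> differentiable g (X y) ->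
  'D_v (g \o X) y = 'D_v X y *m 'J g (X y).
Proof.
move=> dX dg; rewrite deriveE; last exact: differentiable_comp.
by rewrite diff_comp//= -deriveE// -deriveE// deriveEjacobian.
Qed.

Lemma jacobian_comp m p q (X : 'rV[R]_m -> 'rV[R]_p)
   (g : 'rV[R]_p -> 'rV[R]_q) y :
  differentiable X y -> differentiable g (X y) ->
  'J (g \o X) y = 'J X y *m 'J g (X y).
Proof.
move=> dX dg; apply/row_matrixP => i; rewrite !rowE mulmxA.
rewrite -(deriveEjacobian _ dX) -derive_comp_jacobian// deriveEjacobian//.
exact: differentiable_comp.
Qed.

End Chain.

Lemma continuous_near (T V : topologicalType) (f h : T -> V) t :
  (\forall s \near t, f s = h s) -> {for t, continuous f} -> {for t, continuous h}.
Proof.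
move=> fh cf A; rewrite -(nbhs_singleton fh) => /cf fA.
suff : \forall z \near t, A (h z) by [].
have {}fA : \forall z \near t, A (f z) by [].
by apply: filterS2 fh fA => z ->.
Qed.

Section Smooth.
Variables (R : realType) (m : nat).
Implicit Types (U : set 'rV[R]_m) (f : 'rV[R]_m -> R).

(** [iter_pd] applies the last index of the string first. *)
Lemma iter_pd_rcons s i f : iter_pd (rcons s i) f = iter_pd s (pd i f).
Proof. by rewrite /iter_pd -cats1 foldr_cat. Qed.

Lemma Ck_pd k U f i : Ck k.+1 U f -> Ck k U (pd i f).
Proof.
move=> H s y Uy; have := H (rcons s i) y Uy.
by rewrite iter_pd_rcons size_rcons.
Qed.

Lemma smooth_pd U f i : smooth U f -> smooth U (pd i f).
Proof. by move=> H k; apply: Ck_pd; exact: H. Qed.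

Lemma smooth_derivable U f y i : smooth U f -> U y -> derivable f y 'e_i.
Proof. by move=> H Uy; have [_] := H 1%N [::] y Uy; exact. Qed.

Lemma smooth_continuous U f y : smooth U f -> U y -> {for y, continuous f}.
Proof. by move=> H Uy; have [+ _] := H 1%N [::] y Uy; exact. Qed.

Lemma Ck1_differentiable U f y : open U -> Ck 1 U f -> U y -> differentiable f y.
Proof.
move=> oU H Uy; apply: C1_differentiable => i.
  by apply: filterS (open_nbhs_nbhs (conj oU Uy)) => z Uz; have [_] := H [::] z Uz; exact.
by have [+ _] := H [:: i] y Uy; exact.
Qed.

Lemma smooth_differentiable U f y : open U -> smooth U f -> U y -> differentiable f y.
Proof. by move=> oU H; exact: Ck1_differentiable. Qed.

Lemma smooth_clairaut U f y i j : open U -> smooth U f -> U y ->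
  pd i (pd j f) y = pd j (pd i f) y.
Proof.
move=> oU H Uy; have Hp l := smooth_pd l H; apply: clairaut.
- apply: filterS (open_nbhs_nbhs (conj oU Uy)) => z Uz.
  split; [exact: smooth_derivable H Uz | exact: smooth_derivable H Uz | |].
    exact: smooth_derivable (Hp i) Uz.
  exact: smooth_derivable (Hp j) Uz.
- exact: smooth_continuous (smooth_pd _ (Hp _)) Uy.
- exact: smooth_continuous (smooth_pd _ (Hp _)) Uy.
Qed.

Lemma smooth_map_differentiable p U (X : 'rV[R]_m -> 'rV[R]_p) y :
  open U -> smooth_map U X -> U y -> differentiable X y.
Proof.
move=> oU H Uy; apply: differentiable_row => j.
exact: (smooth_differentiable oU).
Qed.

Lemma pd_near_eq f g y i : (\forall z \near y, f z = g z) -> pd i f y = pd i g y.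
Proof. by move=> fg; exact: near_eq_derive. Qed.

End Smooth.

(** * Bilinear forms and Christoffel symbols *)

Section Bilinear.
Variables (R : realType).

(** The bilinear form of matrix [G], on row vectors. *)
Definition bil q (G : 'M[R]_q) (u v : 'rV[R]_q) : R := (u *m G *m v^T) 0 0.

Lemma bilE q (G : 'M[R]_q) u v : bil G u v = \sum_A \sum_B u 0 A * G A B * v 0 B.
Proof.
rewrite /bil mxE exchange_big /=; apply: eq_bigr => B _.
by rewrite !mxE mulr_suml.
Qed.

Lemma bilC q (G : 'M[R]_q) u v : G^T = G -> bil G u v = bil G v u.
Proof.
move=> sG; rewrite /bil.
have -> : (u *m G *m v^T) 0 0 = ((u *m G *m v^T)^T) 0 0 by rewrite [RHS]mxE.
by rewrite !trmx_mul trmxK sG mulmxA.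
Qed.

Lemma bilDl q (G : 'M[R]_q) u v w : bil G (u + v) w = bil G u w + bil G v w.
Proof. by rewrite /bil !mulmxDl mxE. Qed.
Lemma bilBl q (G : 'M[R]_q) u v w : bil G (u - v) w = bil G u w - bil G v w.
Proof. by rewrite /bil !mulmxBl !mxE. Qed.
Lemma bilZl q (G : 'M[R]_q) a u w : bil G (a *: u) w = a * bil G u w.
Proof. by rewrite /bil -!scalemxAl mxE. Qed.
Lemma bilDr q (G : 'M[R]_q) u v w : bil G u (v + w) = bil G u v + bil G u w.
Proof. by rewrite /bil linearD mulmxDr mxE. Qed.
Lemma bilZr q (G : 'M[R]_q) a u w : bil G u (a *: w) = a * bil G u w.
Proof. by rewrite /bil linearZ -scalemxAr mxE. Qed.
Lemma bil_suml q (G : 'M[R]_q) n (f : 'I_n -> 'rV[R]_q) w :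
  bil G (\sum_i f i) w = \sum_i bil G (f i) w.
Proof. by rewrite /bil !mulmx_suml summxE. Qed.

Lemma bil_entry n1 n2 q (A : 'M[R]_(n1, q)) (B : 'M[R]_(n2, q)) (G : 'M[R]_q) i j :
  (A *m G *m B^T) i j = bil G (row i A) (row j B).
Proof.
rewrite /bil -row_mul mxE [RHS]mxE; apply: eq_bigr => k _.
congr (_ * _); first by rewrite [RHS]mxE.
by rewrite [LHS]mxE [RHS]mxE [RHS]mxE.
Qed.

Lemma entry_row n q (A : 'rV[R]_q) (B : 'M[R]_(n, q)) i :
  (A *m B^T) 0 i = (A *m (row i B)^T) 0 0.
Proof.
rewrite mxE [RHS]mxE; apply: eq_bigr => k _; congr (_ * _).
by rewrite [LHS]mxE [RHS]mxE [RHS]mxE.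
Qed.

Lemma bil0l q (G : 'M[R]_q) w : bil G 0 w = 0.
Proof. by rewrite /bil !mul0mx mxE. Qed.

Lemma bil0r q (G : 'M[R]_q) w : bil G w 0 = 0.
Proof. by rewrite /bil trmx0 mulmx0 mxE. Qed.

(** The norm of a gradient: raising the index of [du] turns the inverse metric
    into the metric. *)
Lemma bil_raise n (G : 'M[R]_n) (du : 'rV[R]_n) :
  G \in unitmx -> G^T = G ->
  bil G (du *m invmx G) (du *m invmx G) = bil (invmx G) du du.
Proof.
move=> uG sG; have E : (du *m invmx G)^T = invmx G *m du^T.
  by rewrite trmx_mul trmx_inv sG.
by rewrite /bil E mulmxKV// mulmxA.
Qed.

Lemma is_derive_sum_fun (V : normedModType R) n (h : 'I_n -> V -> R) x v (dh : 'I_n -> R) :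
  (forall i, is_derive x v (h i) (dh i)) ->
  is_derive x v (fun z => \sum_i h i z) (\sum_i dh i).
Proof.
move=> H; have -> : (fun z => \sum_i h i z) = \sum_i h i.
  by apply/funext => z; rewrite fct_sumE.
exact: is_derive_sum.
Qed.

(** The derivative at [x] of the matrix field [G] in the direction [w], written
    with the partial derivatives of its entries. *)
Definition dmx q (G : 'rV[R]_q -> 'M[R]_q) (x w : 'rV[R]_q) : 'M[R]_q :=
  \matrix_(A, B) \sum_C w 0 C * pd C (fun z => G z A B) x.

(** Product rule for [G (P, Q)] along a map [X]. *)
Lemma is_derive_bil m q (G : 'rV[R]_q -> 'M[R]_q) (X P Q : 'rV[R]_m -> 'rV[R]_q)
   (y v : 'rV[R]_m) :
  (forall A B, differentiable (fun z => G z A B) (X y)) ->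
  differentiable X y -> 
  (forall A, derivable (fun z => P z 0 A) y v) ->
  (forall A, derivable (fun z => Q z 0 A) y v) ->
  is_derive y v (fun z => bil (G (X z)) (P z) (Q z))
   (bil (G (X y)) (\row_A 'D_v (fun z => P z 0 A) y) (Q y)
    + bil (dmx G (X y) (\row_A 'D_v (fun z => X z 0 A) y)) (P y) (Q y)
    + bil (G (X y)) (P y) (\row_A 'D_v (fun z => Q z 0 A) y)).
Proof.
move=> dG dX dP dQ.
have -> : (fun z => bil (G (X z)) (P z) (Q z)) =
   (fun z => \sum_A \sum_B ((fun z => P z 0 A) * (fun z => G (X z) A B)
       * (fun z => Q z 0 B) : 'rV[R]_m -> R) z).
  by apply/funext => z; rewrite bilE.
rewrite !bilE -!big_split /=.
apply: is_derive_sum_fun => A; rewrite -!big_split /=; apply: is_derive_sum_fun => B.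
have dGX : is_derive y v (fun z => G (X z) A B)
    (dmx G (X y) (\row_A 'D_v (fun z => X z 0 A) y) A B).
  split; first by apply: diff_derivable; apply: (@differentiable_comp _ _ _ _ X (fun z => G z A B)).
  rewrite (@derive_comp_pd _ _ _ X (fun z => G z A B))// mxE; apply: eq_bigr => C _.
  by rewrite mxE mulrC.
have iP := derivableP (dP A); have iQ := derivableP (dQ B).
apply: is_derive_eq; rewrite /GRing.scale /= !mxE !fctE; ring.
Qed.

Lemma dmx_sym q (G : 'rV[R]_q -> 'M[R]_q) x w :
  (\forall z \near x, (G z)^T = G z) -> (dmx G x w)^T = dmx G x w.
Proof.
move=> sG; apply/matrixP => A B; rewrite !mxE; apply: eq_bigr => C _.
congr (_ * _); apply: near_eq_derive; apply: filterS sG => z E.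
by rewrite -[in LHS]E mxE.
Qed.

(** The Christoffel symbols of [G] at [x] applied to two vectors. *)
Definition chr q (G : 'rV[R]_q -> 'M[R]_q) x (u v : 'rV[R]_q) : 'rV[R]_q :=
  \row_A \sum_B \sum_C christoffel G x A B C * u 0 B * v 0 C.

Lemma bil_dmx_delta q (G : 'rV[R]_q -> 'M[R]_q) x (u v w : 'rV[R]_q) :
  bil (dmx G x w) u v =
  \sum_A \sum_B \sum_C (u 0 A * v 0 B * w 0 C) * pd C (fun z => G z A B) x.
Proof.
rewrite bilE; apply: eq_bigr => A _; apply: eq_bigr => B _; rewrite mxE.
rewrite mulr_sumr mulr_suml; apply: eq_bigr => C _; ring.
Qed.

(** The first Christoffel identity: lowering the index of the Christoffel
    symbols leaves derivatives of the metric only. *)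
Lemma bil_chr q (G : 'rV[R]_q -> 'M[R]_q) x (u v w : 'rV[R]_q) :
  G x \in unitmx -> (G x)^T = G x ->
  bil (G x) (chr G x u v) w =
  2^-1 * (bil (dmx G x u) v w + bil (dmx G x v) u w - bil (dmx G x w) u v).
Proof.
move=> uG sG.
pose c B C D : R := pd B (fun z => G z C D) x + pd C (fun z => G z B D) x
     - pd D (fun z => G z B C) x.
(* the contraction with G cancels the inverse matrix in the definition *)
have low B C D : \sum_A christoffel G x A B C * G x A D = 2^-1 * c B C D.
  transitivity (2^-1 * \sum_A \sum_l (G x A D * invmx (G x) A l) * c B C l).
    rewrite mulr_sumr; apply: eq_bigr => A _; rewrite /christoffel -mulrA.
    congr (_ * _); rewrite mulr_suml; apply: eq_bigr => l _; rewrite /c; ring.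
  congr (_ * _); rewrite exchange_big /=.
  transitivity (\sum_l (D == l)%:R * c B C l).
    apply: eq_bigr => l _; rewrite -mulr_suml; congr (_ * _).
    have := mulmxV uG => /matrixP/(_ D l); rewrite !mxE => <-.
    by apply: eq_bigr => A _; rewrite -{1}sG mxE.
  rewrite (bigD1 D)//= eqxx mul1r big1 ?addr0// => l.
  by rewrite eq_sym => /negbTE ->; rewrite mul0r.
transitivity (\sum_D \sum_B \sum_C (u 0 B * v 0 C * w 0 D) * (2^-1 * c B C D)).
  rewrite bilE exchange_big /=; apply: eq_bigr => D _.
  under eq_bigr => A _ do rewrite mxE -mulrA mulr_suml.
  rewrite exchange_big /=; apply: eq_bigr => B _.
  under eq_bigr => A _ do rewrite mulr_suml.
  rewrite exchange_big /=; apply: eq_bigr => C _.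
  rewrite -low mulr_sumr; apply: eq_bigr => A _; ring.
have E1 : bil (dmx G x u) v w =
  \sum_D \sum_B \sum_C (u 0 B * v 0 C * w 0 D) * pd B (fun z => G z C D) x.
  rewrite bil_dmx_delta exchange_big /=; apply: eq_bigr => D _.
  rewrite exchange_big /=; apply: eq_bigr => B _; apply: eq_bigr => C _; ring.
have E2 : bil (dmx G x v) u w =
  \sum_D \sum_B \sum_C (u 0 B * v 0 C * w 0 D) * pd C (fun z => G z B D) x.
  rewrite bil_dmx_delta exchange_big /=; apply: eq_bigr => D _.
  apply: eq_bigr => B _; apply: eq_bigr => C _; ring.
have E3 : bil (dmx G x w) u v =
  \sum_D \sum_B \sum_C (u 0 B * v 0 C * w 0 D) * pd D (fun z => G z B C) x.
  rewrite bil_dmx_delta.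
  under eq_bigr => A _ do rewrite exchange_big /=.
  rewrite exchange_big /=.
  by apply: eq_bigr => D _; apply: eq_bigr => B _; apply: eq_bigr => C _.
rewrite E1 E2 E3 -big_split -sumrB mulr_sumr; apply: eq_bigr => D _ /=.
rewrite -big_split -sumrB mulr_sumr; apply: eq_bigr => B _ /=.
rewrite -big_split -sumrB mulr_sumr; apply: eq_bigr => C _ /=.
rewrite /c; ring.
Qed.

End Bilinear.

(** * The Gauss formula in coordinates *)

(** The cancellation behind [sff_vec_tangent]: [a], [c], [e] are products of a
    second derivative of the immersion with a tangent vector, [d1], [d2], [d3]
    derivatives of the ambient metric. *)
Lemma koszul_cancel (R : realFieldType) (a a' c c' e e' d1 d2 d3 : R) :
  a' = a -> c' = c -> e' = e ->
  a + 2^-1 * (d1 + d2 - d3)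
    - 2^-1 * ((a + d1 + c) + (a' + d2 + e) - (c' + d3 + e')) = 0.
Proof. by move=> -> -> ->; lra. Qed.

(** The cancellation behind [sff_vec_normal]; the last hypothesis is the
    derivative of the orthogonality of the normal to a tangent vector. *)
Lemma weingarten_cancel (R : realFieldType) (a b b' d1 d1' d2 d3 : R) :
  b' = b -> d1' = d1 -> a + d1 + b' = 0 ->
  a + 2^-1 * (d1 + d2 - d3) - 0 = - (b + 2^-1 * (d1' + d3 - d2)).
Proof. by move=> -> -> ?; lra. Qed.

Section Gauss.
Variables (R : realType) (m q : nat).
Variables (U : set 'rV[R]_m) (X : 'rV[R]_m -> 'rV[R]_q) (y : 'rV[R]_m).
Variable (G : 'rV[R]_q -> 'M[R]_q).
Hypotheses (oU : open U) (Uy : U y) (sX : smooth_map U X).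
Hypothesis dG : forall A B, differentiable (fun z => G z A B) (X y).
Hypothesis symG : \forall z \near X y, (G z)^T = G z.
Hypothesis unitG : G (X y) \in unitmx.

(** The coordinate tangent vector d_j X of the immersion [X]. *)
Definition tanv (z : 'rV[R]_m) (j : 'I_m) : 'rV[R]_q :=
  \row_A pd j (fun z => X z 0 A) z.

(** The second partial derivatives of [X] at [y], as a vector of components. *)
Definition hessv (i j : 'I_m) : 'rV[R]_q :=
  \row_A pd i (pd j (fun z => X z 0 A)) y.

Lemma tanvE z j : U z -> tanv z j = row j ('J X z).
Proof.
move=> Uz; apply/rowP => A; rewrite [LHS]mxE [RHS]mxE jacobianE//.
exact: (smooth_map_differentiable oU sX Uz).
Qed.

Let symGy : (G (X y))^T = G (X y).
Proof. exact: nbhs_singleton symG. Qed.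

Let dX : differentiable X y.
Proof. exact: (smooth_map_differentiable oU sX Uy). Qed.

Let dtanv j A v : derivable (fun z => tanv z j 0 A) y v.
Proof.
apply: diff_derivable.
have -> : (fun z => tanv z j 0 A) = pd j (fun z => X z 0 A).
  by apply/funext => z; rewrite mxE.
exact: (smooth_differentiable oU (smooth_pd _ (sX A)) Uy).
Qed.

Let hessv_sym i j : hessv i j = hessv j i.
Proof.
apply/rowP => A; rewrite [LHS]mxE [RHS]mxE.
exact: (smooth_clairaut i j oU (sX A) Uy).
Qed.

Let dtanvE i j : (\row_A 'D_('e_i) (fun z => tanv z j 0 A) y) = hessv i j.
Proof.
apply/rowP => A; rewrite !mxE; apply: near_eq_derive.
by near=> z; rewrite mxE.
Unshelve. all: by end_near. Qed.

(** The ambient metric at [X y], and its derivative in a direction [w]. *)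
Definition amb u v := bil (G (X y)) u v.
Definition damb w u v := bil (dmx G (X y) w) u v.
Local Notation B := amb.
Local Notation Dt := damb.
Let BC u v : B u v = B v u. Proof. exact: bilC. Qed.
Let DC w u v : Dt w u v = Dt w v u.
Proof. by apply: bilC; exact: dmx_sym. Qed.

Section Induced.
Variable g : 'rV[R]_m -> 'M[R]_m.
Hypothesis gE : forall z, U z -> g z = 'J X z *m G (X z) *m ('J X z)^T.
Hypothesis unitg : g y \in unitmx.

Let gEntry z i j : U z -> g z i j = bil (G (X z)) (tanv z i) (tanv z j).
Proof. by move=> Uz; rewrite gE// bil_entry -!tanvE. Qed.

Let pd_g i j l : pd i (fun z => g z j l) y =
  B (hessv i j) (tanv y l) + Dt (tanv y i) (tanv y j) (tanv y l) + B (tanv y j) (hessv i l).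
Proof.
transitivity (pd i (fun z => bil (G (X z)) (tanv z j) (tanv z l)) y).
  by apply: pd_near_eq; apply: filterS (open_nbhs_nbhs (conj oU Uy)) => z Uz; rewrite gEntry.
have H := is_derive_bil dG dX (fun A => @dtanv j A 'e_i) (fun A => @dtanv l A 'e_i).
have E := @derive_val _ _ _ _ _ _ _ H.
rewrite /amb /damb -(dtanvE i j) -(dtanvE i l).
exact: E.
Qed.

Let tanvD i : (\row_A 'D_('e_i) (fun z => X z 0 A) y) = tanv y i.
Proof. by []. Qed.

(** The vector-valued second fundamental form: the ambient covariant second
    derivative of [X] minus its tangential part, the latter being computed with
    the Christoffel symbols of the induced metric [g]. *)
Definition sff_vec i j : 'rV[R]_q :=
  hessv i j + chr G (X y) (tanv y i) (tanv y j)
  - \sum_k christoffel g y k i j *: tanv y k.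

Let BE u v : bil (G (X y)) u v = B u v. Proof. by []. Qed.
Let BDl u v w : B (u + v) w = B u w + B v w. Proof. exact: bilDl. Qed.
Let BBl u v w : B (u - v) w = B u w - B v w. Proof. exact: bilBl. Qed.
Let BZl (a : R) u w : B (a *: u) w = a * B u w. Proof. exact: bilZl. Qed.
Let B_suml n (f : 'I_n -> 'rV[R]_q) w : B (\sum_i f i) w = \sum_i B (f i) w.
Proof. exact: bil_suml. Qed.
Let B_chr u v w : B (chr G (X y) u v) w = 2^-1 * (Dt u v w + Dt v u w - Dt w u v).
Proof. exact: bil_chr. Qed.
Let gB i j : g y i j = B (tanv y i) (tanv y j). Proof. exact: gEntry. Qed.

Let DE w u v : bil (dmx G (X y) w) u v = Dt w u v. Proof. by []. Qed.

(** The second fundamental form is orthogonal to the tangent space: in the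
    directions d_l X the Christoffel symbols of [g] are the tangential part of
    the ambient covariant derivative. *)
Lemma sff_vec_tangent i j l : B (sff_vec i j) (tanv y l) = 0.
Proof.
rewrite BBl BDl B_chr.
have -> : B (\sum_k christoffel g y k i j *: tanv y k) (tanv y l) =
   2^-1 * (pd i (fun z => g z j l) y + pd j (fun z => g z i l) y - pd l (fun z => g z i j) y).
  rewrite B_suml.
  transitivity (2^-1 * \sum_k \sum_s (g y k l * invmx (g y) k s) *
     (pd i (fun z => g z j s) y + pd j (fun z => g z i s) y - pd s (fun z => g z i j) y)).
    rewrite mulr_sumr; apply: eq_bigr => k _.
    rewrite BZl /christoffel -mulrA; congr (_ * _).
    rewrite mulr_suml; apply: eq_bigr => s _; rewrite gB; ring.
  congr (_ * _); rewrite exchange_big /=.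
  have sg k : g y k l = g y l k by rewrite !gB BC.
  transitivity (\sum_s (l == s)%:R * (pd i (fun z => g z j s) y +
      pd j (fun z => g z i s) y - pd s (fun z => g z i j) y)).
    apply: eq_bigr => s _; rewrite -mulr_suml; congr (_ * _).
    have := mulmxV unitg => /matrixP/(_ l s); rewrite !mxE => <-.
    by apply: eq_bigr => k _; rewrite sg.
  rewrite (bigD1 l)//= eqxx mul1r big1 ?addr0// => s.
  by rewrite eq_sym => /negbTE ->; rewrite mul0r.
rewrite !pd_g.
apply: koszul_cancel; first by rewrite (hessv_sym j i).
  by rewrite (hessv_sym l i) BC.
by rewrite (hessv_sym l j).
Qed.

Variable nu : 'rV[R]_m -> 'rV[R]_q.
Hypothesis dnu : differentiable nu y.
Hypothesis tnu : forall z, U z -> 'J X z *m G (X z) *m (nu z)^T = 0.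

Let Btnu z j : U z -> bil (G (X z)) (tanv z j) (nu z) = 0.
Proof.
move=> Uz; rewrite /bil tanvE// -row_mul -row_mul tnu//.
by rewrite !mxE.
Qed.

(** The Weingarten equation, for a field [nu] of normal vectors; the vector on
    the right is the covariant derivative of [nu] along d_i X. *)
Lemma sff_vec_normal i j : B (sff_vec i j) (nu y) =
  - B (\row_A pd i (fun z => nu z 0 A) y + chr G (X y) (tanv y i) (nu y)) (tanv y j).
Proof.
rewrite BBl !BDl !B_chr.
have -> : B (\sum_k christoffel g y k i j *: tanv y k) (nu y) = 0.
  by rewrite B_suml big1// => k _; rewrite BZl -BE Btnu// mulr0.
have H := is_derive_bil dG dX (fun A => @dtanv j A 'e_i)
   (fun A => @diff_derivable _ _ _ _ _ 'e_i (differentiable_entry A dnu)).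
have : pd i (fun z => bil (G (X z)) (tanv z j) (nu z)) y = 0.
  rewrite (@pd_near_eq _ _ _ (cst 0)); first by rewrite /pd derive_cst.
  by apply: filterS (open_nbhs_nbhs (conj oU Uy)) => z Uz; rewrite Btnu.
have D := @derive_val _ _ _ _ _ _ _ H; rewrite dtanvE in D.
rewrite [pd i _ y]D.
rewrite tanvD.
by rewrite !BE DE; apply: weingarten_cancel; [exact: BC | exact: DC].
Qed.

End Induced.
End Gauss.

(** * Splitting along a hyperplane and its normal *)

Section NormalSplitting.
Variables (R : realType) (m : nat).
Variables (G : 'M[R]_(1 + m)) (J : 'M[R]_(m, 1 + m)) (nu : 'rV[R]_(1 + m)).
Hypotheses (uG : G \in unitmx) (sG : G^T = G).
Let g := J *m G *m J^T.
Hypothesis ug : g \in unitmx.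
Hypotheses (tn : J *m G *m nu^T = 0) (n1 : bil G nu nu = 1).

Let nt : nu *m G *m J^T = 0.
Proof. by apply: trmx_inj; rewrite !trmx_mul trmxK sG mulmxA tn trmx0. Qed.

Let bil_mx u v : u *m G *m v^T = (bil G u v)%:M.
Proof. exact: mx11_scalar. Qed.

(** The rows of [J] together with [nu] form a basis, since their Gram matrix is
    block diagonal with the invertible blocks 1 and [g]. *)
Lemma orthogonal_frame_eq0 (t : 'rV[R]_(1 + m)) :
  t *m G *m J^T = 0 -> bil G t nu = 0 -> t = 0.
Proof.
move=> tJ tnu.
pose M : 'M[R]_(1 + m) := col_mx nu J.
have MM : M *m G *m M^T = block_mx 1%:M 0 0 g.
  by rewrite /M mul_col_mx tr_col_mx mul_col_row bil_mx n1 nt tn.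
have uM : M \in unitmx.
  have : M *m G *m M^T \in unitmx.
    rewrite MM unitmxE det_ublock det1 mul1r -unitmxE; exact: ug.
  by rewrite !unitmx_mul => /andP[/andP[]].
have : t *m G *m M^T = 0.
  by rewrite /M tr_col_mx mul_mx_row tJ bil_mx tnu raddf0 row_mx0.
move/(congr1 (mulmx^~ (invmx M^T))); rewrite mul0mx mulmxK ?unitmx_tr//.
by move/(congr1 (mulmx^~ (invmx G))); rewrite mul0mx mulmxK.
Qed.

(** A vector orthogonal to the rows of [J] is a multiple of [nu]. *)
Lemma normal_vector_eq (Z e : 'rV[R]_(1 + m)) :
  Z *m G *m J^T = 0 -> bil G Z e = bil G Z nu * bil G nu e.
Proof.
move=> ZJ.
suff : Z - bil G Z nu *: nu = 0 by move/subr0_eq => {1}->; rewrite bilZl.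
apply: orthogonal_frame_eq0.
  by rewrite !mulmxBl ZJ -!scalemxAl nt scaler0 subr0.
by rewrite bilBl bilZl n1 mulr1 subrr.
Qed.

(** Pythagoras: the tangential part of [e] is measured by the inverse of the Gram
    matrix applied to the products of [e] with the rows of [J]. *)
Lemma norm_split (e : 'rV[R]_(1 + m)) :
  bil G e e = bil (invmx g) (e *m G *m J^T) (e *m G *m J^T) + bil G e nu ^+ 2.
Proof.
have sg : g^T = g by rewrite /g !trmx_mul trmxK sG mulmxA.
pose w := e *m G *m J^T *m invmx g.
have wg : w *m J *m G *m J^T = e *m G *m J^T.
  have -> : w *m J *m G *m J^T = w *m g by rewrite /g !mulmxA.
  by rewrite /w mulmxKV.
have E : e - w *m J - bil G e nu *: nu = 0.
  apply: orthogonal_frame_eq0.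
    by rewrite !mulmxBl wg -!scalemxAl nt scaler0 subr0 subrr.
  rewrite !bilBl bilZl n1 mulr1.
  have -> : bil G (w *m J) nu = 0.
    rewrite /bil.
    have -> : w *m J *m G *m nu^T = w *m (J *m G *m nu^T) by rewrite !mulmxA.
    by rewrite tn mulmx0 mxE.
  by rewrite subr0 subrr.
have {E} E : e = w *m J + bil G e nu *: nu.
  by move/subr0_eq: E => <-; rewrite addrC subrK.
rewrite {2}E bilDr bilZr -expr2; congr (_ + _).
have wT : w^T = invmx g *m (e *m G *m J^T)^T by rewrite /w trmx_mul trmx_inv sg.
by rewrite /bil trmx_mul wT !mulmxA.
Qed.

End NormalSplitting.

(** * The trace of the Einstein tensor *)

Section Bordered.

(** The determinant of a bordered matrix, up to the factor [\det D]: multiply by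
    a block matrix built from the adjugate of [D]. *)
Lemma det_bordered_mul (T : comNzRingType) r (c : T) (u : 'rV[T]_r) (v : 'cV[T]_r) (D : 'M[T]_r) :
  \det (block_mx c%:M u v D) * \det D =
  (c * \det D - (u *m \adj D *m v) 0 0) * \det D.
Proof.
pose K := block_mx (\det D)%:M 0 (- (\adj D *m v)) 1%:M : 'M[T]_(1 + r).
have dK : \det K = \det D by rewrite det_lblock det1 mulr1 det_scalar1.
rewrite -[X in _ * X = _]dK -det_mulmx mulmx_block.
rewrite mulmx0 !mulmx1 add0r mulmx0 add0r !mulmxN !mulmxA mul_mx_adj.
rewrite (mul_mx_scalar _ v) (mul_scalar_mx _ v) subrr det_ublock; congr (_ * _).
by rewrite -scalar_mxM [u *m _ *m _]mx11_scalar -raddfB det_scalar1 [in RHS]mxE eqxx mulr1n.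
Qed.

Lemma det_bordered (F : fieldType) r (c : F) (u : 'rV[F]_r) (v : 'cV[F]_r) (D : 'M[F]_r) :
  \det (block_mx c%:M u v D) = c * \det D - (u *m \adj D *m v) 0 0.
Proof.
(* the factor det D is cancelled for the generic matrix X + D, whose
   determinant is a characteristic polynomial, and then X is set to 0 *)
pose P := map_mx (@polyC F).
pose D' : 'M[{poly F}]_r := 'X%:M + P _ _ D.
have dD' : \det D' != 0.
  have -> : D' = char_poly_mx (- D) by rewrite /D' /P /char_poly_mx map_mxN opprK.
  by rewrite -/(char_poly _) monic_neq0// char_poly_monic.
have := det_bordered_mul c%:P (P _ _ u) (P _ _ v) D' => /(mulIf dD').
pose ev : {rmorphism {poly F} -> F} := horner_eval (0 : F).
have evP p q (A : 'M[F]_(p, q)) : map_mx ev (P _ _ A) = A.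
  by apply/matrixP => i j; rewrite !mxE /ev /= /horner_eval hornerC.
have evD : map_mx ev D' = D.
  by rewrite /D' map_mxD evP map_scalar_mx /= /horner_eval hornerX raddf0 add0r.
move/(congr1 ev); rewrite -det_map_mx map_block_mx evD !evP map_scalar_mx.
have evc (a : F) : ev a%:P = a by rewrite /ev /= /horner_eval hornerC.
clearbody ev.
rewrite evc rmorphB rmorphM evc -det_map_mx evD => ->; congr (_ - _).
transitivity ((map_mx ev (P _ _ u *m \adj D' *m P _ _ v)) 0 0); first by rewrite [RHS]mxE.
by rewrite !map_mxM /= map_mx_adj evD !evP.
Qed.

(** Contracting one pair of indices of the generalized Kronecker delta of order
    [r.+1].  The first row and column border the matrix of the delta of order
    [r]; summed over [i], the corrections add up to the trace of
    [\adj D *m D]. *)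
Lemma gdelta_contract (R : realType) m r (I J : 'I_r -> 'I_m) :
  \sum_i gdelta R (icons i I) (icons i J) = (m%:R - r%:R) * gdelta R I J.
Proof.
pose D : 'M[R]_r := \matrix_(a, b) (I a == J b)%:R.
have E i : gdelta R (icons i I) (icons i J) =
    \det D - \sum_b \sum_a (i == J b)%:R * \adj D b a * (I a == i)%:R.
  pose K : 'M[R]_(1 + r) :=
    block_mx 1%:M (\row_b (i == J b)%:R) (\col_a (I a == i)%:R) D.
  have ls : (lshift r 0 : 'I_(1 + r)) = ord0 by apply/val_inj.
  have rs k : (rshift 1 k : 'I_(1 + r)) = lift ord0 k by apply/val_inj.
  have B (a b : 'I_(1 + r)) : (icons i I a == icons i J b)%:R = K a b.
    case: (split_ordP a) => k ->; case: (split_ordP b) => l ->;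
      rewrite /K ?block_mxEul ?block_mxEur ?block_mxEdl ?block_mxEdr ?ord1 ?ls ?rs
      /icons ?unlift_none ?liftK ?mxE ?eqxx//.
  transitivity (\det K).
    by congr (\det _); apply/matrixP => a b; rewrite mxE; exact: B.
  rewrite /K det_bordered mul1r mxE exchange_big /=; congr (_ - _).
  apply: eq_bigr => a _; rewrite !mxE mulr_suml; apply: eq_bigr => b _.
  by rewrite !mxE.
under eq_bigr do rewrite E.
rewrite sumrB sumr_const card_ord mulrBl !mulr_natl /gdelta -/D; congr (_ - _).
have <- : \tr (\adj D *m D) = \det D *+ r by rewrite mul_adj_mx mxtrace_scalar.
rewrite exchange_big /=; apply: eq_bigr => b _; rewrite mxE exchange_big /=.
apply: eq_bigr => a _; rewrite [D a b]mxE (bigD1 (J b))//= eqxx mul1r big1 ?addr0// => i.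
by move=> /negbTE ->; rewrite !mul0r.
Qed.

(** The metric trace of -2 E_(k) is (m - 2k) L_k. *)
Lemma einstein_trace (R : realType) m k (G : 'rV[R]_m -> 'M[R]_m) y :
  G y \in unitmx -> (G y)^T = G y -> (k.*2 <= m)%N ->
  \sum_i \sum_j (- 2 * einstein k G y i j) * G y i j = (m - k.*2)%:R * gauss_bonnet k G y.
Proof.
move=> uG sG km.
pose e i l : R := \sum_(I : {ffun 'I_(k.*2) -> 'I_m}) \sum_(J : {ffun 'I_(k.*2) -> 'I_m})
     gdelta R (icons i I) (icons l J) * riem_prod G y I J.
transitivity ((2 ^+ k)^-1 * \sum_i e i i).
  rewrite mulr_sumr; apply: eq_bigr => i _.
  transitivity ((2 ^+ k)^-1 * \sum_j \sum_l (invmx (G y) l j * G y j i) * e i l).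
    rewrite mulr_sumr; apply: eq_bigr => j _.
    rewrite mxE -[X in _ = _ * X]mulr1 exprS invfM.
    have -> : G y i j = G y j i by rewrite -{1}sG mxE.
    rewrite mulr1 -!mulrA mulr_suml !mulr_sumr; apply: eq_bigr => l _; rewrite -/(e i l).
    by field; rewrite expf_neq0.
  congr (_ * _); rewrite exchange_big /=.
  transitivity (\sum_l (l == i)%:R * e i l).
    apply: eq_bigr => l _; rewrite -mulr_suml; congr (_ * _).
    by have := mulVmx uG => /matrixP/(_ l i); rewrite !mxE => <-.
  rewrite (bigD1 i)//= eqxx mul1r big1 ?addr0// => l.
  by move=> /negbTE ->; rewrite mul0r.
rewrite /gauss_bonnet [RHS]mulrCA; congr (_ * _).
rewrite /e exchange_big mulr_sumr /=; apply: eq_bigr => I _.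
rewrite exchange_big mulr_sumr /=; apply: eq_bigr => J _.
rewrite -mulr_suml mulrA; congr (_ * _).
by rewrite gdelta_contract natrB.
Qed.

End Bordered.

(** * Charts and the induced metric *)

Section Linear.
Variable R : realType.

Lemma posdef_unitmx n (A : 'M[R]_n) :
  (forall v : 'rV[R]_n, v != 0 -> 0 < (v *m A *m v^T) 0 0) -> A \in unitmx.
Proof.
move=> H; rewrite -row_free_unit -kermx_eq0; apply/negPn/negP => /rowV0Pn[v].
move=> /sub_kermxP vA /H; by rewrite vA mul0mx mxE ltxx.
Qed.

Lemma derive_lsubmx n1 n2 (z v : 'rV[R]_(n1 + n2)) :
  'D_v (lsubmx : 'rV[R]_(n1 + n2) -> 'rV[R]_n1) z = lsubmx v.
Proof.
rewrite deriveE; last exact: differentiable_lsubmx.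
by rewrite diff_lin// => x; apply: differentiable_continuous; exact: differentiable_lsubmx.
Qed.

Lemma derive_rsubmx n1 n2 (z v : 'rV[R]_(n1 + n2)) :
  'D_v (rsubmx : 'rV[R]_(n1 + n2) -> 'rV[R]_n2) z = rsubmx v.
Proof.
rewrite deriveE; last exact: differentiable_rsubmx.
by rewrite diff_lin// => x; apply: differentiable_continuous; exact: differentiable_rsubmx.
Qed.

Lemma differentiable_row_mx (V : normedModType R) n1 n2 (f : V -> 'rV[R]_n1)
    (h : V -> 'rV[R]_n2) x :
  differentiable f x -> differentiable h x ->
  differentiable (fun z => row_mx (f z) (h z)) x.
Proof.
move=> df dh; apply: differentiable_row => j.
case: (split_ordP j) => i ->.
  under [X in differentiable X _]eq_fun do rewrite row_mxEl.
  exact: differentiable_entry.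
under [X in differentiable X _]eq_fun do rewrite row_mxEr.
exact: differentiable_entry.
Qed.

Lemma derive_row_mx (V : normedModType R) n1 n2 (f : V -> 'rV[R]_n1)
    (h : V -> 'rV[R]_n2) x v :
  differentiable f x -> differentiable h x ->
  'D_v (fun z => row_mx (f z) (h z)) x = row_mx ('D_v f x) ('D_v h x).
Proof.
move=> df dh; apply/rowP => j; rewrite derive_entry; last exact: differentiable_row_mx.
case: (split_ordP j) => i ->.
  have -> : (fun z => row_mx (f z) (h z) 0 (lshift n2 i)) = (fun z => f z 0 i).
    by apply/funext => z; rewrite row_mxEl.
  by rewrite row_mxEl derive_entry.
have -> : (fun z => row_mx (f z) (h z) 0 (rshift n1 i)) = (fun z => h z 0 i).
  by apply/funext => z; rewrite row_mxEr.
by rewrite row_mxEr derive_entry.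
Qed.

End Linear.

Section Charts.
Variables (R : realType) (m : nat) (X : manifold R m).

Lemma img_phi (a : chart X) p : dom a p -> img a (phi a p).
Proof. by move=> dp; exists p. Qed.

Lemma psi_dom (a : chart X) y : img a y -> dom a (psi a y).
Proof. by move=> [p dp <-]; rewrite phiK. Qed.

Lemma psiK (a : chart X) y : img a y -> phi a (psi a y) = y.
Proof. by move=> [p dp <-]; rewrite phiK. Qed.

Lemma open_img (a : chart X) : open (img a).
Proof. exact: img_open. Qed.

Lemma open_transition_dom (a b : chart X) :
  open [set y | img a y /\ dom b (psi a y)].
Proof.
rewrite openE => y [ay bp].
have cp := psi_continuous ay.
have nb : nbhs (psi a y) (dom b) by apply: open_nbhs_nbhs; split => //; exact: dom_open.
apply: filterI; first by apply: open_nbhs_nbhs; split => //; exact: open_img.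
exact: cp nb.
Qed.

Lemma transition_differentiable (a b : chart X) y :
  img a y -> dom b (psi a y) -> differentiable (phi b \o psi a) y.
Proof.
move=> ay bp.
apply: (@smooth_map_differentiable _ _ _ [set y | img a y /\ dom b (psi a y)] _ y _
  (@transition_smooth _ _ X a b)) => //.
exact: open_transition_dom.
Qed.

End Charts.

Section Induced.
Variables (R : realType) (m : nat) (N : manifold R m) (gN : riemannian_metric N).
Variables (rbar : \bar R) (lam : R -> R) (hlam : warping_function rbar lam).

Local Notation W := (wmetric gN lam).

Lemma wcoord_l (b : chart N) q : lsubmx (wcoord b q) 0 0 = q.1.
Proof. by rewrite row_mxKl mxE eqxx mulr1n. Qed.

Lemma wcoord_r (b : chart N) q : rsubmx (wcoord b q) = phi b q.2.
Proof. by rewrite row_mxKr. Qed.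

Lemma wmetric_sym b z : img b (rsubmx z) -> (W b z)^T = W b z.
Proof.
move=> bz; rewrite /wmetric tr_block_mx trmx1 !trmx0 linearZ/=.
by rewrite (Defs.metric_sym gN bz).
Qed.

Lemma bil_wmetric b z (u v : 'rV[R]_(1 + m)) :
  bil (W b z) u v = lsubmx u 0 0 * lsubmx v 0 0
   + lam (lsubmx z 0 0) ^+ 2 * bil (gcomp gN b (rsubmx z)) (rsubmx u) (rsubmx v).
Proof.
rewrite /bil -{1}[u]hsubmxK -{1}[v]hsubmxK /wmetric mul_row_block tr_row_mx.
rewrite !mulmx0 mulmx1 addr0 add0r mul_row_col -scalemxAr -scalemxAl mxE; congr (_ + _).
  by rewrite mxE big_ord1 [in RHS]mulrC mulrC !mxE.
by rewrite mxE.
Qed.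

Lemma wmetric_posdef b z v : img b (rsubmx z) -> 0 < lam (lsubmx z 0 0) ->
  v != 0 -> 0 < bil (W b z) v v.
Proof.
move=> bz l0 v0; rewrite bil_wmetric -expr2.
have [r0|r0] := eqVneq (rsubmx v) 0.
  have l1 : lsubmx v 0 0 != 0.
    apply: contra v0 => /eqP l1; rewrite -[v]hsubmxK r0 [lsubmx v]mx11_scalar l1.
    by rewrite raddf0 row_mx0.
  by rewrite r0 bil0l mulr0 addr0 lt_neqAle eq_sym sqrf_eq0 l1 sqr_ge0.
apply: ltr_wpDl; first exact: sqr_ge0.
by rewrite mulr_gt0 ?exprn_gt0//; exact: Defs.metric_pos.
Qed.

(** A change of chart of N does not affect the radial coordinate. *)
Lemma wtransition_jacobian (b b' : chart N) (z : 'rV[R]_(1 + m)) :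
  img b (rsubmx z) -> dom b' (psi b (rsubmx z)) ->
  differentiable (wtransition b b') z /\
  'J (wtransition b b') z = block_mx 1%:M 0 0 ('J (phi b' \o psi b) (rsubmx z)).
Proof.
move=> bz b'z.
have dT := transition_differentiable bz b'z.
have dr : differentiable (rsubmx : 'rV[R]_(1 + m) -> 'rV[R]_m) z by exact: differentiable_rsubmx.
have dl : differentiable (lsubmx : 'rV[R]_(1 + m) -> 'rV[R]_1) z by exact: differentiable_lsubmx.
have dc : differentiable ((phi b' \o psi b) \o (rsubmx : 'rV[R]_(1 + m) -> 'rV[R]_m)) z.
  exact: differentiable_comp.
have dW : differentiable (wtransition b b') z by exact: differentiable_row_mx.
split => //; apply/row_matrixP => i; rewrite !rowE -deriveEjacobian//.
set v := delta_mx 0 i.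
rewrite [LHS]derive_row_mx// derive_lsubmx.
rewrite [X in row_mx _ X](@derive_comp_jacobian _ _ _ _ _ (phi b' \o psi b) z v dr dT) derive_rsubmx.
rewrite -{3}[v]hsubmxK mul_row_block !mulmx0 mulmx1 addr0 add0r//.
Qed.

Lemma wmetric_transition (b b' : chart N) (z : 'rV[R]_(1 + m)) :
  img b (rsubmx z) -> dom b' (psi b (rsubmx z)) ->
  W b z = 'J (wtransition b b') z *m W b' (wtransition b b' z)
            *m ('J (wtransition b b') z)^T.
Proof.
move=> bz b'z; have [_ ->] := wtransition_jacobian bz b'z.
rewrite /wmetric /wtransition row_mxKl row_mxKr tr_block_mx trmx1 !trmx0 !mulmx_block.
rewrite !(mulmx0, mul0mx, mulmx1, mul1mx, addr0, add0r).
rewrite {1}(metric_transition gN bz b'z).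
by rewrite -scalemxAr -scalemxAl.
Qed.

Variables (S : manifold R m) (F : S -> R * N) (hF : hypersurface rbar F).

Let F_range p : 0 <= (F p).1 /\ ((F p).1%:E < rbar)%E. Proof. by case: hF. Qed.
Let F_cont : continuous F. Proof. by case: hF. Qed.

Lemma lam_height_gt0 p : 0 < lam (F p).1.
Proof. by case: hlam => _; apply; case: (F_range p). Qed.

Lemma lam_derivable k x : 0 <= x -> (x%:E < rbar)%E -> derivable (derive1n k lam) x 1.
Proof.
case: hlam => -[e e0 H] _ x0 xr; apply: H => //.
by apply: lt_le_trans x0; rewrite oppr_lt0.
Qed.

Lemma Fdom_open a b : open (Fdom F a b).
Proof.
rewrite openE => y [ay bp].
have cp := psi_continuous ay.
have nb : nbhs (F (psi a y)) [set q | dom b q.2].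
  apply: (@cvg_snd _ _ (nbhs (F (psi a y)).1) (nbhs (F (psi a y)).2)).
  by apply: open_nbhs_nbhs; split => //; exact: dom_open.
apply: filterI; first by apply: open_nbhs_nbhs; split => //; exact: open_img.
have := @F_cont (psi a y) _ nb; exact: cp.
Qed.

Lemma Floc_smooth a b : smooth_map (Fdom F a b) (Floc F a b).
Proof. by case: hF. Qed.

Lemma Floc_differentiable a b y : Fdom F a b y -> differentiable (Floc F a b) y.
Proof. apply: smooth_map_differentiable; [exact: Fdom_open | exact: Floc_smooth]. Qed.

Lemma Floc_l a b y : lsubmx (Floc F a b y) 0 0 = height F (psi a y).
Proof. exact: wcoord_l. Qed.

Lemma Floc_r a b y : rsubmx (Floc F a b y) = phi b (F (psi a y)).2.
Proof. exact: wcoord_r. Qed.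

Lemma Floc_img a b y : Fdom F a b y -> img b (rsubmx (Floc F a b y)).
Proof. by move=> [_ bp]; rewrite Floc_r; exact: img_phi. Qed.

Lemma Floc_lam a b y : 0 < lam (lsubmx (Floc F a b y) 0 0).
Proof. by rewrite Floc_l; exact: lam_height_gt0. Qed.

Lemma Floc_wtransition a b b' y : Fdom F a b y ->
  Floc F a b' y = wtransition b b' (Floc F a b y).
Proof.
move=> [_ bp]; rewrite /wtransition Floc_r phiK//.
rewrite /Floc /wcoord; congr row_mx.
by rewrite row_mxKl.
Qed.

Lemma Floc_jacobian_transition a b b' y : Fdom F a b y -> Fdom F a b' y ->
  'J (Floc F a b') y = 'J (Floc F a b) y *m 'J (wtransition b b') (Floc F a b y).
Proof.
move=> by_ b'y.
have bz := Floc_img by_.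
have b'z : dom b' (psi b (rsubmx (Floc F a b y))).
  by rewrite Floc_r phiK; [case: b'y | case: by_].
have [dW _] := wtransition_jacobian bz b'z.
have dF := Floc_differentiable by_.
rewrite -(jacobian_comp dF dW).
apply/matrixP => i j.
apply: (etrans (jacobianE i j (Floc_differentiable b'y))).
apply: (etrans _ (esym (jacobianE i j (differentiable_comp dF dW)))).
have nb : nbhs y (Fdom F a b) by apply: open_nbhs_nbhs; split => //; exact: Fdom_open.
apply: pd_near_eq; apply: filterS nb => z bz'.
by rewrite (Floc_wtransition b' bz').
Qed.

(** The induced metric may be computed in any chart [b] of N around the image
    point, and hence with one and the same chart near a given point. *)
Lemma induced_metricE a b y : Fdom F a b y ->
  induced_metric gN lam F a y =
  'J (Floc F a b) y *m W b (Floc F a b y) *m ('J (Floc F a b) y)^T.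
Proof.
move=> by_; rewrite /induced_metric; set b' := chart_at _.
have b'y : Fdom F a b' y by split; [case: by_ | exact: chart_atP].
rewrite (Floc_jacobian_transition by_ b'y) (wmetric_transition (Floc_img by_) (b' := b')).
  by rewrite (Floc_wtransition b' by_) trmx_mul !mulmxA.
by rewrite Floc_r phiK; [case: b'y | case: by_].
Qed.

Lemma Floc_row_free a b y : Fdom F a b y -> row_free ('J (Floc F a b) y).
Proof. by case: hF => _ _ _; apply. Qed.

Lemma induced_metric_posdef a y v : img a y -> v != 0 ->
  0 < bil (induced_metric gN lam F a y) v v.
Proof.
move=> ay v0; pose b := chart_at (F (psi a y)).2.
have by_ : Fdom F a b y by split => //; exact: chart_atP.
rewrite (induced_metricE by_).
have -> : bil ('J (Floc F a b) y *m W b (Floc F a b y) *m ('J (Floc F a b) y)^T) v v =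
  bil (W b (Floc F a b y)) (v *m 'J (Floc F a b) y) (v *m 'J (Floc F a b) y).
  by rewrite /bil trmx_mul !mulmxA.
apply: wmetric_posdef; [exact: Floc_img | exact: Floc_lam |].
apply: contra v0 => /eqP H; have /row_freeP[B JB] := Floc_row_free by_.
by apply/eqP; rewrite -[v]mulmx1 -JB mulmxA H mul0mx.
Qed.

Lemma induced_metric_unit a y : img a y -> induced_metric gN lam F a y \in unitmx.
Proof. by move=> ay; apply: posdef_unitmx => v; exact: induced_metric_posdef. Qed.

Lemma wmetric_unit a b y : Fdom F a b y -> W b (Floc F a b y) \in unitmx.
Proof.
move=> by_; apply: posdef_unitmx => v; apply: wmetric_posdef.
  exact: Floc_img.
exact: Floc_lam.
Qed.

Lemma induced_metric_sym a y : img a y ->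
  (induced_metric gN lam F a y)^T = induced_metric gN lam F a y.
Proof.
move=> ay; pose b := chart_at (F (psi a y)).2.
have by_ : Fdom F a b y by split => //; exact: chart_atP.
by rewrite (induced_metricE by_) !trmx_mul trmxK (wmetric_sym (Floc_img by_)) mulmxA.
Qed.

End Induced.

(** * The radial Christoffel symbols of a warped product *)

Section Geometry.
Variables (R : realType) (m : nat) (N : manifold R m) (gN : riemannian_metric N).
Variables (rbar : \bar R) (lam : R -> R) (hlam : warping_function rbar lam).
Local Notation W := (wmetric gN lam).
Local Notation lam' := (derive1 lam).

(** The vector d/dr in the coordinates of the warped product. *)
Definition radial : 'rV[R]_(1 + m) := row_mx 1%:M 0.

Lemma radial_l : lsubmx radial 0 0 = 1.
Proof. by rewrite row_mxKl mxE eqxx. Qed.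
Lemma radial_r : rsubmx radial = 0.
Proof. by rewrite row_mxKr. Qed.

Section AtPoint.
Variables (b : chart N) (x : 'rV[R]_(1 + m)).
Hypotheses (bx : img b (rsubmx x)) (x0 : 0 <= lsubmx x 0 0)
  (xr : ((lsubmx x 0 0)%:E < rbar)%E).

Let l0 : 0 < lam (lsubmx x 0 0). Proof. by case: hlam => _; apply. Qed.

Let dlam : derivable lam (lsubmx x 0 0) 1.
Proof. exact: (@lam_derivable _ _ _ hlam 0%N _ x0 xr). Qed.

Let dlamx : differentiable (fun z : 'rV[R]_(1 + m) => lam (lsubmx z 0 0)) x.
Proof.
apply: (@differentiable_comp _ _ _ _ (fun z : 'rV[R]_(1 + m) => lsubmx z 0 0) lam).
  apply: differentiable_entry; exact: differentiable_lsubmx.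
exact/derivable1_diffP.
Qed.

Let dgx i j : differentiable (fun z : 'rV[R]_(1 + m) => gcomp gN b (rsubmx z) i j) x.
Proof.
apply: (@differentiable_comp _ _ _ _ (fun z : 'rV[R]_(1 + m) => rsubmx z) (fun z => gcomp gN b z i j)).
  exact: differentiable_rsubmx.
by apply: (smooth_differentiable (@open_img _ _ N b)) => //; exact: Defs.metric_smooth.
Qed.

Lemma wmetric_differentiable A B : differentiable (fun z => W b z A B) x.
Proof.
rewrite /wmetric; case: (split_ordP A) => i ->; case: (split_ordP B) => j ->.
- under [X in differentiable X _]eq_fun do rewrite block_mxEul; exact: differentiable_cst.
- under [X in differentiable X _]eq_fun do rewrite block_mxEur; exact: differentiable_cst.
- under [X in differentiable X _]eq_fun do rewrite block_mxEdl; exact: differentiable_cst.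
- have -> : (fun z => block_mx (1%:M : 'M[R]_1) 0 0
      (lam (lsubmx z 0 0) ^+ 2 *: gcomp gN b (rsubmx z)) (rshift 1 i) (rshift 1 j)) =
    (fun z : 'rV[R]_(1 + m) => lam (lsubmx z 0 0)) ^+ 2
      * (fun z : 'rV[R]_(1 + m) => gcomp gN b (rsubmx z) i j).
    by apply/funext => z; rewrite block_mxEdr mxE !fctE.
  apply: differentiableM; last exact: dgx.
  by apply: differentiableX; exact: dlamx.
Qed.

Lemma dmxE q (G : 'rV[R]_q -> 'M[R]_q) z w A B : differentiable (fun z => G z A B) z ->
  dmx G z w A B = 'D_w (fun z => G z A B) z.
Proof. by move=> dG; rewrite mxE deriveE_pd. Qed.

(** The radial column of the metric is constant. *)
Lemma bil_dmx_radial_r u w : bil (dmx (W b) x w) u radial = 0.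
Proof.
rewrite bilE big1// => A _; rewrite big1// => B _.
case: (split_ordP B) => j ->; last by rewrite /radial row_mxEr [X in _ * X]mxE mulr0.
rewrite dmxE; last exact: wmetric_differentiable.
suff -> : 'D_w (fun z => W b z A (lshift m j)) x = 0 by rewrite mulr0 mul0r.
rewrite /wmetric; case: (split_ordP A) => i ->.
  have -> : (fun z : 'rV[R]_(1 + m) => block_mx (1%:M : 'M[R]_1) 0 0 (lam (lsubmx z 0 0) ^+ 2 *: gcomp gN b (rsubmx z))
     (lshift m i) (lshift m j)) = cst ((1%:M : 'M[R]_1) i j).
    by apply/funext => z; rewrite block_mxEul.
  exact: derive_cst.
have -> : (fun z : 'rV[R]_(1 + m) => block_mx (1%:M : 'M[R]_1) 0 0 (lam (lsubmx z 0 0) ^+ 2 *: gcomp gN b (rsubmx z))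
     (rshift 1 i) (lshift m j)) = cst ((0 : 'M[R]_(m, 1)) i j).
  by apply/funext => z; rewrite block_mxEdl.
exact: derive_cst.
Qed.

Let radial_derive i j :
  'D_radial (fun z => W b z (rshift 1 i) (rshift 1 j)) x =
  2 * lam (lsubmx x 0 0) * lam' (lsubmx x 0 0) * gcomp gN b (rsubmx x) i j.
Proof.
have D := diff_derivable (v := radial) (wmetric_differentiable (rshift 1 i) (rshift 1 j)).
have := @is_derive_line R _ _ (fun z => W b z (rshift 1 i) (rshift 1 j)) x radial 0.
rewrite scale0r addr0 => /(_ D) [_ <-].
have -> : (fun s : R => W b (x + s *: radial) (rshift 1 i) (rshift 1 j)) =
  (fun s : R => (lam (lsubmx x 0 0 + s *: 1)) ^+ 2 * gcomp gN b (rsubmx x) i j).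
  apply/funext => s; rewrite /wmetric block_mxEdr mxE !linearD !linearZ /=.
  rewrite radial_r scaler0 addr0.
  suff -> : (lsubmx x + s *: lsubmx radial) 0 0 = lsubmx x 0 0 + s * 1 by [].
  by rewrite [LHS]mxE; congr (_ + _); rewrite [LHS]mxE radial_l.
have L := @is_derive_line R R R lam (lsubmx x 0 0) 1 0.
rewrite scale0r addr0 in L; have {}L := L dlam.
set f := (fun s : R => lam (lsubmx x 0 0 + s *: 1)) in L *.
have -> : (fun s : R => (lam (lsubmx x 0 0 + s *: 1)) ^+ 2 * gcomp gN b (rsubmx x) i j) =
  (f ^+ 2 * cst (gcomp gN b (rsubmx x) i j)).
  by apply/funext => s; rewrite !fctE.
rewrite derive_val !fctE /f scale0r addr0 expr1 derive1E /GRing.scale /=.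
ring.
Qed.

(** The derivative of the metric in the radial direction is 2 lambda' / lambda
    times its part along N. *)
Lemma bil_dmx_radial u v : bil (dmx (W b) x radial) u v =
  2 * (lam' (lsubmx x 0 0) / lam (lsubmx x 0 0)) *
     (bil (W b x) u v - u 0 (lshift m 0) * v 0 (lshift m 0)).
Proof.
have sd : (dmx (W b) x radial)^T = dmx (W b) x radial.
  apply: dmx_sym.
  have : \forall z \near x, img b (rsubmx z).
    have := @differentiable_continuous _ _ _ x _ (@differentiable_rsubmx _ 1 1 m x).
    apply; apply: open_nbhs_nbhs; split => //; exact: open_img.
  by apply: filterS => z bz; exact: wmetric_sym.
rewrite bil_wmetric.
have -> : u 0 (lshift m 0) = lsubmx u 0 0 by rewrite mxE.
have -> : v 0 (lshift m 0) = lsubmx v 0 0 by rewrite mxE.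
have split_radial w : w = lsubmx w 0 0 *: radial + row_mx 0 (rsubmx w).
  rewrite /radial scale_row_mx scaler0 add_row_mx add0r addr0.
  by rewrite -scalemx1 scalerA mulr1 scalemx1 -mx11_scalar hsubmxK.
have -> : bil (dmx (W b) x radial) u v =
  bil (dmx (W b) x radial) (row_mx 0 (rsubmx u)) (row_mx 0 (rsubmx v)).
  rewrite {1}(split_radial u) {1}(split_radial v) bilDr bilZr bil_dmx_radial_r mulr0 add0r.
  by rewrite bilDl bilZl (bilC _ _ sd) bil_dmx_radial_r mulr0 add0r.
rewrite addrAC subrr add0r.
transitivity (2 * lam (lsubmx x 0 0) * lam' (lsubmx x 0 0) *
   bil (gcomp gN b (rsubmx x)) (rsubmx u) (rsubmx v)); last first.
  by have := lt0r_neq0 l0; move: (lam (lsubmx x 0 0)) => l ln0; field.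
rewrite !bilE big_split_ord /= big_ord1 row_mxEl mxE.
rewrite [X in X + _]big1 ?add0r; last by move=> B _; rewrite !mul0r.
rewrite mulr_sumr; apply: eq_bigr => i _.
rewrite big_split_ord /= big_ord1 !row_mxEl !row_mxEr [X in _ * X + _]mxE mulr0 add0r.
rewrite mulr_sumr; apply: eq_bigr => j _.
rewrite dmxE; last exact: wmetric_differentiable.
rewrite radial_derive !row_mxEr; ring.
Qed.

(** The radial component of the Christoffel symbols of a warped product. *)
Lemma chr_wmetric_radial u v : chr (W b) x u v 0 (lshift m 0) =
  - (lam' (lsubmx x 0 0) / lam (lsubmx x 0 0)) *
     (bil (W b x) u v - u 0 (lshift m 0) * v 0 (lshift m 0)).
Proof.
have uW : W b x \in unitmx by apply: posdef_unitmx => w; exact: wmetric_posdef.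
have -> : chr (W b) x u v 0 (lshift m 0) = bil (W b x) (chr (W b) x u v) radial.
  by rewrite bil_wmetric radial_l radial_r bil0r mulr0 addr0 mulr1 [RHS]mxE.
rewrite bil_chr//; last exact: wmetric_sym.
rewrite !bil_dmx_radial_r bil_dmx_radial.
set X := bil (W b x) u v - _; set c := _ / _; lra.
Qed.

End AtPoint.
End Geometry.

(** * The Hessian of the height function *)

Lemma hessian_solve (R : comNzRingType) (A s c K h t : R) :
  A + - c * K - s = - h * t -> A - s = c * K - t * h.
Proof.
move=> E; have -> : A - s = (A + - c * K - s) + c * K by ring.
by rewrite E; ring.
Qed.

Section HeightFunction.
Variables (R : realType) (m : nat) (N : manifold R m) (gN : riemannian_metric N).
Variables (rbar : \bar R) (lam : R -> R) (hlam : warping_function rbar lam).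
Variables (S : manifold R m) (F : S -> R * N) (hF : hypersurface rbar F).
Variables (nu : chart N -> S -> 'rV[R]_(1 + m)) (hnu : unit_normal gN lam F nu).
Local Notation W := (wmetric gN lam).
Local Notation lam' := (derive1 lam).
Local Notation g := (induced_metric gN lam F).
Local Notation height := (height F).

Section AtPoint.
Variable p : S.
Let a := chart_at p.
Let b := chart_at (F p).2.
Let y := coord_at p.
Let x := Floc F a b y.
Let J := 'J (Floc F a b) y.
Let U := Fdom F a b.

Lemma coord_at_img : img (chart_at p) (coord_at p).
Proof. by apply: img_phi; exact: chart_atP. Qed.

Lemma psi_coord_at : psi (chart_at p) (coord_at p) = p.
Proof. by rewrite phiK//; exact: chart_atP. Qed.

Let Uy : U y.
Proof. by split; [exact: coord_at_img | rewrite psi_coord_at; exact: chart_atP]. Qed.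

Let oU : open U. Proof. exact: Fdom_open hF _ _. Qed.
Let sX : smooth_map U (Floc F a b). Proof. exact: Floc_smooth hF _ _. Qed.
Let ux : W b x \in unitmx. Proof. exact: (wmetric_unit gN hlam hF). Qed.
Let ix : img b (rsubmx x). Proof. exact: Floc_img. Qed.
Let xl : lsubmx x 0 0 = height p.
Proof. by rewrite /x Floc_l psi_coord_at. Qed.
Let x0 : 0 <= lsubmx x 0 0. Proof. by rewrite xl; case: hF => H _ _ _; case: (H p). Qed.
Let xr : ((lsubmx x 0 0)%:E < rbar)%E.
Proof. by rewrite xl; case: hF => H _ _ _; case: (H p). Qed.
Let sx : (W b x)^T = W b x. Proof. exact: wmetric_sym. Qed.
Let sxn : \forall z \near x, (W b z)^T = W b z.
Proof.
have : \forall z \near x, img b (rsubmx z).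
  have := @differentiable_continuous _ _ _ x _ (@differentiable_rsubmx _ 1 1 m x).
  apply; apply: open_nbhs_nbhs; split => //; exact: open_img.
by apply: filterS => z bz; exact: wmetric_sym.
Qed.
Let gE z : U z -> g a z = 'J (Floc F a b) z *m W b (Floc F a b z) *m ('J (Floc F a b) z)^T.
Proof. exact: (induced_metricE gN lam hF). Qed.
Let ug : g a y \in unitmx.
Proof. by apply: (induced_metric_unit gN hlam hF); exact: coord_at_img. Qed.
Let tn z : U z -> 'J (Floc F a b) z *m W b (Floc F a b z) *m (nu b (psi a z))^T = 0.
Proof. by case: hnu => _ _ + _; apply. Qed.

Let v := nu b p.

(* Num.sqrt vanishes on negative numbers, so a number whose square root is 1
   is equal to 1 *)
Let n1 : bil (W b x) v v = 1.
Proof.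
case: hnu => _ _ _ /(_ b p (chart_atP _)).
rewrite /norm_in -/(bil _ _ _) => H.
have E : x = wcoord b (F p) by rewrite /x /Floc psi_coord_at.
rewrite -E in H.
have p0 : 0 <= bil (W b x) v v.
  rewrite leNgt; apply/negP => /ltW/ler0_sqrtr H0.
  by move: H; rewrite H0 => /esym/eqP; rewrite oner_eq0.
by rewrite -(sqr_sqrtr p0) H expr1n.
Qed.

Let tnp : J *m W b x *m v^T = 0.
Proof. by have := tn Uy; rewrite psi_coord_at. Qed.

Let ugJ : J *m W b x *m J^T \in unitmx. Proof. by rewrite -gE. Qed.

Lemma angleE : angle gN lam F nu p = bil (W b x) (radial R m) v.
Proof. by rewrite /angle /bil /x /Floc psi_coord_at. Qed.

Let heightE : (fun z => Floc F a b z 0 (lshift m 0)) = height \o psi a.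
Proof.
apply/funext => z; by rewrite /= -[RHS](Floc_l F a b z) [RHS]mxE.
Qed.

(* the products of d/dr with the coordinate vectors are the derivatives of r *)
Let radial_tangent : radial R m *m W b x *m J^T = \row_j pd j (height \o psi a) y.
Proof.
rewrite /radial /wmetric mul_row_block !mul1mx !mul0mx !addr0.
apply/rowP => j; rewrite [RHS]mxE -heightE -jacobianE; last exact: Floc_differentiable hF _ _ _ _.
rewrite mxE big_split_ord /= big_ord1 row_mxEl big1 ?addr0; last first.
  by move=> i _; rewrite row_mxEr mxE mul0r.
by rewrite [X in X * _]mxE eqxx mul1r [LHS]mxE.
Qed.

Let bil_radial : bil (W b x) (radial R m) (radial R m) = 1.
Proof. by rewrite bil_wmetric radial_l radial_r bil0l mulr0 addr0 mulr1. Qed.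

Lemma norm_grad_sqr (u : S -> R) :
  norm_grad g u p ^+ 2 =
  bil (invmx (g a y)) (\row_j pd j (u \o psi a) y) (\row_j pd j (u \o psi a) y).
Proof.
rewrite /norm_grad /norm_in /metric_at -/a -/y -/(bil _ _ _).
set du := \row_j _.
have sg : (g a y)^T = g a y by apply: (induced_metric_sym gN lam hF); exact: coord_at_img.
have -> : gradient (g a) (u \o psi a) y = du *m invmx (g a y).
  apply/rowP => i; rewrite !mxE; apply: eq_bigr => j _; rewrite mxE mulrC; congr (_ * _).
  by rewrite -[in LHS]sg -trmx_inv mxE.
rewrite sqr_sqrtr.
  exact: bil_raise.
have [->|n0] := eqVneq (du *m invmx (g a y)) 0; first by rewrite bil0l.
by apply: ltW; apply: (induced_metric_posdef gN hlam hF) => //; exact: coord_at_img.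
Qed.

(** |grad r|^2 + <d/dr, nu>^2 = 1: the splitting of the unit vector d/dr into its
    tangential and normal parts. *)
Lemma norm_grad_height : norm_grad g height p ^+ 2 + angle gN lam F nu p ^+ 2 = 1.
Proof.
rewrite norm_grad_sqr angleE -radial_tangent gE//.
by rewrite -(norm_split ux sx ugJ tnp n1).
Qed.

(** The Hessian of the height function,
    (lambda' / lambda) (g - dr dr) - <d/dr, nu> h.  It is the radial component of
    the Gauss formula: the vector-valued second fundamental form is - h nu, and
    the ambient Christoffel symbols contribute through [chr_wmetric_radial]. *)
Lemma height_hessian i j :
  hessian (g a) (height \o psi a) y i j =
  lam' (height p) / lam (height p) *
    (g a y i j - pd i (height \o psi a) y * pd j (height \o psi a) y)
  - angle gN lam F nu p * second_ff gN lam F nu p i j.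
Proof.
have dW A B : differentiable (fun z => W b z A B) (Floc F a b y).
  exact: (wmetric_differentiable gN hlam ix x0 xr).
have dnu : differentiable (nu b \o psi a) y.
  case: hnu => s _ _ _; exact: (smooth_map_differentiable oU (s a b) Uy).
pose Z := sff_vec (Floc F a b) y (W b) (g a) i j.
have ZJ : Z *m W b x *m J^T = 0.
  apply/rowP => l; rewrite [RHS]mxE.
  have <- := sff_vec_tangent oU Uy sX dW sxn ux gE ug i j l.
  by rewrite /amb (tanvE oU sX)// /bil -entry_row.
have Zr : Z 0 (lshift m 0) = bil (W b x) Z (radial R m).
  by rewrite bil_wmetric radial_l radial_r bil0r mulr0 addr0 mulr1 [RHS]mxE.
have Znu := sff_vec_normal oU Uy sX dW sxn ux (g a) dnu tn i j.
have tan0 l : tanv (Floc F a b) y l 0 (lshift m 0) = pd l (height \o psi a) y.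
  by rewrite mxE heightE.
have hE : second_ff gN lam F nu p i j =
   amb (Floc F a b) y (W b)
     (\row_A pd i (fun z => (nu b \o psi a) z 0 A) y
      + chr (W b) x (tanv (Floc F a b) y i) ((nu b \o psi a) y)) (tanv (Floc F a b) y j).
  rewrite /second_ff -/a -/b -/y bil_entry /amb !(tanvE oU sX)// -/x; congr (bil _ _ _).
  apply/rowP => A; rewrite [LHS]mxE [LHS]mxE [RHS]mxE; congr (_ + _).
    by rewrite -/a -/b -/y (jacobianE i A dnu) [RHS]mxE.
  rewrite [RHS]mxE -/a -/b -/y -/x; apply: eq_bigr => B _; apply: eq_bigr => C _.
  rewrite [row _ _ _ _]mxE; congr (_ * _).
  by rewrite /y /= psi_coord_at.
rewrite -hE in Znu.
have ZE := normal_vector_eq ux sx ugJ tnp n1 (radial R m) ZJ.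
rewrite -Zr (bilC v _ sx) -angleE in ZE.
have Zv : bil (W b x) Z v = - second_ff gN lam F nu p i j.
  by rewrite -Znu /amb /= /y psi_coord_at.
rewrite Zv /Z /sff_vec in ZE.
have gij : g a y i j = bil (W b x) (tanv (Floc F a b) y i) (tanv (Floc F a b) y j).
  by rewrite gE// bil_entry !(tanvE oU sX).
have h0 : hessv (Floc F a b) y i j 0 (lshift m 0) = pd i (pd j (height \o psi a)) y.
  by rewrite mxE heightE.
have c0 := chr_wmetric_radial gN hlam ix x0 xr (tanv (Floc F a b) y i) (tanv (Floc F a b) y j).
rewrite -gij !tan0 xl in c0.
move: ZE; rewrite [LHS]mxE [X in X + _ = _]mxE h0 c0 [X in _ + X = _]mxE summxE.
have -> : \sum_k (christoffel (g a) y k i j *: tanv (Floc F a b) y k) 0 (lshift m 0) =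
  \sum_k christoffel (g a) y k i j * pd k (height \o psi a) y.
  by apply: eq_bigr => k _; rewrite mxE tan0.
have -> : hessian (g a) (height \o psi a) y i j =
    pd i (pd j (height \o psi a)) y - \sum_k christoffel (g a) y k i j * pd k (height \o psi a) y.
  by rewrite [LHS]mxE.
exact: hessian_solve.
Qed.

End AtPoint.
End HeightFunction.

(** * Composition with a function of one variable *)

Section Composition.
Variables (R : realType) (m : nat).

Lemma derive_comp_real (phi : R -> R) (rho : 'rV[R]_m -> R) y v (d : R) :
  is_derive (rho y) (1:R) phi d -> differentiable rho y ->
  differentiable (phi \o rho) y /\ 'D_v (phi \o rho) y = d * 'D_v rho y.
Proof.
move=> [dphi <-] drho.
have dp : differentiable phi (rho y) by exact/derivable1_diffP.
have dc : differentiable (phi \o rho) y by exact: differentiable_comp.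
split; first exact: dc.
rewrite deriveE// diff_comp// /= diff1E// -deriveE// derive1E.
by rewrite /GRing.scale /= mulrC.
Qed.

Variables (U : set 'rV[R]_m) (rho : 'rV[R]_m -> R) (phi phi1 phi2 : R -> R).
Hypotheses (oU : open U) (srho : smooth U rho).
Hypothesis d1 : forall y, U y -> is_derive (rho y) (1:R) phi (phi1 (rho y)).
Hypothesis d2 : forall y, U y -> is_derive (rho y) (1:R) phi1 (phi2 (rho y)).
Hypothesis c2 : forall y, U y -> {for rho y, continuous phi2}.

Let drho y : U y -> differentiable rho y.
Proof. exact: smooth_differentiable. Qed.
Let dpd y i : U y -> differentiable (pd i rho) y.
Proof. by apply: smooth_differentiable => //; exact: smooth_pd. Qed.
Let nU y : U y -> nbhs y U.
Proof. by move=> Uy; apply: open_nbhs_nbhs. Qed.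

Lemma pd_comp y j : U y -> pd j (phi \o rho) y = phi1 (rho y) * pd j rho y.
Proof. by move=> Uy; case: (derive_comp_real 'e_j (d1 Uy) (drho Uy)). Qed.

Let pd_near y j : U y ->
  \forall z \near y, ((phi1 \o rho) * pd j rho) z = pd j (phi \o rho) z.
Proof. by move=> Uy; apply: filterS (nU Uy) => z Uz; rewrite pd_comp. Qed.

Let dpdc y j : U y -> differentiable ((phi1 \o rho) * pd j rho) y.
Proof.
move=> Uy; apply: differentiableM; last exact: dpd.
by case: (derive_comp_real 0 (d2 Uy) (drho Uy)).
Qed.

Lemma pd2_comp y i j : U y -> pd i (pd j (phi \o rho)) y =
  phi2 (rho y) * (pd i rho y * pd j rho y) + phi1 (rho y) * pd i (pd j rho) y.
Proof.
move=> Uy; rewrite -(pd_near_eq i (pd_near j Uy)).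
have [dc Dc] := derive_comp_real 'e_i (d2 Uy) (drho Uy).
have M : pd i ((phi1 \o rho) * pd j rho) y =
   phi1 (rho y) * pd i (pd j rho) y + pd j rho y * (phi2 (rho y) * pd i rho y).
  rewrite -Dc; apply: deriveM; first exact: diff_derivable.
  by apply: diff_derivable; exact: dpd.
by rewrite M addrC mulrCA [pd j rho y * _]mulrC.
Qed.

(** The composite of a smooth function with a C^2 function of one variable. *)
Lemma Ck2_comp : Ck 2 U (phi \o rho).
Proof.
move=> [|j [|i [|k s]]] y Uy; split => // _.
- by apply: differentiable_continuous; case: (derive_comp_real 0 (d1 Uy) (drho Uy)).
- by move=> i; apply: diff_derivable; case: (derive_comp_real 0 (d1 Uy) (drho Uy)).
- apply: continuous_near (pd_near j Uy) _.
  by apply: differentiable_continuous; exact: dpdc.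
- move=> i; have : derivable ((phi1 \o rho) * pd j rho) y 'e_i.
    by apply: diff_derivable; exact: dpdc.
  exact: near_eq_derivable (pd_near j Uy).
- have E : \forall z \near y,
     ((fun z => phi2 (rho z) * (pd j rho z * pd i rho z)) \+
      (fun z => phi1 (rho z) * pd j (pd i rho) z)) z = pd j (pd i (phi \o rho)) z.
    by apply: filterS (nU Uy) => z Uz; rewrite pd2_comp.
  apply: continuous_near E _.
  have cr : {for y, continuous rho} by apply: differentiable_continuous; exact: drho.
  apply: (@continuousD _ _ _ (fun z => phi2 (rho z) * (pd j rho z * pd i rho z))
      (fun z => phi1 (rho z) * pd j (pd i rho) z)).
    apply: (@continuousM _ _ (phi2 \o rho) (fun z => pd j rho z * pd i rho z)).
      by apply: continuous_comp => //; exact: c2.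
    by apply: (@continuousM _ _ (pd j rho) (pd i rho));
      apply: differentiable_continuous; exact: dpd.
  apply: (@continuousM _ _ (phi1 \o rho) (pd j (pd i rho))).
    apply: continuous_comp => //.
    by apply: differentiable_continuous; apply/derivable1_diffP; case: (d2 Uy).
  exact: smooth_continuous (smooth_pd _ (smooth_pd _ srho)) Uy.
Qed.

End Composition.

(** * The warping function on a slab *)

Section Warping.
Variables (R : realType) (rbar : \bar R) (lam : R -> R).
Hypothesis hlam : warping_function rbar lam.
Variables (r1 r2 : R).
Hypotheses (hr1 : 0 <= r1) (hr12 : r1 <= r2) (hr2 : (r2%:E < rbar)%E).

Let dom_itv x : r1 <= x <= r2 -> 0 <= x /\ (x%:E < rbar)%E.
Proof.
move=> /andP[x1 x2]; split; first exact: le_trans x1.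
by apply: le_lt_trans hr2; rewrite lee_fin.
Qed.

Lemma derive1n_continuous k x : r1 <= x <= r2 -> {for x, continuous (derive1n k lam)}.
Proof.
move=> /dom_itv[x0 xr]; apply: differentiable_continuous; apply/derivable1_diffP.
exact: (@lam_derivable _ _ _ hlam k).
Qed.

Lemma derive1n_within k : {within `[r1, r2], continuous (derive1n k lam)}.
Proof.
apply: continuous_in_subspaceT => x; rewrite inE /= in_itv /= => x12.
exact: derive1n_continuous.
Qed.

Lemma warping_lower_bound : exists2 l, 0 < l & forall x, r1 <= x <= r2 -> l <= lam x.
Proof.
have [c c12 H] := EVT_min hr12 (@derive1n_within 0%N).
exists (lam c).
  by case: hlam => _; apply; case: (@dom_itv c); move: c12; rewrite in_itv.
by move=> x x12; apply: H; rewrite in_itv.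
Qed.

Lemma warping_derive_bound : exists B, forall x, r1 <= x <= r2 -> `|derive1 lam x| <= B.
Proof.
have [c _ H] := EVT_max hr12 (@derive1n_within 1%N).
have [d _ K] := EVT_min hr12 (@derive1n_within 1%N).
exists (Num.max `|derive1 lam c| `|derive1 lam d|) => x x12.
have xi : x \in `[r1, r2]%R by rewrite in_itv.
have := H x xi; have := K x xi; rewrite /= => h1 h2.
rewrite le_max; case: (lerP 0 (derive1 lam x)) => s.
  by rewrite ger0_norm// (le_trans h2)// ler_norm.
apply/orP; right; rewrite ltr0_norm// (le_trans (_ : _ <= - derive1 lam d)) ?lerN2//.
by rewrite -normrN ler_norm.
Qed.

(** A primitive of the warping function on [r1, r2], differentiable at the end
    points too: lambda is smooth on a larger interval, where the fundamental
    theorem of calculus applies. *)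
Lemma antiderivative : exists Phi : R -> R,
  forall x, r1 <= x <= r2 -> is_derive x (1:R) Phi (lam x).
Proof.
have [[e e0 dl] _] := hlam.
(* a little room on the right of r2, and below on the left of r1 >= 0 *)
have [u u2 ur] : exists2 u : R, r2 < u & (u%:E < rbar)%E.
  case: rbar hr2 => [s| |]//.
  - rewrite lte_fin => rs; exists ((r2 + s) / 2); rewrite ?lte_fin; lra.
  - by exists (r2 + 1); [lra | rewrite ltry].
pose v := - (e / 2).
have dv x : v <= x <= u -> derivable lam x 1.
  move=> /andP[vx xu]; apply: (dl 0%N).
    by apply: lt_le_trans vx; rewrite /v; lra.
  by apply: le_lt_trans ur; rewrite lee_fin.
have cv : {within `[v, u], continuous lam}.
  by apply: derivable_within_continuous => x; rewrite in_itv; exact: dv.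
have il := continuous_compact_integrable (@segment_compact _ v u) cv.
exists (fun x => \int[lebesgue_measure]_(t in [set` `[v, x]]) lam t)%R => x /andP[x1 x2].
have xu : x < u by lra.
have vx : v < x by apply: lt_le_trans x1; apply: lt_le_trans hr1; rewrite oppr_lt0 divr_gt0.
have [|D1 D2] := continuous_FTC1_closed xu il vx.
  apply: differentiable_continuous; apply/derivable1_diffP; apply: dv.
  by rewrite !ltW.
by split; [exact: D1 | rewrite -derive1E; exact: D2].
Qed.

End Warping.

(** The estimate at one point of an Omori-Yau sequence.  Here [t] = |grad r| and
    [th] = <d/dr, nu>, so that 1 - th <= t ^ 2 <= t; [l], [l'] are lambda and
    lambda', [H] is H_2k, [c] = m - 2k, and [e] bounds both the gradient of Phi(r)
    and L Phi(r).  With delta > 0 a lower bound of [D], the fixed positive number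
    on the left is bounded by a multiple of [e]. *)
Lemma omori_yau_estimate (R : realType) (delta C1 C2 l0 B c H l l' th t D e : R) :
  0 < delta -> 0 < C1 -> 0 < l0 -> 0 <= c ->
  C1 <= H <= C2 -> l0 <= l -> `|l'| <= B -> 0 <= th -> 0 <= t ->
  t ^+ 2 + th ^+ 2 = 1 -> delta <= D ->
  l * t < e -> l' * (c * H) - l * th * (H * (c * (l' / l) - D)) < e ->
  C1 * l0 * delta < e * (1 + (C1 * l0 * delta + C2 * c * B) / l0).
Proof.
move=> d0 C10 l00 c0 /andP[H1 H2] ll lB th0 t0 E dD g1 g2.
have l1 : 0 < l by exact: lt_le_trans ll.
have H0 : 0 < H by exact: lt_le_trans H1.
have t1 : t <= 1 by rewrite -(@expr_le1 _ 2)//; nra.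
have th1 : th <= 1 by rewrite -(@expr_le1 _ 2)//; nra.
have tt : t ^+ 2 <= t by rewrite expr2 ler_piMl.
have thth : th ^+ 2 <= th by rewrite expr2 ler_piMl.
have te : t < e / l0.
  by rewrite ltr_pdivlMr// mulrC; apply: le_lt_trans g1; rewrite ler_wpM2r.
have E2 : l' * (c * H) - l * th * (H * (c * (l' / l) - D)) =
   H * c * (l' * (1 - th)) + H * l * (th * D).
  by field; rewrite lt0r_neq0.
rewrite {}E2 in g2.
have B0 : 0 <= B by exact: le_trans (normr_ge0 _) lB.
have t2 : 1 - th <= t ^+ 2 by lra.
have th10 : 0 <= 1 - th by rewrite subr_ge0.
have t10 : 0 <= 1 - t by rewrite subr_ge0.
have C20 : 0 <= C2 by apply: ltW; exact: lt_le_trans (lt_le_trans C10 H1) H2.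
have s1 : - (C2 * c * B * t) <= H * c * (l' * (1 - th)).
  have K : `|H * c * (l' * (1 - th))| <= C2 * c * (B * t).
    rewrite normrM ger0_norm ?mulr_ge0 ?(ltW H0)//.
    apply: ler_pM => //; [by rewrite mulr_ge0// ltW|by rewrite ler_wpM2r|].
    rewrite normrM (ger0_norm th10); apply: ler_pM => //; exact: le_trans t2 tt.
  rewrite -[C2 * c * B * t]mulrA lerNl; apply: le_trans K.
  by rewrite -normrN ler_norm.
have s2 : C1 * l0 * (delta * (1 - t)) <= H * l * (th * D).
  apply: ler_pM; rewrite ?mulr_ge0 ?(ltW C10) ?(ltW l00) ?(ltW d0)//.
    by apply: ler_pM => //; exact: ltW.
  by rewrite mulrC; apply: ler_pM => //; [exact: ltW | lra].
have K0 : 0 <= C1 * l0 * delta + C2 * c * B.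
  by rewrite addr_ge0// !mulr_ge0// ltW.
have s3 : C1 * l0 * delta < e + (C1 * l0 * delta + C2 * c * B) * t.
  have -> : (C1 * l0 * delta + C2 * c * B) * t =
    C1 * l0 * delta - C1 * l0 * (delta * (1 - t)) + C2 * c * B * t by ring.
  lra.
apply: lt_le_trans s3 _; rewrite mulrDr mulr1 lerD2l.
have -> : e * ((C1 * l0 * delta + C2 * c * B) / l0) =
  (C1 * l0 * delta + C2 * c * B) * (e / l0) by field; rewrite lt0r_neq0.
by rewrite ler_wpM2l// ltW.
Qed.

(** * The Omori-Yau principle for a primitive of the warping function *)

(** The Hessian of Phi(r): the terms in dr dr cancel as Phi' = lambda.  Here [G],
    [r], [t] and [h] stand for g, dr dr, <d/dr, nu> and the second fundamental
    form. *)
Lemma hessian_primitive (R : fieldType) (l' l G r t h : R) : l != 0 ->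
  l' * r + l * (l' / l * (G - r) - t * h) = l' * G - l * t * h.
Proof. by move=> l0; field. Qed.

Lemma trace_term (R : comNzRingType) (E l' G c h : R) :
  - 2 * E * (l' * G - c * h) = l' * (- 2 * E * G) - c * (- 2 * (E * h)).
Proof. ring. Qed.

Section OmoriYau.
Variables (R : realType) (m k : nat) (hk : (k.*2 < m)%N).
Variables (N : manifold R m) (gN : riemannian_metric N).
Variables (rbar : \bar R) (lam : R -> R) (hlam : warping_function rbar lam).
Variables (S : manifold R m) (F : S -> R * N) (hF : hypersurface rbar F).
Variables (nu : chart N -> S -> 'rV[R]_(1 + m)) (hnu : unit_normal gN lam F nu).
Variables (r1 r2 : R).
Hypotheses (hr1 : 0 <= r1) (hr12 : r1 <= r2) (hr2 : (r2%:E < rbar)%E).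
Hypothesis hslab : forall p, r1 <= height F p <= r2.
Local Notation lam' := (derive1 lam).
Local Notation g := (induced_metric gN lam F).

Lemma height_smooth (a : chart S) : smooth (img a) (height F \o psi a).
Proof.
move=> l s y ay; pose b := chart_at (F (psi a y)).2.
have by_ : Fdom F a b y by split => //; exact: chart_atP.
have E : (fun z => Floc F a b z 0 (lshift m 0)) = height F \o psi a.
  by apply/funext => z; rewrite /= -[RHS](Floc_l F a b z) [RHS]mxE.
rewrite -E; exact: (Floc_smooth hF).
Qed.

Variable Phi : R -> R.
Hypothesis dPhi : forall x, r1 <= x <= r2 -> is_derive x (1:R) Phi (lam x).

Let d1 (a : chart S) y : img a y ->
  is_derive ((height F \o psi a) y) (1:R) Phi (lam ((height F \o psi a) y)).
Proof. by move=> _; apply: dPhi; exact: hslab. Qed.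

Let hrange (p : S) : 0 <= height F p /\ ((height F p)%:E < rbar)%E.
Proof. by case: hF => H _ _ _; exact: H. Qed.

Let d2 (a : chart S) y : img a y ->
  is_derive ((height F \o psi a) y) (1:R) lam (lam' ((height F \o psi a) y)).
Proof.
move=> _; rewrite derive1E; apply: derivableP.
by apply: (@lam_derivable _ _ _ hlam 0%N); case: (hrange (psi a y)).
Qed.

Let c2 (a : chart S) y : img a y -> {for (height F \o psi a) y, continuous lam'}.
Proof.
by move=> _; apply: (@derive1n_continuous _ _ _ hlam _ _ hr1 hr2 1%N); exact: hslab.
Qed.

Let u := Phi \o height F.

Lemma Phi_height_C2 : Ck_fun 2 u.
Proof.
move=> a; apply: (@Ck2_comp R m (img a) (height F \o psi a) Phi lam lam').
- exact: open_img.
- exact: height_smooth.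
- exact: d1.
- exact: d2.
- exact: c2.
Qed.

Lemma norm_grad_Phi_height p :
  norm_grad g u p = lam (height F p) * norm_grad g (height F) p.
Proof.
have l0 : 0 < lam (height F p) by exact: (lam_height_gt0 hlam hF).
have E : norm_grad g u p ^+ 2 = (lam (height F p) * norm_grad g (height F) p) ^+ 2.
  rewrite exprMn !(norm_grad_sqr gN hlam hF) expr2 -mulrA -bilZr -bilZl.
  suff -> : \row_j pd j (u \o psi (chart_at p)) (coord_at p) =
    lam (height F p) *: \row_j pd j (height F \o psi (chart_at p)) (coord_at p) by [].
  apply/rowP => j; rewrite !mxE.
  have -> := @pd_comp R m (img (chart_at p)) (height F \o psi (chart_at p)) Phi lam
    (@open_img _ _ _ _) (@height_smooth _) (@d1 _) (coord_at p) j (coord_at_img p).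
  by rewrite /= psi_coord_at.
by apply: (pexpIrn (n := 2)) => //; rewrite nnegrE ?mulr_ge0 ?sqrtr_ge0 ?(ltW l0).
Qed.

(** L Phi(r) = lambda' (m - 2k) H_2k - lambda <d/dr, nu> H_(2k+1). *)
Lemma trace_op_Phi_height p :
  trace_op g (fun p => - 2 *: einstein_tensor g k p) u p =
  lam' (height F p) * ((m - k.*2)%:R * H_even gN lam F k p)
  - lam (height F p) * angle gN lam F nu p * H_odd gN lam F nu k p.
Proof.
pose a := chart_at p; pose y := coord_at p.
have ay : img a y by exact: coord_at_img.
have pE : psi a y = p by exact: psi_coord_at.
have l0 : lam (height F p) != 0 by apply: lt0r_neq0; exact: (lam_height_gt0 hlam hF).
have H i j : hessian (g a) (u \o psi a) y i j =
   lam' (height F p) * g a y i j - lam (height F p) * angle gN lam F nu p * second_ff gN lam F nu p i j.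
  transitivity (lam' (height F p) * (pd i (height F \o psi a) y * pd j (height F \o psi a) y)
     + lam (height F p) * hessian (g a) (height F \o psi a) y i j).
    rewrite [LHS]mxE.
    have -> := @pd2_comp R m (img a) (height F \o psi a) Phi lam lam'
      (@open_img _ _ _ _) (@height_smooth _) (@d1 _) (@d2 _) y i j ay.
    rewrite -addrA; congr (_ + _); first by rewrite /= pE.
    rewrite mxE mulrBr; congr (_ - _); first by rewrite /= pE.
    rewrite mulr_sumr; apply: eq_bigr => l _.
    have -> := @pd_comp R m (img a) (height F \o psi a) Phi lam
      (@open_img _ _ _ _) (@height_smooth _) (@d1 _) y l ay.
    by rewrite /= pE mulrCA.
  by rewrite (height_hessian hlam hF hnu p i j); exact: hessian_primitive.
rewrite /trace_op -/a -/y.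
transitivity (lam' (height F p) * (\sum_i \sum_j (- 2 * einstein k (g a) y i j) * g a y i j)
   - lam (height F p) * angle gN lam F nu p *
      (- 2 * \sum_i \sum_j einstein k (g a) y i j * second_ff gN lam F nu p i j)).
  rewrite !mulr_sumr -sumrB; apply: eq_bigr => i _.
  rewrite !mulr_sumr -sumrB; apply: eq_bigr => j _.
  rewrite H [X in X * _]mxE /einstein_tensor -/a -/y.
  exact: trace_term.
congr (_ * _ - _).
apply: einstein_trace; last exact: ltnW.
  exact: (induced_metric_unit gN hlam hF).
exact: (induced_metric_sym gN lam hF).
Qed.

End OmoriYau.

Section GradientVanishes.
Variables (R : realType) (m k : nat) (hk : (k.*2 < m)%N).
Variables (N : manifold R m) (gN : riemannian_metric N).
Variables (rbar : \bar R) (lam : R -> R) (hlam : warping_function rbar lam).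
Variables (S : manifold R m) (F : S -> R * N) (hF : hypersurface rbar F).
Variables (nu : chart N -> S -> 'rV[R]_(1 + m)) (hnu : unit_normal gN lam F nu).
Hypothesis hstar : star_shaped gN lam F nu.
Variables (r1 r2 : R).
Hypotheses (hr1 : 0 <= r1) (hr12 : r1 <= r2) (hr2 : (r2%:E < rbar)%E).
Hypothesis hslab : forall p, r1 <= height F p <= r2.
Local Notation lam' := (derive1 lam).
Local Notation g := (induced_metric gN lam F).
Hypothesis hOY : omori_yau g (trace_op g (fun p => - 2 *: einstein_tensor g k p)).
Variables (C1 C2 : R) (hC1 : 0 < C1).
Hypothesis hH : forall p, C1 <= H_even gN lam F k p <= C2.
(* the deficit in the hypothesis on H_(2k+1) / H_2k *)
Let D q := (m - k.*2)%:R * (lam' (height F q) / lam (height F q))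
       - H_odd gN lam F nu k q / H_even gN lam F k q.
Hypothesis hD : forall p, 0 <= D p.

(** If the deficit were bounded below by delta > 0, [omori_yau_estimate] would
    bound a positive constant by a multiple of 1 / i for every i. *)
Lemma inf_deficit_le0 : inf (range D) <= 0.
Proof.
rewrite leNgt; apply/negP => d0; set delta := inf _ in d0.
have dD p : delta <= D p.
  by apply: ge_inf; [exists 0 => _ [q _ <-] | exists p].
have [Phi dPhi] := antiderivative hlam hr1 hr2.
have [l0 l00 hl] := warping_lower_bound hlam hr1 hr12 hr2.
have [B hB] := warping_derive_bound hlam hr1 hr12 hr2.
have ub : has_ubound (range (Phi \o height F)).
  have cP : {within `[r1, r2], continuous Phi}.
    by apply: derivable_within_continuous => x; rewrite in_itv => /dPhi[].
  have [c _ Hc] := EVT_max hr12 cP.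
  by exists (Phi c) => _ [q _ <-]; apply: Hc; rewrite in_itv /=.
have [p Hp] := hOY (Phi_height_C2 hlam hF hr1 hr2 hslab dPhi) ub.
set c : R := (m - k.*2)%:R.
pose K := 1 + (C1 * l0 * delta + C2 * c * B) / l0.
have est i : (0 < i)%N -> C1 * l0 * delta < i%:R^-1 * K.
  move=> i0; have [_ g1 g2] := Hp i i0.
  rewrite (norm_grad_Phi_height gN hlam hF hslab dPhi) in g1.
  rewrite (trace_op_Phi_height hk hlam hF hnu hslab dPhi) in g2.
  have H0 : 0 < H_even gN lam F k (p i) by case/andP: (hH (p i)) => + _; exact: lt_le_trans.
  have E : H_odd gN lam F nu k (p i) = H_even gN lam F k (p i) *
      (c * (lam' (height F (p i)) / lam (height F (p i))) - D (p i)).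
    rewrite /D opprB addrC subrK mulrC divfK//; exact: lt0r_neq0.
  rewrite E in g2.
  apply: (omori_yau_estimate (t := norm_grad g (height F) (p i)) (D := D (p i))
    d0 hC1 l00 _ (hH (p i)) (hl _ (hslab (p i))) (hB _ (hslab (p i))) (hstar (p i))) => //.
  - exact: sqrtr_ge0.
  - exact: (norm_grad_height hlam hF hnu).
have P0 : 0 < C1 * l0 * delta by rewrite !mulr_gt0.
have K0 : 0 < K by have := est 1%N isT; rewrite invr1 mul1r; exact: lt_trans.
have := archi_boundP (ltW (divr_gt0 K0 P0)).
set n := Num.bound _ => nK.
have n0 : (0 < n)%N by rewrite -(ltr0n R); apply: lt_trans nK; rewrite divr_gt0.
have := est n n0; rewrite [X in _ < X]mulrC ltr_pdivlMr ?ltr0n// => E.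
by move: nK; rewrite ltr_pdivrMr// mulrC => /(lt_trans E); rewrite ltxx.
Qed.

End GradientVanishes.

(** * Functions with vanishing gradient *)

Section LocallyConstant.
Variables (R : realType) (m : nat) (X : manifold R m).

(** A nonempty open and closed subset of a connected manifold is everything. *)
Lemma manifold_clopen (B : set X) : B !=set0 ->
  (forall p, B p -> \forall q \near p, B q) ->
  (forall p, ~ B p -> \forall q \near p, ~ B q) -> forall p, B p.
Proof.
move=> B0 oB cB p.
have oB' : open B by rewrite openE => q /oB.
have cB' : open (~` B) by rewrite openE => q /cB.
suff -> : B = setT by [].
apply: (@manifold_connected _ _ X B B0).
  by exists B; rewrite ?setTI.
by exists B; rewrite ?setTI// -[B]setCK; exact: open_closedC.
Qed.

Lemma near_chart (a : chart X) p (A : set 'rV[R]_m) : dom a p ->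
  nbhs (phi a p) A -> \forall q \near p, dom a q /\ A (phi a q).
Proof.
move=> ap nA; apply: filterI.
  by apply: open_nbhs_nbhs; split => //; exact: dom_open.
exact: (phi_continuous ap).
Qed.

Lemma pd_chart_change (u : X -> R) (a b : chart X) y j :
  img a y -> dom b (psi a y) ->
  differentiable (u \o psi b) (phi b (psi a y)) ->
  pd j (u \o psi a) y =
  \sum_i pd i (u \o psi b) (phi b (psi a y)) * pd j (fun z => phi b (psi a z) 0 i) y.
Proof.
move=> ay bp du.
transitivity (pd j ((u \o psi b) \o (phi b \o psi a)) y).
  apply: pd_near_eq.
  have : nbhs y [set z | img a z /\ dom b (psi a z)].
    by apply: open_nbhs_nbhs; split => //; exact: open_transition_dom.
  by apply: filterS => z [az bz] /=; rewrite phiK.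
by rewrite /pd derive_comp_pd//; exact: transition_differentiable.
Qed.

(** The derivatives of [u] are assumed to vanish at each point in the preferred
    chart of that point only; the chain rule transfers this to a common chart. *)
Lemma locally_constant (u : X -> R) :
  (forall a : chart X, smooth (img a) (u \o psi a)) ->
  (forall p j, pd j (u \o psi (chart_at p)) (coord_at p) = 0) ->
  forall p, \forall q \near p, u q = u p.
Proof.
move=> su du p; pose a := chart_at p.
have ap : dom a p by exact: chart_atP.
have df (c : chart X) z : img c z -> differentiable (u \o psi c) z.
  by move=> cz; apply: (smooth_differentiable (@open_img _ _ X c) (su c)).
have d0 z j : img a z -> pd j (u \o psi a) z = 0.
  move=> az; pose b := chart_at (psi a z).
  have bp : dom b (psi a z) by exact: chart_atP.
  rewrite (@pd_chart_change u a b)//; last by apply: df; exact: img_phi.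
  by rewrite big1// => i _; rewrite -/(coord_at _) du mul0r.
have : nbhs (phi a p) (img a).
  by apply: open_nbhs_nbhs; split; [exact: open_img|exact: img_phi].
move=> /nbhs_ballP[e /= e0 He].
have nB : nbhs (phi a p) (ball (phi a p) e) by exact: nbhsx_ballx.
apply: filterS (near_chart ap nB) => q [aq bq].
have B t : 0 <= t <= 1 -> img a (phi a p + t *: (phi a q - phi a p)).
  move=> /andP[t0 t1]; apply: He; move: bq.
  rewrite -ball_normE /= opprD addrA subrr sub0r normrN normrZ ger0_norm// distrC => bq.
  by apply: le_lt_trans bq; rewrite ler_piMl.
have [t t01] := @MVT_line R _ (u \o psi a) (phi a p) (phi a q - phi a p)
  (fun t t01 => diff_derivable (df a _ (B t t01))).
rewrite deriveE_pd; last exact: df (B t t01).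
rewrite big1 => [|i _]; last by rewrite d0 ?mulr0//; exact: B.
by rewrite [phi a p + _]addrC subrK /= !phiK// => /subr0_eq.
Qed.

Lemma constant_of_pd0 (u : X -> R) :
  (forall a : chart X, smooth (img a) (u \o psi a)) ->
  (forall p j, pd j (u \o psi (chart_at p)) (coord_at p) = 0) ->
  exists c, forall p, u p = c.
Proof.
move=> su du; have lc := locally_constant su du.
have [p0 _] := manifold_nonempty X.
exists (u p0); apply: manifold_clopen; first by exists p0.
  by move=> p <-; exact: lc.
by move=> p np; apply: filterS (lc p) => q ->.
Qed.

End LocallyConstant.

Lemma norm_grad_eq0 (R : realType) (m : nat) (N : manifold R m) (gN : riemannian_metric N)
  (rbar : \bar R) (lam : R -> R) (hlam : warping_function rbar lam)
  (S : manifold R m) (F : S -> R * N) (hF : hypersurface rbar F) (u : S -> R) p :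
  norm_grad (induced_metric gN lam F) u p = 0 ->
  forall j, pd j (u \o psi (chart_at p)) (coord_at p) = 0.
Proof.
move=> n0 j; have := norm_grad_sqr gN hlam hF p u.
rewrite n0 expr0n /=; set g := induced_metric _ _ _ _ _; set du := \row_j _ => E.
have cp := coord_at_img p.
have ug : g \in unitmx by exact: (induced_metric_unit gN hlam hF cp).
have sg : g^T = g by exact: (induced_metric_sym gN lam hF cp).
have [z|nz] := eqVneq (du *m invmx g) 0.
  have : du = 0 by rewrite -[du](mulmxKV ug) z mul0mx.
  by move/rowP/(_ j); rewrite !mxE.
have := induced_metric_posdef gN hlam hF cp nz.
by rewrite -/g bil_raise// -E ltxx.
Qed.

(** * Curves of bounded speed *)

(** No measurability of [f] is needed: the integral of a nonnegative function is
    a supremum over the simple functions below it. *)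
Lemma ge0_Rintegral_le_cst (R : realType) (f : R -> R) (T : R) :
  (forall t, 0 <= f t) -> (forall t, f t <= T) ->
  \int[@lebesgue_measure R]_(t in `[0, 1]) f t <= T.
Proof.
move=> f0 fT; have T0 : 0 <= T by exact: le_trans (f0 0) (fT 0).
rewrite /Rintegral.
have I0 : (0 <= \int[@lebesgue_measure R]_(t in `[0%R, 1%R]) (f t)%:E)%E.
  by apply: integral_ge0 => t _; rewrite lee_fin.
have IT : (\int[@lebesgue_measure R]_(t in `[0%R, 1%R]) (f t)%:E <= T%:E)%E.
  have <- : (\int[@lebesgue_measure R]_(t in `[0%R, 1%R]) (cst T%:E t) = T%:E)%E.
    rewrite integral_cst//= lebesgue_measure_itv/= lte_fin ltr01 oppr0 adde0.
    by rewrite mule1.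
  rewrite !ge0_integralE; last 2 first.
  - by move=> t _; rewrite lee_fin.
  - by move=> t _; rewrite lee_fin.
  apply: le_ereal_sup => _ [h hf <-]; exists h => // x.
  apply: le_trans (hf x) _; rewrite /patch; case: ifP => // _.
  by rewrite lee_fin.
have fI : (\int[@lebesgue_measure R]_(t in `[0%R, 1%R]) (f t)%:E)%E \is a fin_num.
  by rewrite ge0_fin_numE//; apply: le_lt_trans IT _; rewrite ltry.
by rewrite -lee_fin fineK.
Qed.

Lemma near_preimage (T U : topologicalType) (f : T -> U) (t : T) (P : set U) :
  {for t, continuous f} -> nbhs (f t) P -> \forall s \near t, P (f s).
Proof. by move=> cf /cf. Qed.

Section Affine.
Variables (R : realType) (V : normedModType R).

(** Reparametrization of a curve by [s |-> al * s + be]. *)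
Lemma derive1_affine (f : R -> V) (al be t : R) :
  derivable f (al * t + be) 1 ->
  derivable (fun s => f (al * s + be)) t 1 /\
  derive1 (fun s => f (al * s + be)) t = al *: derive1 f (al * t + be).
Proof.
move=> df; pose h (s : R) := al * s + be.
have dh : is_derive t (1:R) h al.
  have -> : h = al *: (@id R) + cst be by apply/funext.
  apply: is_derive_eq.
  by rewrite /GRing.scale /= mulr1 addr0.
have Dh : differentiable h t by apply/derivable1_diffP; case: dh.
have Df : differentiable f (h t) by exact/derivable1_diffP.
have Dc : differentiable (f \o h) t by exact: differentiable_comp.
split; first exact/derivable1_diffP.
rewrite derive1E deriveE// diff_comp//= (diff1E Df) -deriveE//.
by case: dh => _ ->.
Qed.

Lemma norm_in_scale m (G : 'M[R]_m) (v : 'rV[R]_m) (c : R) :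
  norm_in G (c *: v) = `|c| * norm_in G v.
Proof.
rewrite /norm_in linearZ /= -!scalemxAl -scalemxAr scalerA mxE -expr2.
by rewrite sqrtrM ?sqr_ge0// sqrtr_sqr.
Qed.

End Affine.

Section Curves.
Variables (R : realType) (m : nat) (X : manifold R m) (g : tensor2 X).
Implicit Types c : R -> X.

(** The conditions of [C1_curve] at a single time. *)
Definition C1_curve_at c (t : R) : Prop :=
  {for t, continuous c} /\
  forall a, dom a (c t) ->
    derivable (phi a \o c) t 1 /\ {for t, continuous (derive1 (phi a \o c))}.

Lemma C1_curveP c : C1_curve c <-> forall t, C1_curve_at c t.
Proof.
split => [[cc H] t|H]; first by split; [exact: cc | move=> a; exact: H].
by split => [t|a t]; [case: (H t) | case: (H t) => _; apply].
Qed.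

Lemma derive1_near (V : normedModType R) (f h : R -> V) t :
  (\forall s \near t, f s = h s) -> derive1 f t = derive1 h t.
Proof. by move=> fh; rewrite !derive1E; exact: near_eq_derive. Qed.

Lemma C1_curve_at_near c c' t : (\forall s \near t, c s = c' s) ->
  C1_curve_at c t -> C1_curve_at c' t /\ speed g c' t = speed g c t.
Proof.
move=> cc' [C H]; have E := nbhs_singleton cc'.
have pE a : \forall s \near t, (phi a \o c) s = (phi a \o c') s.
  by apply: filterS cc' => s /= ->.
split; last first.
  rewrite /speed -E; congr norm_in; apply: derive1_near.
  by apply: filterS (pE (chart_at (c t))) => s ->.
split; first exact: continuous_near cc' C.
move=> a; rewrite -E => /H[d cd]; split; first exact: near_eq_derivable (pE a) d.
have E1 : \forall s \near t, derive1 (phi a \o c) s = derive1 (phi a \o c') s.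
  by apply: filterS (near_join (pE a)) => s; exact: derive1_near.
exact: continuous_near E1 cd.
Qed.

Lemma C1_curve_near_derivable c a t : C1_curve c -> dom a (c t) ->
  \forall s \near t, derivable (phi a \o c) s 1.
Proof.
move=> [cc H] ac.
have : nbhs (c t) (dom a) by apply: open_nbhs_nbhs; split => //; exact: dom_open.
move/(cc t) => ns; have {}ns : \forall s \near t, dom a (c s) by [].
by apply: filterS ns => s /H[].
Qed.

Lemma C1_curve_affine c (al be : R) : C1_curve c ->
  C1_curve (fun s => c (al * s + be)) /\
  forall t, speed g (fun s => c (al * s + be)) t = `|al| * speed g c (al * t + be).
Proof.
move=> C1c; have [cc H] := C1c.
have ca : continuous (fun s : R => al * s + be).
  by move=> s; apply: cvgD; [apply: cvgMr; exact: cvg_id | exact: cvg_cst].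
have nd a t : dom a (c (al * t + be)) -> \forall s \near t,
   derivable (phi a \o c) (al * s + be) 1.
  move=> ac.
  have nb : nbhs (al * t + be) [set s | derivable (phi a \o c) s 1].
    exact: C1_curve_near_derivable C1c ac.
  exact: (near_preimage (ca t) nb).
split; last first.
  move=> t; rewrite /speed -norm_in_scale; congr norm_in.
  have [d _] := H _ _ (chart_atP (c (al * t + be))).
  by have [_ <-] := derive1_affine d.
split; first by move=> s; apply: continuous_comp; [exact: ca | exact: cc].
move=> a t ac; have [d cd] := H a _ ac.
have [da _] := derive1_affine d.
split; first exact: da.
have E : \forall s \near t, al *: derive1 (phi a \o c) (al * s + be) =
   derive1 (phi a \o (fun s => c (al * s + be))) s.
  by apply: filterS (nd a t ac) => s ds; have [_ <-] := derive1_affine ds.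
apply: continuous_near E _.
apply: cvgZl_tmp; apply: continuous_comp; [exact: ca | exact: cd].
Qed.

(** [q] can be reached from [p] in time [T] at speed at most 1, along a C^1 curve
    defined on the whole line that rests at [p] until some time after 0 and at [q]
    from some time before [T] on.  Resting at both ends makes concatenations
    C^1. *)
Definition reach (p q : X) (T : R) : Prop :=
  0 < T /\ exists c eta, [/\ 0 < eta, C1_curve c,
    forall t, t < eta -> c t = p,
    forall t, T - eta < t -> c t = q
  & forall t, speed g c t <= 1].

Lemma reach_sym p q T : reach p q T -> reach q p T.
Proof.
move=> [T0 [c [eta [e0 C c0 cT sc]]]].
have [C' S'] := C1_curve_affine (-1) T C.
split; first exact: T0.
exists (fun s => c (-1 * s + T)), eta; split; [exact: e0 | exact: C' | | | ].
- by move=> t te; apply: cT; lra.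
- by move=> t te; apply: c0; lra.
- by move=> t; rewrite S' normrN1 mul1r.
Qed.

Lemma reach_trans p q r T1 T2 : reach p q T1 -> reach q r T2 -> reach p r (T1 + T2).
Proof.
move=> [T10 [c1 [e1 [e10 C1 c10 c1T s1]]]] [T20 [c2 [e2 [e20 C2 c20 c2T s2]]]].
split; first exact: addr_gt0.
have [C2' S2'] := C1_curve_affine 1 (- T1) C2.
pose c2' s := c2 (1 * s + - T1).
pose c (t : R) := if t < T1 then c1 t else c2' t.
(* the concatenation agrees near each time with one of the two curves: around
   T1 both of them rest at q *)
have n1 t : t < T1 + e2 -> \forall s \near t, c1 s = c s.
  move=> te; near=> s.
  have se : s < T1 + e2 by near: s; exact: lt_nbhsl.
  rewrite /c; case: ltP => // T1s.
  by rewrite /c2' c20 ?c1T//; lra.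
have n2 t : T1 - e1 < t -> \forall s \near t, c2' s = c s.
  move=> te; near=> s.
  have se : T1 - e1 < s by near: s; exact: lt_nbhsr.
  rewrite /c; case: ltP => // T1s.
  by rewrite /c2' c20 ?c1T//; lra.
have K t : C1_curve_at c t /\ speed g c t <= 1.
  case: (ltP t (T1 + e2)) => te.
    have [A ->] := C1_curve_at_near (n1 t te) ((C1_curveP c1).1 C1 t).
    by split.
  have te' : T1 - e1 < t by lra.
  have [A ->] := C1_curve_at_near (n2 t te') ((C1_curveP c2').1 C2' t).
  by split => //; rewrite S2' normr1 mul1r.
exists c, (Num.min (Num.min e1 e2) (Num.min T1 T2)); split.
- by rewrite !lt_min e10 e20 T10 T20.
- by apply/C1_curveP => t; case: (K t).
- move=> t; rewrite !lt_min => /andP[/andP[t1 t2] /andP[t3 t4]].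
  by rewrite /c t3 c10.
- move=> t; rewrite ltrBlDr => h.
  have [m1 m2] : Num.min (Num.min e1 e2) (Num.min T1 T2) <= e2 /\
     Num.min (Num.min e1 e2) (Num.min T1 T2) <= T2.
    by rewrite !ge_min !lexx !orbT.
  rewrite /c ltNge (_ : T1 <= t) ?/c2' ?c2T//; lra.
- by move=> t; case: (K t).
Unshelve. all: by end_near. Qed.

Lemma speed_ge0 c t : 0 <= speed g c t.
Proof. exact: sqrtr_ge0. Qed.

(** The curve is run through on [0, 1], at speed at most [T]. *)
Lemma dist_le_reach p q T : reach p q T -> dist g p q <= T.
Proof.
move=> [T0 [c [eta [e0 C c0 cT sc]]]].
have [C' S'] := C1_curve_affine T 0 C.
pose c' s := c (T * s + 0).
apply: (@le_trans _ _ (curve_length g c')).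
  apply: ge_inf.
    exists 0 => _ [d _ <-]; apply: Rintegral_ge0 => t _; exact: speed_ge0.
  exists c' => //; split => //; first by rewrite /c' c0// mulr0 addr0.
  by rewrite /c' cT// mulr1 addr0; lra.
apply: ge0_Rintegral_le_cst => t; first exact: speed_ge0.
by rewrite S' gtr0_norm// -[leRHS]mulr1 ler_wpM2l// ltW.
Qed.

End Curves.

(** * A C^1 step function *)

Section SmoothStep.
Variable R : realType.

(** A second order bound on the increments determines the derivative. *)
Lemma is_derive_quadratic (f : R -> R) (t d : R) :
  (forall h, `|f (h + t) - f t - d * h| <= h ^+ 2) -> is_derive t (1:R) f d.
Proof.
move=> H.
have C : (fun h : R => h^-1 *: ((f \o shift t) (h *: (1:R)) - f t)) @ 0^' --> d.
  apply/cvgrPdist_lt => e e0; near=> h.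
  have h0 : h != 0 by near: h; exact: nbhs_dnbhs_neq.
  have he : `|h| < e by near: h; exact: dnbhs0_lt.
  apply: le_lt_trans he; rewrite /= [h *: 1]mulr1 distrC.
  have -> : h^-1 *: (f (h + t) - f t) - d = h^-1 * (f (h + t) - f t - d * h).
    by rewrite /GRing.scale /= [in RHS]mulrBr mulrCA mulVf ?mulr1.
  rewrite normrM normfV ler_pdivrMl ?normr_gt0//.
  by apply: le_trans (H h) _; rewrite -normrM -expr2 ger0_norm ?sqr_ge0.
by split; [apply/cvg_ex; exists d | exact/cvg_lim].
Unshelve. all: by end_near. Qed.

(** The square of the positive part of [t], which is C^1. *)
Definition pos_sqr (t : R) : R := (t ^+ 2 + t * `|t|) / 2.

Lemma pos_sqr_ge0 t : 0 <= t -> pos_sqr t = t ^+ 2.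
Proof. by move=> t0; rewrite /pos_sqr ger0_norm// -expr2; field. Qed.

Lemma pos_sqr_le0 t : t <= 0 -> pos_sqr t = 0.
Proof. by move=> t0; rewrite /pos_sqr ler0_norm//; field. Qed.

Lemma is_derive_pos_sqr t : is_derive t (1:R) pos_sqr (t + `|t|).
Proof.
apply: is_derive_quadratic => h.
have [t0|/ltW t0] := leP 0 t; have [ht|/ltW ht] := leP 0 (h + t).
- rewrite !pos_sqr_ge0// (ger0_norm t0).
  have -> : (h + t) ^+ 2 - t ^+ 2 - (t + t) * h = h ^+ 2 by ring.
  by rewrite ger0_norm// sqr_ge0.
- rewrite pos_sqr_le0// pos_sqr_ge0// (ger0_norm t0) ler_norml; apply/andP; split; nra.
- rewrite pos_sqr_ge0// pos_sqr_le0// (ler0_norm t0) ler_norml; apply/andP; split; nra.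
- rewrite !pos_sqr_le0// (ler0_norm t0) !subrr mul0r subr0 normr0 sqr_ge0//.
Qed.

(** A C^1 function equal to 0 before 1/4 and to 1 after 3/4: half the second
    difference of [pos_sqr], rescaled. *)
Definition smoothstep (t : R) : R :=
  (pos_sqr (4 * t + (-1)) - 2 * pos_sqr (4 * t + (-2)) + pos_sqr (4 * t + (-3))) / 2.

(** The derivative of [smoothstep], a continuous tent with values in [0, 4]. *)
Definition smoothstep' (t : R) : R :=
  2 * ((4 * t - 1 + `|4 * t - 1|) - 2 * (4 * t - 2 + `|4 * t - 2|)
    + (4 * t - 3 + `|4 * t - 3|)).

Lemma is_derive_smoothstep t : is_derive t (1:R) smoothstep (smoothstep' t).
Proof.
have H (b : R) : is_derive t (1:R) (fun s => pos_sqr (4 * s + b)) (4 * (4 * t + b + `|4 * t + b|)).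
  have [d D] := is_derive_pos_sqr (4 * t + b).
  have [d' D'] := derive1_affine d.
  by split => //; rewrite -derive1E D' derive1E D.
have -> : smoothstep = (2^-1 : R) *: ((fun s => pos_sqr (4 * s + (-1)))
   - (2 : R) *: (fun s => pos_sqr (4 * s + (-2))) + (fun s => pos_sqr (4 * s + (-3)))).
  by apply/funext => s; rewrite /smoothstep !fctE /GRing.scale /= mulrC.
have H1 := H (-1); have H2 := H (-2); have H3 := H (-3).
have D := is_deriveD (is_deriveB H1 (@is_deriveZ _ _ _ _ (2 : R) _ _ _ H2)) H3.
have D2 := @is_deriveZ _ _ _ _ (2^-1 : R) _ _ _ D.
by apply: (is_derive_eq D2); rewrite /smoothstep' /GRing.scale /=; field.
Qed.

Lemma smoothstep0 t : t < 4^-1 -> smoothstep t = 0.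
Proof.
by move=> t4; rewrite /smoothstep !pos_sqr_le0 ?mulr0 ?subr0 ?addr0 ?mul0r//; lra.
Qed.

Lemma smoothstep1 t : 3 / 4 < t -> smoothstep t = 1.
Proof. by move=> t4; rewrite /smoothstep !pos_sqr_ge0; [field|lra..]. Qed.

Lemma smoothstep'_bound t : 0 <= smoothstep' t <= 4.
Proof.
rewrite /smoothstep'.
have [a1|/ltW a1] := leP 0 (4 * t - 1); have [a2|/ltW a2] := leP 0 (4 * t - 2);
have [a3|/ltW a3] := leP 0 (4 * t - 3);
rewrite ?(ger0_norm a1) ?(ler0_norm a1) ?(ger0_norm a2) ?(ler0_norm a2)
  ?(ger0_norm a3) ?(ler0_norm a3); apply/andP; split; lra.
Qed.

Lemma smoothstep_bound t : 0 <= smoothstep t <= 1.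
Proof.
rewrite /smoothstep.
have [a1|/ltW a1] := leP 0 (4 * t + (-1)); have [a2|/ltW a2] := leP 0 (4 * t + (-2));
have [a3|/ltW a3] := leP 0 (4 * t + (-3));
rewrite ?(pos_sqr_ge0 a1) ?(pos_sqr_le0 a1) ?(pos_sqr_ge0 a2) ?(pos_sqr_le0 a2)
  ?(pos_sqr_ge0 a3) ?(pos_sqr_le0 a3); apply/andP; split; nra.
Qed.

Lemma smoothstep'_continuous : continuous smoothstep'.
Proof.
have cb (b : R) : continuous (fun t : R => 4 * t - b).
  by move=> t; apply: cvgB; [apply: cvgMr; exact: cvg_id | exact: cvg_cst].
have H (b : R) : continuous (fun t : R => 4 * t - b + `|4 * t - b|).
  move=> t; apply: cvgD; first exact: cb.
  by apply: cvg_norm; exact: cb.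
move=> t; apply: cvgMr; apply: cvgD; last exact: H.
by apply: cvgB; [exact: H | apply: cvgMr; exact: H].
Qed.

End SmoothStep.

(** * Segments in a chart *)

Lemma continuous_row (R : realType) (T : topologicalType) m (f : T -> 'rV[R]_m) (t : T) :
  (forall j, {for t, continuous (fun s => f s 0 j)}) -> {for t, continuous f}.
Proof.
move=> H; apply/cvgrPdist_le => e e0.
have : \forall s \near t, forall j : 'I_m, `|f t 0 j - f s 0 j| <= e.
  apply: (@filter_forall _ _ (fun j s => `|f t 0 j - f s 0 j| <= e) (nbhs t)) => j.
  by move: (H j) => /cvgrPdist_le/(_ e e0).
apply: filterS => s hs; apply: norm_row_le; first exact: ltW.
by move=> j; have := hs j; rewrite !mxE.
Qed.

Section ChartCurves.
Variables (R : realType) (m : nat) (X : manifold R m) (g : tensor2 X).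
Hypothesis tg : forall (a b : chart X) y, img a y -> dom b (psi a y) ->
  g a y = 'J (phi b \o psi a) y *m g b (phi b (psi a y)) *m ('J (phi b \o psi a) y)^T.

Lemma derive_chart_change (a b : chart X) (gam : R -> 'rV[R]_m) t :
  derivable gam t 1 -> img a (gam t) -> dom b (psi a (gam t)) ->
  derivable (phi b \o psi a \o gam) t 1 /\
  derive1 (phi b \o psi a \o gam) t = derive1 gam t *m 'J (phi b \o psi a) (gam t).
Proof.
move=> dgam at_ bt.
have Dg : differentiable gam t by exact/derivable1_diffP.
have Dt := transition_differentiable at_ bt.
split; first by apply/derivable1_diffP; exact: (differentiable_comp Dg Dt).
by rewrite !derive1E; exact: (@derive_comp_jacobian _ _ _ _ gam (phi b \o psi a) t 1 Dg Dt).
Qed.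

(** The speed of a curve does not depend on the chart. *)
Lemma speedE (c : R -> X) a t : C1_curve c -> dom a (c t) ->
  speed g c t = norm_in (g a (phi a (c t))) (derive1 (phi a \o c) t).
Proof.
move=> [cc H] at_; rewrite /speed; set b := chart_at (c t).
have bt : dom b (c t) by exact: chart_atP.
have [d _] := H a t at_.
have ia : img a (phi a (c t)) by exact: img_phi.
have bpt : dom b (psi a (phi a (c t))) by rewrite phiK.
have [_ E] := derive_chart_change d ia bpt.
have -> : derive1 (phi b \o c) t = derive1 (phi b \o psi a \o (phi a \o c)) t.
  apply: derive1_near.
  have : \forall s \near t, dom a (c s).
    by apply: near_preimage (cc t) _; apply: open_nbhs_nbhs; split => //; exact: dom_open.
  by apply: filterS => s as_ /=; rewrite phiK.
rewrite E (tg ia bpt) /norm_in /metric_at /coord_at phiK//.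
by rewrite trmx_mul !mulmxA.
Qed.

Lemma chart_segment_C1 (a : chart X) (y0 v : 'rV[R]_m) (k k' : R -> R) :
  (forall t, img a (y0 + k t *: v)) ->
  (forall t, is_derive t (1:R) k (k' t)) -> continuous k' ->
  C1_curve (fun t => psi a (y0 + k t *: v)).
Proof.
move=> ia dk ck'.
pose gam t := y0 + k t *: v.
have ck : continuous k.
  by move=> t; apply: differentiable_continuous; apply/derivable1_diffP; case: (dk t).
have dgam t : is_derive t (1:R) gam (k' t *: v).
  have Dk : differentiable k t by apply/derivable1_diffP; case: (dk t).
  have Dz : differentiable (fun t => k t *: v) t by exact: differentiableZl.
  have -> : gam = cst y0 + (fun t => k t *: v) by [].
  have dz : is_derive t (1:R) (fun t => k t *: v) (k' t *: v).
    split; first exact/derivable1_diffP.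
    by rewrite deriveE// diffZl// -deriveE//; case: (dk t) => _ ->.
  apply: (is_derive_eq (is_deriveD (is_derive_cst y0 t 1) dz)).
  by rewrite add0r.
have cgam : continuous gam.
  by move=> t; apply: differentiable_continuous; apply/derivable1_diffP; case: (dgam t).
have cc : continuous (psi a \o gam).
  by move=> t; apply: continuous_comp; [exact: cgam | exact: psi_continuous (ia t)].
split; first exact: cc.
move=> b t bt.
have [dt _] : derivable gam t 1 /\ True by split => //; case: (dgam t).
have [D _] := derive_chart_change dt (ia t) bt.
split; first exact: D.
have nb : \forall s \near t, dom b (psi a (gam s)).
  by apply: near_preimage (cc t) _; apply: open_nbhs_nbhs; split => //; exact: dom_open.
have E : \forall s \near t, k' s *: (v *m 'J (phi b \o psi a) (gam s)) =
    derive1 (phi b \o (fun t => psi a (y0 + k t *: v))) s.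
  apply: filterS nb => s bs.
  have ds : derivable gam s 1 by case: (dgam s).
  have [_ ->] := derive_chart_change ds (ia s) bs.
  by rewrite derive1E (@derive_val _ _ _ _ _ _ _ (dgam s)) scalemxAl.
apply: continuous_near E _.
suff cw : {for t, continuous (fun s => v *m 'J (phi b \o psi a) (gam s))}.
  by apply: cvgZ; [exact: ck' | exact: cw].
have oU := @open_transition_dom _ _ X a b.
have sT := @transition_smooth _ _ X a b.
have Ut : [set y | img a y /\ dom b (psi a y)] (gam t) by split; [exact: ia | exact: bt].
apply: continuous_row => j.
have E2 : \forall s \near t, \sum_i v 0 i * pd i (fun z => phi b (psi a z) 0 j) (gam s) =
  (v *m 'J (phi b \o psi a) (gam s)) 0 j.
  apply: filterS nb => s bs; rewrite [RHS]mxE; apply: eq_bigr => i _.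
  by rewrite jacobianE//; exact: transition_differentiable (ia s) bs.
apply: continuous_near E2 _.
apply: (@cvg_sum_fin R _ (nbhs t) _ m (fun i s => v 0 i * pd i (fun z => phi b (psi a z) 0 j) (gam s))) => i.
apply: cvgMr.
apply: (@continuous_comp _ _ _ gam (pd i (fun z => phi b (psi a z) 0 j))); first exact: cgam.
exact: smooth_continuous (smooth_pd i (sT j)) Ut.
Qed.

(** If [v] has norm at most [B] all along the segment, the end point is reached in
    time 4 B: the segment is run through with the [smoothstep] profile, whose
    derivative is at most 4. *)
Lemma chart_segment_reach (a : chart X) (y0 v : 'rV[R]_m) (B : R) : 0 < B ->
  (forall s, 0 <= s <= 1 -> img a (y0 + s *: v)) ->
  (forall s, 0 <= s <= 1 -> norm_in (g a (y0 + s *: v)) v <= B) ->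
  reach g (psi a y0) (psi a (y0 + v)) (4 * B).
Proof.
move=> B0 ia nv.
pose al := (4 * B)^-1.
have al0 : 0 < al by rewrite invr_gt0 mulr_gt0.
pose k t := smoothstep (al * t + 0).
pose k' t := al * smoothstep' (al * t + 0).
have dk t : is_derive t (1:R) k (k' t).
  have [d D] := is_derive_smoothstep (al * t + 0).
  have [d' D'] := derive1_affine d.
  by split => //; rewrite -derive1E D' derive1E D.
have ck' : continuous k'.
  move=> t; apply: cvgMr.
  apply: (@continuous_comp _ _ _ (fun t => al * t + 0) (@smoothstep' R)).
    by apply: cvgD; [apply: cvgMr; exact: cvg_id | exact: cvg_cst].
  exact: smoothstep'_continuous.
have ik t : img a (y0 + k t *: v) by apply: ia; exact: smoothstep_bound.
have C := chart_segment_C1 ik dk ck'.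
split; first by rewrite mulr_gt0.
exists (fun t => psi a (y0 + k t *: v)), B; split => //.
- move=> t tB; rewrite /k smoothstep0 ?scale0r ?addr0//.
  by rewrite /al mulrC ltr_pdivrMr ?mulr_gt0// mulrA mulVf ?mul1r.
- move=> t tB; rewrite /k smoothstep1 ?scale1r//.
  by rewrite addr0 [al * t]mulrC /al ltr_pdivlMr ?mulr_gt0//; lra.
- move=> t; rewrite (speedE C (psi_dom (ik t))) psiK//.
  have -> : derive1 (phi a \o (fun t => psi a (y0 + k t *: v))) t = k' t *: v.
    have -> : phi a \o (fun t => psi a (y0 + k t *: v)) = cst y0 + (fun t => k t *: v).
      by apply/funext => s /=; rewrite psiK.
    have Dk : differentiable k t by apply/derivable1_diffP; case: (dk t).
    have Dz : differentiable (fun t => k t *: v) t by exact: differentiableZl.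
    rewrite derive1E deriveD//; last exact: diff_derivable.
    by rewrite derive_cst add0r deriveE// diffZl// -deriveE//; case: (dk t) => _ ->.
  rewrite norm_in_scale.
  apply: (@le_trans _ _ (`|k' t| * B)).
    by rewrite ler_wpM2l//; apply: nv; exact: smoothstep_bound.
  have /andP[s0 s4] := smoothstep'_bound (al * t + 0).
  have -> : `|k' t| = al * smoothstep' (al * t + 0).
    by rewrite ger0_norm// mulr_ge0// ltW.
  rewrite mulrAC.
  have -> : al * B = 4^-1 by rewrite /al; field; rewrite lt0r_neq0.
  by rewrite ler_pdivrMl// mulr1.
Qed.

Lemma norm_in_bound (G : 'M[R]_m) (M : R) (v : 'rV[R]_m) : 1 <= M ->
  (forall i j, `|G i j| <= M) -> norm_in G v <= m%:R * M * `|v|.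
Proof.
move=> M1 GM; have M0 : 0 <= M by exact: le_trans M1.
rewrite /norm_in -/(bil G v v).
apply: (@le_trans _ _ (Num.sqrt ((m%:R * M * `|v|) ^+ 2))); last first.
  by rewrite sqrtr_sqr ger0_norm// !mulr_ge0.
apply: ler_wsqrtr; rewrite bilE.
apply: (@le_trans _ _ (\sum_(A < m) \sum_(B < m) `|v| * M * `|v|)).
  apply: ler_sum => A _; apply: ler_sum => B _; apply: le_trans (ler_norm _) _.
  rewrite !normrM; apply: ler_pM; rewrite ?mulr_ge0 ?norm_row_ge//.
  by apply: ler_pM; rewrite ?norm_row_ge.
rewrite !sumr_const !card_ord.
rewrite -(mulr_natl (`|v| * M * `|v|) m) -(mulr_natl (m%:R * (`|v| * M * `|v|)) m).
have -> : (m%:R * M * `|v|) ^+ 2 = m%:R * (m%:R * (`|v| * M * `|v|)) * M by ring.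
by rewrite ler_peMr// !mulr_ge0.
Qed.

Hypothesis cg : forall (a : chart X) y i j, img a y -> {for y, continuous (fun z => g a z i j)}.

(** Near a point a continuous metric is dominated by a multiple of the norm of the
    chart. *)
Lemma norm_in_locally_bounded (a : chart X) y : img a y ->
  exists2 K, 0 < K & \forall z \near y, img a z /\ forall v, norm_in (g a z) v <= K * `|v|.
Proof.
move=> ay; pose M0 := \sum_i \sum_j `|g a y i j|.
have M00 : 0 <= M0 by rewrite sumr_ge0// => i _; rewrite sumr_ge0.
have gM i j : `|g a y i j| <= M0.
  rewrite /M0 (bigD1 i)//= (bigD1 j)//= -addrA lerDl addr_ge0//.
    by rewrite sumr_ge0.
  by rewrite sumr_ge0// => i' _; rewrite sumr_ge0.
exists (m%:R * (M0 + 1) + 1); first by rewrite ltr_wpDl// mulr_ge0// addr_ge0.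
have : \forall z \near y, forall i : 'I_m, forall j : 'I_m, `|g a y i j - g a z i j| <= 1.
  apply: (@filter_forall _ _ (fun i z => forall j : 'I_m, `|g a y i j - g a z i j| <= 1) (nbhs y)) => i.
  apply: (@filter_forall _ _ (fun j z => `|g a y i j - g a z i j| <= 1) (nbhs y)) => j.
  by move: (@cg a y i j ay) => /cvgrPdist_le/(_ 1 ltr01).
have nU : nbhs y (img a) by apply: open_nbhs_nbhs; split => //; exact: open_img.
apply: filterS2 nU => z az H; split => // v.
apply: (@le_trans _ _ (m%:R * (M0 + 1) * `|v|)); last by rewrite ler_wpM2r// lerDl.
apply: norm_in_bound; first by rewrite lerDr.
move=> i j; have := H i j; have := gM i j => h1 h2.
rewrite -[g a z i j](subKr (g a y i j)).
by apply: le_trans (ler_normB _ _) _; exact: lerD.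
Qed.

Lemma reach_near p (e : R) : 0 < e -> \forall q \near p, reach g p q e.
Proof.
move=> e0; pose a := chart_at p.
have ap : dom a p by exact: chart_atP.
have [K K0 /nbhs_ballP[d /= d0 Hd]] := norm_in_locally_bounded (img_phi ap).
have r0 : 0 < Num.min d (e / 4 / K) by rewrite lt_min d0 !divr_gt0.
have nB : nbhs (phi a p) (ball (phi a p) (Num.min d (e / 4 / K))) by exact: nbhsx_ballx.
apply: filterS (near_chart ap nB) => q [aq].
rewrite -ball_normE /= distrC lt_min => /andP[bq1 bq2].
have B s : 0 <= s <= 1 -> ball (phi a p) d (phi a p + s *: (phi a q - phi a p)).
  move=> /andP[s0 s1]; rewrite -ball_normE /= opprD addrA subrr sub0r normrN normrZ ger0_norm//.
  by apply: le_lt_trans bq1; rewrite ler_piMl.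
have -> : e = 4 * (e / 4) by field.
have := @chart_segment_reach a (phi a p) (phi a q - phi a p) (e / 4).
rewrite [phi a p + (_ - _)]addrC subrK !phiK//; apply; first by rewrite divr_gt0.
  by move=> s /B/Hd[].
move=> s /B/Hd[_ /(_ (phi a q - phi a p))] H; apply: le_trans H _.
by rewrite mulrC -ler_pdivlMr// ltW.
Qed.

End ChartCurves.

(** * A variational principle on complete manifolds *)

Section Caristi.
Variables (R : realType) (m : nat) (X : manifold R m) (g : tensor2 X).
Hypothesis complete : complete_metric g.
Hypothesis reach_loc : forall p (e : R), 0 < e -> \forall q \near p, reach g p q e.
Variables (E : set X) (f : X -> R) (C : R).
Hypothesis C0 : 0 < C.
Hypothesis f_ge0 : forall p, E p -> 0 <= f p.
Hypothesis f_cont : forall p, E p -> {for p, continuous f}.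
Hypothesis E_closed : closed E.

Lemma reach_le p q T T' : T <= T' -> reach g p q T -> reach g p q T'.
Proof.
move=> TT [T0 [c [eta [e0 Cc c0 cT sc]]]].
split; first exact: lt_le_trans TT.
by exists c, eta; split => // t h; apply: cT; lra.
Qed.

(** Caristi's order: [q] lies in [E] and, up to an arbitrarily small error, can be
    reached from [p] in [C] times the decrease of [f]. *)
Definition descends (p q : X) : Prop :=
  E q /\ forall e, 0 < e -> reach g p q (C * (f p - f q) + e).

Lemma descends_refl p : E p -> descends p p.
Proof.
move=> Ep; split => // e e0; rewrite subrr mulr0 add0r.
exact: nbhs_singleton (reach_loc p e0).
Qed.

Lemma descends_trans p q r : descends p q -> descends q r -> descends p r.
Proof.
move=> [Eq pq] [Er qr]; split => // e e0.
have e2 : 0 < e / 2 by rewrite divr_gt0.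
have := reach_trans (pq _ e2) (qr _ e2).
apply: reach_le; lra.
Qed.

Lemma descends_le p q : descends p q -> f q <= f p.
Proof.
move=> [_ H]; rewrite leNgt; apply/negP => fpq.
have e0 : 0 < C * (f q - f p) by rewrite mulr_gt0// subr_gt0.
have [+ _] := H _ e0.
by rewrite -mulrDr addrA subrK subrr mulr0 ltxx.
Qed.

(* the infimum of f over the points to which p descends *)
Let low p := inf (f @` [set q | descends p q]).

Let has_inf_low p : E p -> has_inf (f @` [set q | descends p q]).
Proof.
move=> Ep; split; first by exists (f p); exists p => //; exact: descends_refl.
by exists 0 => _ [q [Eq _] <-]; exact: f_ge0.
Qed.

Let low_le p q : E p -> descends p q -> low p <= f q.
Proof. by move=> Ep pq; apply: ge_inf; [exact: (has_inf_low Ep).2 | exists q]. Qed.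

(* a point to which p descends and which realizes half of the possible gain *)
Let next_ex p : exists q, E p -> descends p q /\ f q <= (f p + low p) / 2.
Proof.
have [Ep|nE] := pselect (E p); last by exists p.
have mp : low p <= f p by apply: low_le => //; exact: descends_refl.
move: mp; rewrite le_eqVlt => /predU1P[mp|mp].
  by exists p => _; split; [exact: descends_refl | rewrite mp; lra].
have d0 : 0 < (f p - low p) / 2 by rewrite divr_gt0// subr_gt0.
have [_ [q pq <-] h] := inf_adherent d0 (has_inf_low Ep).
by exists q => _; split => //; apply: ltW; apply: lt_le_trans h _; rewrite -/(low p); lra.
Qed.

Let next p := sval (cid (next_ex p)).
Let nextP p : E p -> descends p (next p) /\ f (next p) <= (f p + low p) / 2.
Proof. exact: (svalP (cid (next_ex p))). Qed.

(** Iterating [next] gives a Cauchy sequence, whose limit [p] is below all its terms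
    for the order [descends].  A point strictly below [p] would be below all the
    terms too, which contradicts the choice of [next]. *)
Lemma caristi p0 : E p0 ->
  (forall p, E p -> 0 < f p -> exists2 q, descends p q & f q < f p) ->
  exists2 p, E p & f p = 0.
Proof.
move=> E0 H; pose x n := iter n next p0.
have Ex n : E (x n).
  by elim: n => [//|n IH]; have [[]] := nextP IH.
have xS n : descends (x n) (x n.+1) by have [] := nextP (Ex n).
have xx i j : (i <= j)%N -> descends (x i) (x j).
  move=> /subnKC <-; elim: (j - i)%N => [|k IH]; first by rewrite addn0; exact: descends_refl.
  by rewrite addnS; apply: descends_trans IH _; exact: xS.
have fdec : {homo (f \o x) : i j / (i <= j)%N >-> j <= i}.
  by move=> i j ij; apply: descends_le; exact: xx.
have fcv : cvgn (f \o x).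
  apply: nonincreasing_is_cvgn => //.
  by exists 0 => _ [n _ <-]; exact: f_ge0.
set l := limn (f \o x) in fcv *.
have fl : (f \o x) @ \oo --> l by [].
have lx n : l <= f (x n).
  exact: (nonincreasing_cvgn_ge fdec fcv n).
have cauchy (e : R) : 0 < e -> exists K : nat,
    forall i j, (K <= i)%N -> (K <= j)%N -> dist g (x i) (x j) < e.
  move=> e0; have e1 : 0 < e / (2 * C) by rewrite divr_gt0// mulr_gt0.
  move/cvgrPdist_lt: (fl) => /(_ _ e1) [K _ HK].
  have fK i : (K <= i)%N -> f (x i) < l + e / (2 * C).
    move=> Ki; have := HK i Ki; rewrite /= ltr_norml => /andP[+ _]; lra.
  have D i j : (K <= i)%N -> (i <= j)%N -> reach g (x i) (x j) (e / 2 + e / 4).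
    move=> Ki ij; have e4 : 0 < e / 4 by rewrite divr_gt0.
    have := (xx i j ij).2 _ e4; apply: reach_le; rewrite lerD2r.
    have h1 := fK i Ki; have h2 := lx j.
    have -> : e / 2 = C * (e / (2 * C)) by field; rewrite lt0r_neq0.
    rewrite ler_wpM2l ?(ltW C0)//; lra.
  have e34 : e / 2 + e / 4 < e by lra.
  exists K => i j Ki Kj; apply: le_lt_trans e34; apply: dist_le_reach.
  have [ij|/ltnW ji] := leqP i j; first exact: D.
  by apply: reach_sym; exact: D.
have [p xp] := complete cauchy.
have Ep : E p.
  by apply: (closed_cvg E E_closed _ p xp); apply: nearW.
have fp : f p = l.
  have fxp : (f \o x) @ \oo --> f p by apply: continuous_cvg xp; exact: f_cont.
  exact: (cvg_unique _ fxp fl).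
have xnp n : descends (x n) p.
  split => // e e0; have e2 : 0 < e / 2 by rewrite divr_gt0.
  have : \forall j \near \oo, reach g p (x j) (e / 2).
    exact: xp _ (reach_loc p e2).
  move=> [K _ HK]; pose j := maxn K n.
  have := reach_trans ((xx n j (leq_maxr _ _)).2 _ e2) (reach_sym (HK j (leq_maxl _ _))).
  apply: reach_le; rewrite -addrA -splitr lerD2r ler_wpM2l ?(ltW C0)//.
  by rewrite fp lerB//; exact: lx.
exists p => //; apply/eqP; rewrite eq_le f_ge0// andbT leNgt; apply/negP => fp0.
have [q pq fq] := H p Ep fp0.
have fn n : f (x n.+1) <= (f (x n) + f q) / 2.
  have [_ h] := nextP (Ex n); apply: le_trans h _.
  have := low_le (Ex n) (descends_trans (xnp n) pq) => h; lra.
have d0 : 0 < (l - f q) by rewrite subr_gt0 -fp.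
move/cvgrPdist_lt: (fl) => /(_ _ d0) [K _ HK].
have := HK K (leqnn K); rewrite /= ltr_norml => /andP[h1 h2].
have h3 := fn K; have h4 := lx K.+1; lra.
Qed.

End Caristi.

(** * The induced metric as a tensor *)

Section InducedTensor.
Variables (R : realType) (m : nat) (N : manifold R m) (gN : riemannian_metric N).
Variables (rbar : \bar R) (lam : R -> R) (hlam : warping_function rbar lam).
Variables (S : manifold R m) (F : S -> R * N) (hF : hypersurface rbar F).
Local Notation g := (induced_metric gN lam F).
Local Notation W := (wmetric gN lam).

Lemma induced_metric_transition (a a' : chart S) y : img a y -> dom a' (psi a y) ->
  g a y = 'J (phi a' \o psi a) y *m g a' (phi a' (psi a y)) *m ('J (phi a' \o psi a) y)^T.
Proof.
move=> ay a'y; pose b := chart_at (F (psi a y)).2; pose y' := phi a' (psi a y).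
have by_ : Fdom F a b y by split => //; exact: chart_atP.
have by' : Fdom F a' b y'.
  by split; [exact: img_phi | rewrite /y' phiK//; exact: chart_atP].
rewrite (induced_metricE gN lam hF by_) (induced_metricE gN lam hF by').
have dT := transition_differentiable ay a'y.
have dF := Floc_differentiable hF by'.
have FE : \forall z \near y, Floc F a b z = (Floc F a' b \o (phi a' \o psi a)) z.
  have : nbhs y [set z | img a z /\ dom a' (psi a z)].
    by apply: open_nbhs_nbhs; split => //; exact: open_transition_dom.
  by apply: filterS => z [az a'z] /=; rewrite /Floc phiK.
have JE : 'J (Floc F a b) y = 'J (phi a' \o psi a) y *m 'J (Floc F a' b) y'.
  rewrite -(jacobian_comp dT dF).
  apply/matrixP => i j.
  apply: (etrans (jacobianE i j (Floc_differentiable hF by_))).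
  apply: (etrans _ (esym (jacobianE i j (differentiable_comp dT dF)))).
  by apply: pd_near_eq; apply: filterS FE => z ->.
rewrite JE trmx_mul.
have -> : Floc F a b y = Floc F a' b y' by rewrite (nbhs_singleton FE).
by rewrite !mulmxA.
Qed.

Lemma induced_metric_continuous (a : chart S) y i j : img a y ->
  {for y, continuous (fun z => g a z i j)}.
Proof.
move=> ay; pose b := chart_at (F (psi a y)).2.
have by_ : Fdom F a b y by split => //; exact: chart_atP.
have oU := @Fdom_open _ _ _ _ _ _ hF a b.
have sX := @Floc_smooth _ _ _ _ _ _ hF a b.
have nU : nbhs y (Fdom F a b) by apply: open_nbhs_nbhs.
have E : \forall z \near y, \sum_A \sum_B tanv (Floc F a b) z i 0 A * W b (Floc F a b z) A B
     * tanv (Floc F a b) z j 0 B = g a z i j.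
  apply: filterS nU => z bz.
  by rewrite (induced_metricE gN lam hF bz) bil_entry bilE !(tanvE oU sX).
apply: continuous_near E _.
apply: (@cvg_sum_fin R _ (nbhs y)) => A; apply: (@cvg_sum_fin R _ (nbhs y)) => B.
have ct k A' : (fun z => tanv (Floc F a b) z k 0 A') @ y --> tanv (Floc F a b) y k 0 A'.
  have -> : (fun z => tanv (Floc F a b) z k 0 A') = pd k (fun z => Floc F a b z 0 A').
    by apply/funext => z; rewrite mxE.
  rewrite mxE; exact: smooth_continuous (smooth_pd k (sX A')) by_.
have cW : (fun z => W b (Floc F a b z) A B) @ y --> W b (Floc F a b y) A B.
  apply: (@continuous_comp _ _ _ (Floc F a b) (fun x => W b x A B)).
    by apply: differentiable_continuous; exact: Floc_differentiable hF _ _ _ by_.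
  apply: differentiable_continuous.
  have [r0 rr] : 0 <= height F (psi a y) /\ ((height F (psi a y))%:E < rbar)%E.
    by case: hF => H _ _ _; exact: H.
  by apply: (wmetric_differentiable gN hlam (Floc_img by_)); rewrite Floc_l.
by apply: cvgM (ct j B); apply: cvgM (ct i A) cW.
Qed.

End InducedTensor.

(** * Complete hypersurfaces of constant height *)

Section Slice.
Variables (R : realType) (m : nat) (N : manifold R m) (gN : riemannian_metric N).
Variables (rbar : \bar R) (lam : R -> R) (hlam : warping_function rbar lam).
Variables (S : manifold R m) (F : S -> R * N) (hF : hypersurface rbar F).
Local Notation g := (induced_metric gN lam F).
Local Notation W := (wmetric gN lam).
Hypothesis complete : complete_metric g.
Variable r0 : R.
Hypothesis hr0 : forall p, height F p = r0.

Let lam0 : 0 < lam r0.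
Proof.
have [p _] := manifold_nonempty S.
by rewrite -(hr0 p); exact: (lam_height_gt0 hlam hF).
Qed.

Section Projection.
Variables (a : chart S) (b : chart N).

(** The projection to N in the charts [a] and [b]. *)
Definition ploc (y : 'rV[R]_m) : 'rV[R]_m := phi b (F (psi a y)).2.

Let FlocE : Floc F a b = fun y => row_mx (r0%:M : 'M[R]_1) (ploc y).
Proof. by apply/funext => y; rewrite /Floc /wcoord -(hr0 (psi a y)). Qed.

Lemma ploc_smooth : smooth_map (Fdom F a b) ploc.
Proof.
move=> j; have := @Floc_smooth _ _ _ _ _ _ hF a b (rshift 1 j).
have -> : (fun y => Floc F a b y 0 (rshift 1 j)) = (fun y => ploc y 0 j).
  by apply/funext => y; rewrite FlocE row_mxEr.
by [].
Qed.

Lemma ploc_differentiable y : Fdom F a b y -> differentiable ploc y.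
Proof. by apply: smooth_map_differentiable; [exact: (Fdom_open hF) | exact: ploc_smooth]. Qed.

Let derive_Floc y v : Fdom F a b y -> 'D_v (Floc F a b) y = row_mx 0 ('D_v ploc y).
Proof.
move=> by_; rewrite FlocE derive_row_mx//; last exact: ploc_differentiable.
by rewrite derive_cst.
Qed.

(** Up to the factor lambda(r0) the projection preserves lengths. *)
Lemma norm_in_induced y v : Fdom F a b y ->
  norm_in (g a y) v = lam r0 * norm_in (gcomp gN b (ploc y)) ('D_v ploc y).
Proof.
move=> by_; rewrite /norm_in -!/(bil _ _ _) (induced_metricE gN lam hF by_).
have -> : bil ('J (Floc F a b) y *m W b (Floc F a b y) *m ('J (Floc F a b) y)^T) v v =
  bil (W b (Floc F a b y)) (v *m 'J (Floc F a b) y) (v *m 'J (Floc F a b) y).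
  by rewrite /bil trmx_mul !mulmxA.
rewrite -deriveEjacobian; last exact: Floc_differentiable hF _ _ _ by_.
rewrite derive_Floc// bil_wmetric row_mxKl !row_mxKr [in X in X + _]mxE mul0r add0r.
by rewrite Floc_l hr0 sqrtrM ?sqr_ge0// sqrtr_sqr gtr0_norm.
Qed.

Lemma ploc_jacobian_unit y : Fdom F a b y -> 'J ploc y \in unitmx.
Proof.
move=> by_; rewrite -row_free_unit -kermx_eq0; apply/negPn/negP => /rowV0Pn[v].
move=> /sub_kermxP vJ v0.
have /row_freeP[B JB] := Floc_row_free hF by_.
move: v0; rewrite -[v]mulmx1 -JB mulmxA.
rewrite -deriveEjacobian; last exact: Floc_differentiable hF _ _ _ by_.
rewrite derive_Floc// deriveEjacobian ?vJ ?row_mx0 ?mul0mx ?eqxx//.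
exact: ploc_differentiable.
Qed.

Lemma derive_ploc_continuous y v : Fdom F a b y ->
  {for y, continuous (fun z => 'D_v ploc z)}.
Proof.
move=> by_; apply: continuous_row => j.
have nU : nbhs y (Fdom F a b) by apply: open_nbhs_nbhs; split => //; exact: (Fdom_open hF).
have E : \forall z \near y, \sum_i v 0 i * pd i (fun z => ploc z 0 j) z = ('D_v ploc z) 0 j.
  apply: filterS nU => z bz; have dz := ploc_differentiable bz.
  by rewrite derive_entry// deriveE_pd//; exact: differentiable_entry.
apply: continuous_near E _.
apply: (@cvg_sum_fin R _ (nbhs y) _ m (fun i z => v 0 i * pd i (fun z => ploc z 0 j) z)) => i.
by apply: cvgMr; exact: smooth_continuous (smooth_pd i (@ploc_smooth j)) by_.
Qed.

End Projection.

(** Let the metric of N be at most [K] times the norm of the chart [b] on [D], and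
    let [p] project into [D].  The tangent vector [v] at [p] that projects to
    z - w points towards z; after a short step s v the distance to z has dropped by
    at least s |z - w| / 2, and the cost is at most 8 lambda(r0) K s |z - w|. *)
Lemma lift_step (b : chart N) (D : set 'rV[R]_m) (K : R) (p : S) (z : 'rV[R]_m) :
  open D -> 0 < K ->
  (forall w, D w -> forall v, norm_in (gcomp gN b w) v <= K * `|v|) ->
  dom b (F p).2 -> D (phi b (F p).2) -> phi b (F p).2 != z ->
  exists p', [/\ dom b (F p').2,
    `|phi b (F p').2 - z| < `|phi b (F p).2 - z| &
    reach g p p' (16 * lam r0 * K * (`|phi b (F p).2 - z| - `|phi b (F p').2 - z|))].
Proof.
move=> oD K0 HK bp Dp wz; pose a := chart_at p; pose y := coord_at p.
have pE : psi a y = p by exact: psi_coord_at.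
have by_ : Fdom F a b y by split; [exact: coord_at_img | rewrite pE].
set w := phi b (F p).2 in wz Dp *.
have wE : ploc a b y = w by rewrite /ploc pE.
pose e := z - w.
have e0 : 0 < `|e| by rewrite normr_gt0 subr_eq0 eq_sym.
have dP := ploc_differentiable by_.
pose v := e *m invmx ('J (ploc a b) y).
have De : 'D_v (ploc a b) y = e.
  by rewrite deriveEjacobian// /v mulmxKV//; exact: ploc_jacobian_unit.
(* near p the projection stays in D and maps v to vectors of norm at most
   2 |z - w| *)
have near1 : \forall x \near y, [/\ Fdom F a b x, D (ploc a b x) & `|'D_v (ploc a b) x| <= 2 * `|e|].
  have nU : nbhs y (Fdom F a b) by apply: open_nbhs_nbhs; split => //; exact: (Fdom_open hF).
  have nD : \forall x \near y, D (ploc a b x).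
    apply: near_preimage; first exact: differentiable_continuous.
    by apply: open_nbhs_nbhs; split => //; rewrite wE.
  have nd : \forall x \near y, `|e - 'D_v (ploc a b) x| <= `|e|.
    have := @derive_ploc_continuous a b y v by_; rewrite /prop_for /continuous_at De.
    by move/cvgrPdist_le => /(_ _ e0).
  apply: filterS3 nU nD nd => x h1 h2 h3; split => //.
  rewrite -['D_v _ _](subKr e); apply: le_trans (ler_normB _ _) _; lra.
have [d /= d0 Hd] := (nbhs_ballP _ _).1 near1.
have : \forall h \near (0:R)^', `|e - h^-1 *: ((ploc a b \o shift y) (h *: v) - ploc a b y)| <= `|e| / 2.
  have Dv : derivable (ploc a b) y v by exact: diff_derivable.
  have e2 : 0 < `|e| / 2 by rewrite divr_gt0.
  have C : (fun h : R => h^-1 *: ((ploc a b \o shift y) (h *: v) - ploc a b y)) @ 0^' --> e.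
    by rewrite -De; exact: Dv.
  by move/cvgrPdist_le: C => /(_ _ e2).
move=> [eta /= eta0 Heta].
(* s is small enough for the first order expansion, the condition s <= 1 and the
   segment to stay in the ball of radius d *)
pose s := Num.min (Num.min (eta / 2) 1) (d / 2 / (`|v| + 1)).
have v1 : 0 < `|v| + 1 by rewrite ltr_wpDl.
have s0 : 0 < s by rewrite !lt_min !divr_gt0// ltr01.
have s1 : s <= 1 by rewrite /s !ge_min lexx orbT.
have se : s < eta.
  by rewrite /s; apply: le_lt_trans (_ : eta / 2 < _); [rewrite !ge_min lexx | lra].
have sd : s * `|v| < d.
  apply: (@le_lt_trans _ _ (d / 2 / (`|v| + 1) * (`|v| + 1))).
    by apply: ler_pM; rewrite ?(ltW s0)// ?lerDl// /s ge_min lexx orbT.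
  by rewrite divfK ?lt0r_neq0//; lra.
have Bs t : 0 <= t <= 1 -> ball y d (y + t *: (s *: v)).
  move=> /andP[t0 t1]; rewrite -ball_normE /= opprD addrA subrr sub0r normrN.
  rewrite !normrZ (ger0_norm t0) (gtr0_norm s0); apply: le_lt_trans sd.
  by rewrite ler_piMl// mulr_ge0// ltW.
have Q : `|e - s^-1 *: (ploc a b (s *: v + y) - w)| <= `|e| / 2.
  have := Heta s; rewrite /= sub0r normrN gtr0_norm// => /(_ se (lt0r_neq0 s0)).
  by rewrite wE.
pose p' := psi a (y + s *: v).
have [[_ bp'] _ _] : [/\ Fdom F a b (y + s *: v), D (ploc a b (y + s *: v))
    & `|'D_v (ploc a b) (y + s *: v)| <= 2 * `|e|].
  by rewrite -[s *: v]scale1r; apply: Hd; apply: Bs; rewrite ler01 lexx.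
have we : `|w - z| = `|e| by rewrite distrC.
have gain : `|ploc a b (y + s *: v) - z| <= `|e| - s * (`|e| / 2).
  rewrite [y + _]addrC; move: Q; set P1 := ploc a b _ => Q.
  have -> : P1 - z = - (s *: (e - s^-1 *: (P1 - w))) - (1 - s) *: e.
    rewrite scalerBr scalerA mulfV ?lt0r_neq0// scale1r scalerBl scale1r /e.
    by apply/rowP => j; rewrite !mxE; ring.
  apply: le_trans (ler_normB _ _) _.
  rewrite normrN !normrZ gtr0_norm// ger0_norm ?subr_ge0//.
  have := ler_wpM2l (ltW s0) Q; lra.
have sE : 0 < s * (`|e| / 2) by rewrite mulr_gt0// divr_gt0.
exists p'; split => //.
  by rewrite we; apply: le_lt_trans gain _; lra.
have B0 : 0 < lam r0 * K * (s * (2 * `|e|)) by rewrite !mulr_gt0.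
have := @chart_segment_reach _ _ _ g (induced_metric_transition gN lam hF) a y (s *: v) _ B0.
rewrite pE => H.
apply: (@reach_le _ _ _ _ _ _ (4 * (lam r0 * K * (s * (2 * `|e|))))); last first.
  apply: H => t t01; have [Ft Dt dt] := Hd _ (Bs t t01); first by case: Ft.
  rewrite norm_in_scale gtr0_norm// (norm_in_induced v Ft).
  have h := HK _ Dt ('D_v (ploc a b) (y + t *: (s *: v))).
  rewrite mulrCA -(mulrA (lam r0) K); apply: ler_wpM2l; first exact: ltW.
  rewrite [leRHS]mulrCA; apply: ler_wpM2l; first exact: ltW.
  by apply: le_trans h _; rewrite ler_pM2l.
rewrite we.
have g2 : s * (`|e| / 2) <= `|e| - `|phi b (F p').2 - z| by move: gain; rewrite /ploc -/p'; lra.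
have l16 : 0 <= 16 * lam r0 * K by rewrite !mulr_ge0// ltW.
by apply: le_trans (ler_wpM2l l16 g2); lra.
Qed.

(** Points of the ball of radius rho = d / 4 have distance at most 2 rho, so that
    the points of [A], within 2 rho of [z], stay in the ball of radius d where the
    metric is controlled.  [E] is closed because the compact set [psi b @` A] is
    closed in the Hausdorff space N. *)
Lemma slice_covers (q0 : N) : exists V : set N, nbhs q0 V /\
  forall p0, V (F p0).2 -> forall q, V q -> exists p, (F p).2 = q.
Proof.
pose b := chart_at q0; have bq0 : dom b q0 by exact: chart_atP.
pose z0 := phi b q0; have iz0 : img b z0 by exact: img_phi.
have [|K K0 near0] := @norm_in_locally_bounded R m N (gcomp gN) _ b z0 iz0.
  move=> c y i j cy; exact: (smooth_continuous (@metric_smooth _ _ _ gN c i j) cy).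
have [d /= d0 Hd] := (nbhs_ballP _ _).1 near0.
pose rho := d / 4; have rho0 : 0 < rho by rewrite divr_gt0.
have nB : nbhs z0 (ball z0 rho) by exact: nbhsx_ballx.
exists [set q | dom b q /\ ball z0 rho (phi b q)]; split; first exact: near_chart nB.
move=> p0 [bp0 Bp0] q [bq Bq]; pose z := phi b q.
pose f p := `|phi b (F p).2 - z|.
pose A := [set w : 'rV[R]_m | `|w - z| <= 2 * rho].
have A_ball w : A w -> ball z0 d w.
  rewrite /A /= -ball_normE /= => wz; move: Bq; rewrite -ball_normE /= -/z => z0z.
  rewrite -(subrKA z z0 (- w)); apply: le_lt_trans (ler_normD _ _) _.
  by rewrite (distrC z w) /rho in wz z0z *; lra.
pose E := [set p | dom b (F p).2 /\ A (phi b (F p).2)].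
have cA : closed A.
  have cn : continuous (fun w : 'rV[R]_m => `|w - z|).
    move=> w; apply: (@cvg_norm _ _ _ (nbhs w) _ (fun w => w - z)).
    by apply: cvgB; [exact: cvg_id | exact: cvg_cst].
  have -> : A = (fun w => `|w - z|) @^-1` [set x | x <= 2 * rho] by [].
  by apply: preimage_closed; [move=> w _; exact: cn | exact: closed_le].
have bA : bounded_set A.
  exists (2 * rho + `|z|); split; first exact: num_real.
  move=> M hM w; rewrite /A /= => wz; apply: ltW; apply: le_lt_trans hM.
  by rewrite -[w](subrK z); apply: le_trans (ler_normD _ _) _; rewrite lerD2r.
have kA : compact A by exact: bounded_closed_compact.
have cE : closed E.
  have kpA : closed (psi b @` A).
    apply: compact_closed; first exact: manifold_hausdorff.
    apply: continuous_compact kA; apply: continuous_in_subspaceT => w.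
    by rewrite inE => Aw; apply: psi_continuous; have [] := Hd _ (A_ball _ Aw).
  have -> : E = (fun p => (F p).2) @^-1` (psi b @` A).
    apply/seteqP; split => p /=.
      by move=> [bp Ap]; exists (phi b (F p).2) => //; rewrite phiK.
    rewrite /E /= => -[w Aw <-]; have [iw _] := Hd _ (A_ball _ Aw).
    by split; [exact: psi_dom | rewrite psiK].
  apply: preimage_closed; last exact: kpA.
  move=> p _; by apply: (@continuous_comp _ _ _ F snd); [case: hF => _ + _ _; exact | exact: cvg_snd].
have E0 : E p0.
  split => //; rewrite /A /=; move: Bp0 Bq; rewrite -ball_normE /= -/z => h1 h2.
  rewrite -(subrKA z0 (phi b (F p0).2) (- z)); apply: le_trans (ler_normD _ _) _.
  by rewrite (distrC _ z0); lra.
have cF p : {for p, continuous (fun p => (F p).2)}.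
  by apply: (@continuous_comp _ _ _ F snd); [case: hF => _ + _ _; exact | exact: cvg_snd].
have f_cont p : E p -> {for p, continuous f}.
  move=> [bp _]; apply: (@cvg_norm _ _ _ (nbhs p) _ (fun p => phi b (F p).2 - z)).
  apply: cvgB; last exact: cvg_cst.
  exact: (@continuous_comp _ _ _ (fun p => (F p).2) (phi b) p (cF p) (phi_continuous bp)).
have C0 : 0 < 16 * lam r0 * K by rewrite !mulr_gt0.
have [p Ep fp] : exists2 p, E p & f p = 0.
  apply: (@caristi _ _ _ g complete _ E f _ C0 _ f_cont cE p0 E0).
  - move=> p e; apply: reach_near; first exact: induced_metric_transition hF.
    by move=> a y i j ay; exact: (@induced_metric_continuous _ _ _ gN _ _ hlam _ _ hF).
  - by move=> p _; exact: normr_ge0.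
  move=> p [bp Ap] fp.
  have oD : open (ball z0 d) by exact: ball_open.
  have HK w : ball z0 d w -> forall v, norm_in (gcomp gN b w) v <= K * `|v|.
    by move=> /Hd[].
  have wz : phi b (F p).2 != z by move: fp; rewrite normr_gt0 subr_eq0.
  have [p' [bp' lt' rp']] := lift_step oD K0 HK bp (A_ball _ Ap) wz.
  exists p' => //; split.
    by split => //; apply: le_trans (ltW lt') _.
  by move=> e e0; apply: reach_le rp'; rewrite lerDl ltW.
exists p; case: Ep => bp _.
move/eqP: fp; rewrite normr_eq0 subr_eq0 => /eqP zE.
by rewrite -(phiK bp) zE /z phiK.
Qed.

(** By [slice_covers] the image of the projection is open and closed. *)
Lemma slice_surjective (q : N) : exists p, (F p).2 = q.
Proof.
apply: (@manifold_clopen _ _ N [set q | exists p, (F p).2 = q]).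
- by have [p _] := manifold_nonempty S; exists (F p).2, p.
- move=> q0 [p0 pq0]; have [V [nV HV]] := slice_covers q0.
  apply: filterS (nV) => q' Vq'; apply: (HV p0) => //.
  by rewrite pq0; exact: nbhs_singleton nV.
- move=> q0 nq0; have [V [nV HV]] := slice_covers q0.
  apply: filterS (nV) => q' Vq' [p' pq']; apply: nq0.
  by apply: (HV p'); [rewrite pq' | exact: nbhs_singleton nV].
Qed.

End Slice.

(** * Rigidity *)

Theorem theorem1p3 (R : realType) (n k : nat) (hk : (k.*2 < n.-1)%N)
  (N : manifold R n.-1) (gN : riemannian_metric N)
  (rbar : \bar R) (hrbar : (0 < rbar)%E)
  (lam : R -> R) (hlam : warping_function rbar lam)
  (S : manifold R n.-1) (F : S -> R * N) (hF : hypersurface rbar F)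
  (nu : chart N -> S -> 'rV[R]_(1 + n.-1)) (hnu : unit_normal gN lam F nu)
  (hstar : star_shaped gN lam F nu)
  (hcomplete : complete_metric (induced_metric gN lam F))
  (r1 r2 : R) (hr1 : 0 <= r1) (hr12 : r1 <= r2) (hr2 : (r2%:E < rbar)%E)
  (hslab : forall p, r1 <= height F p <= r2)
  (hsemi : semi_definite (einstein_tensor (induced_metric gN lam F) k))
  (hOY : omori_yau (induced_metric gN lam F)
     (trace_op (induced_metric gN lam F)
        (fun p => - 2 *: einstein_tensor (induced_metric gN lam F) k p)))
  (C1 C2 : R) (hC1 : 0 < C1)
  (hH : forall p, C1 <= H_even gN lam F k p <= C2)
  (hquot : forall p, H_odd gN lam F nu k p / H_even gN lam F k p <=
     (n.-1 - k.*2)%:R * (derive1 lam (height F p) / lam (height F p)))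
  (hgrad : forall p, norm_grad (induced_metric gN lam F) (height F) p <=
     inf (range (fun q =>
       (n.-1 - k.*2)%:R * (derive1 lam (height F q) / lam (height F q))
       - H_odd gN lam F nu k q / H_even gN lam F k q))) :
  exists r0 : R, [/\ 0 <= r0, (r0%:E < rbar)%E
    & range F = [set q | q.1 = r0]].
Proof.
have hD p : 0 <= (n.-1 - k.*2)%:R * (derive1 lam (height F p) / lam (height F p))
    - H_odd gN lam F nu k p / H_even gN lam F k p by rewrite subr_ge0.
have inf0 := inf_deficit_le0 hk hlam hF hnu hstar hr1 hr12 hr2 hslab hOY hC1 hH hD.
(* |grad r| <= inf D <= 0 *)
have dr0 p : norm_grad (induced_metric gN lam F) (height F) p = 0.
  apply/eqP; rewrite eq_le sqrtr_ge0 andbT.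
  exact: le_trans (hgrad p) inf0.
have [r0 hr0] : exists r0, forall p, height F p = r0.
  apply: constant_of_pd0; first exact: (height_smooth hF).
  by move=> p; apply: (norm_grad_eq0 hlam hF).
have [p0 _] := manifold_nonempty S.
exists r0; split.
- by rewrite -(hr0 p0); case: hF => H _ _ _; case: (H p0).
- by rewrite -(hr0 p0); case: hF => H _ _ _; case: (H p0).
apply/seteqP; split => [_ [p _ <-]|[r q] /= ->]; first exact: hr0.
have [p pq] := slice_surjective hlam hF hcomplete hr0 q.
by exists p => //; rewrite -pq -(hr0 p) /height -surjective_pairing.
Qed.
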